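(* Let $H\in\mathcal{H}_2$ and let $n_0,r$ be positive integers with $n_0\ge 2r$. Given an initial $\boldsymbol\mu^0\in\mathbb{C}_+^{n_0}$, let $\boldsymbol\mu^{\ell+1}=[\boldsymbol\mu^\ell\ \boldsymbol\mu_\star^\ell]$ (concatenation) where $\boldsymbol\mu_\star^\ell\in\mathbb{C}_+^{n_\ell}$, and suppose the entries of $\boldsymbol\mu^\ell$ are distinct for all $\ell$. Let $\widehat H_r^\ell\in\mathcal{R}_r^+(\mathbb{C})$ be a locally optimal solution of the projected problem $\min_{H_r\in\mathcal{R}_r^+(\mathbb{C})}\|P(\boldsymbol\mu^\ell)[H-H_r]\|_{\mathcal{H}_2}$ satisfying $\|Q(\boldsymbol\lambda^\ell)P(\boldsymbol\mu^\ell)[H-\widehat H_r^\ell]\|_{\mathcal{H}_2}=0$, where $\boldsymbol\lambda^\ell$ are the poles of $\widehat H_r^\ell$. If $\widehat H_r^\ell\to\widehat H_r\in\mathcal{H}_2$ in the $\mathcal{H}_2$ norm, where $\widehat H_r$ has $r$ distinct poles $\boldsymbol\lambda\in\mathbb{C}_-^r$, and the sequence $\{\boldsymbol\mu_\star^\ell\}_{\ell=0}^\infty$ has limit points $-\overline{\boldsymbol\lambda}$ (i.e. each $-\overline{\lambda_j}$ is a limit point of the entries of the $\boldsymbol\mu_\star^\ell$), then $\widehat H_r$ satisfies the first order necessary conditions of the $\mathcal{H}_2$ problem, i.e. $\|Q(\boldsymbol\lambda)[H-\widehat H_r]\|_{\mathcal{H}_2}=0$ (the Meier–Luenberger conditi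ons).
   Context: $\mathcal{H}_2$ is the Hilbert space of functions analytic in the right half-plane with inner product $\langle F,G\rangle_{\mathcal{H}_2}=\frac{1}{2\pi}\int_{-\infty}^{\infty}\overline{F(\mathrm{i}\omega)}G(\mathrm{i}\omega)\,d\omega$. $\mathbb{C}_+=\{\operatorname{Re}z>0\}$, $\mathbb{C}_-=\{\operatorname{Re}z<0\}$. $\mathcal{R}_r^+(\mathbb{C})$ is the set of rational functions $p/q$ with $p,q$ complex polynomials of degree at most $r-1$ and $r$ respectively and all roots of $q$ in $\mathbb{C}_-$ (equivalently, transfer functions $c^*(zI-A)^{-1}b$ of stable order-$r$ state-space systems). For $\mu\in\mathbb{C}_+$, $v[\mu](z)=(z+\overline\mu)^{-1}$ (so $\langle v[\mu],F\rangle_{\mathcal{H}_2}=F(\mu)$) and $v[\mu]'(z)=-(z+\overline\mu)^{-2}$. For $\boldsymbol\mu\in\mathbb{C}_+^n$, $P(\boldsymbol\mu)$ is the orthogonal projector onto $\operatorname{span}\{v[\mu_k]\}_{k=1}^n$. For $\boldsymbol\lambda\in\mathbb{C}_-^r$, $Q(\boldsymbol\lambda)$ is the orthogonal projector onto $\mathcal{T}(\boldsymbol\lambda)=\operatorname{span}\{v[-\overline{\lambda_j}],v[-\overline{\lambda_j}]'\}_{j=1}^r$. The condition $\|Q(\boldsymbol\lambda)[H-H_r]\|_{\mathcal{H}_2}=0$ for $H_r$ with poles $\boldsymbol\lambda$ is the first order optimality condition for $\min_{H_r}\|H-H_r\|_{\mathcal{H}_2}$, equivalent to $H_r$ Hermite-interpolating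 $H$ at $-\overline{\lambda_j}$. *)

(* Defs.v *)
From HB Require Import structures.
From mathcomp Require Import all_boot all_order all_algebra.
From mathcomp Require Import all_classical all_reals all_analysis.
From mathcomp Require Import complex.
From Stdlib Require Import ClassicalEpsilon.

Set Implicit Arguments.
Unset Strict Implicit.
Unset Printing Implicit Defensive.

Import Order.TTheory GRing.Theory Num.Theory.
Import numFieldNormedType.Exports.

Local Open Scope ring_scope.
Local Open Scope classical_set_scope.

Section H2space.
Variable R : realType.
Local Notation C := R[i].

Definition Cplus (z : C) : Prop := 0 < complex.Re z.
Definition Cminus (z : C) : Prop := complex.Re z < 0.

Definition holomorphic_on (D : set C) (F : C -> C) : Prop :=
  forall z, D z -> exists d : C, forall e : R, 0 < e ->
    exists2 del : R, 0 < del & forall h : C, h != 0 -> `|h| < (del%:C)%C ->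
      `|(F (z + h) - F z) / h - d| < (e%:C)%C.

Definition abs2 (z : C) : R := complex.Re z ^+ 2 + complex.Im z ^+ 2.

Definition in_H2 (F : C -> C) : Prop :=
  holomorphic_on Cplus F /\
  exists M : R, forall x : R, 0 < x ->
    (\int[@lebesgue_measure R]_(w in setT) (abs2 (F (Complex x w)))%:E
       <= M%:E)%E.

Definition ip_line (F G : C -> C) (x : R) : C :=
  Complex
    ((2 * pi)^-1 * \int[@lebesgue_measure R]_(w in setT)
        complex.Re (conjc (F (Complex x w)) * G (Complex x w)))
    ((2 * pi)^-1 * \int[@lebesgue_measure R]_(w in setT)
        complex.Im (conjc (F (Complex x w)) * G (Complex x w))).

(* H_2 inner product <F,G> = (1/2pi) \int conj(F(iw)) G(iw) dw, where the
   boundary values F(iw) are the (L^2-)limits of F(x+iw) as x -> 0+ *)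
Definition ip (F G : C -> C) : C :=
  Complex (lim ((fun x => complex.Re (ip_line F G x)) @ 0^'+))
          (lim ((fun x => complex.Im (ip_line F G x)) @ 0^'+)).

Definition h2norm (F : C -> C) : R := Num.sqrt (complex.Re (ip F F)).

Definition fsub (F G : C -> C) : C -> C := fun z => F z - G z.

Definition span (S : seq (C -> C)) (g : C -> C) : Prop :=
  exists c : 'I_(size S) -> C,
    g = (fun z => \sum_(i < size S) c i * nth (fun _ => 0) S i z).

Definition orth_proj (S : seq (C -> C)) (F : C -> C) : C -> C :=
  epsilon (inhabits (fun _ : C => 0))
    (fun g => span S g /\
       forall i : 'I_(size S), ip (nth (fun _ => 0) S i) (fsub F g) = 0).

Definition vker (mu : C) : C -> C := fun z => (z + conjc mu)^-1.
Definition dvker (mu : C) : C -> C := fun z => - (z + conjc mu) ^- 2.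

Definition Pproj (mu : seq C) : (C -> C) -> (C -> C) :=
  orth_proj [seq vker m | m <- mu].

Definition Tfam (lam : seq C) : seq (C -> C) :=
  flatten [seq [:: vker (- conjc l); dvker (- conjc l)] | l <- lam].

Definition Qproj (lam : seq C) : (C -> C) -> (C -> C) := orth_proj (Tfam lam).

(* R_r^+(C): p/q with deg p <= r-1, deg q = r (a stable order-r system
   c^*(zI-A)^{-1}b), all roots of q in C_-; functions are compared on C_+,
   where H_2 elements live *)
Definition in_Rr (r : nat) (F : C -> C) : Prop :=
  exists p q : {poly C},
    [/\ (size p <= r)%N, size q = r.+1,
        (forall z, root q z -> Cminus z) &
        (forall z, Cplus z -> F z = p.[z] / q.[z])].

Definition poles_of (F : C -> C) (lam : seq C) : Prop :=
  exists p q : {poly C},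
    [/\ q != 0, coprimep p q,
        (forall z, Cplus z -> F z = p.[z] / q.[z]),
        uniq lam &
        (forall z, (z \in lam) = root q z)].

Definition loc_opt_proj (r : nat) (H : C -> C) (mu : seq C) (F : C -> C) :
  Prop :=
  in_Rr r F /\
  exists2 e : R, 0 < e & forall G, in_Rr r G -> h2norm (fsub G F) < e ->
    h2norm (Pproj mu (fsub H F)) <= h2norm (Pproj mu (fsub H G)).

Definition limit_point_of_entries (s : nat -> seq C) (p : C) : Prop :=
  forall e : R, 0 < e -> forall N : nat,
    exists2 l : nat, (N <= l)%N & exists2 m : C, m \in s l & `|m - p| < (e%:C)%C.

End H2space.

(* Main.v *)
(** Write E = H - Hr, p = - conj lam_j, let P_l be the projector onto the span of the
    kernels v[mu], mu in mu^l, and put g_l = P_l (H - Hhat_l).  Then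
      E = (H - Hhat_l - g_l) + g_l + (Hhat_l - Hr)
    and each summand, together with its derivative, is small at p.  The first one has
    bounded norm and vanishes at two distinct entries of mu^l close to p.  The second
    one also has bounded norm and, by the optimality condition, a double zero at the
    mirror image of a pole of Hhat_l close to lam_j: the poles of Hhat_l approach
    those of Hr because the rational functions converge at many points of the
    half-plane.  The third one has small norm.  Hence E(p) = E'(p) = 0.

    Norms control values because of the reproducing property <v[p], F> = F(p).  It is
    Cauchy's formula on the vertical lines Re z = x, obtained from Goursat's theorem on
    rectangles; the horizontal sides are harmless at suitable heights, found by
    Tonelli's theorem from the square integrability of F on vertical lines. *)

Require Import Defs.
From HB Require Import structures.
From mathcomp Require Import all_boot all_order all_algebra.
From mathcomp Require Import all_classical all_reals all_analysis.
From mathcomp Require Import measurable_realfun complex ring lra zify.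
Import Order.TTheory GRing.Theory Num.Theory.
Import numFieldNormedType.Exports.
Set Implicit Arguments.
Unset Strict Implicit.
Unset Printing Implicit Defensive.
Local Open Scope ring_scope.
Local Open Scope classical_set_scope.

(** The obstacle is that [ip] is a [lim] as x -> 0+, which has a value even where nothing converges,
    and the convergence of the line integrals of |F|^2 is not established here for a general [F] in
    H2. Two substitutes are used. The first argument of [ip] is restricted to functions whose
    pairing with all of H2 converges ([h2kernel]): v[p], v[p]' and their combinations qualify, hence
    so do all the projections. The norm of [F] is replaced by an upper bound for its line integrals
    close to the imaginary axis ([nbd]). The convergence hypothesis does speak of [h2norm], but of a
    rational function, for which dominated convergence provides the limit. No constant is sharp,
    because a weighted AM-GM inequality, integrated pointwise, stands in for Cauchy-Schwarz. *)

Notation nc := Normc.normc.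

(** * The complex modulus as a real number *)

Section ComplexModulus.
Variable R : realType.
Local Notation C := R[i].
Implicit Types (z w : C) (a b : R).

Lemma ncE z : nc z = Num.sqrt (complex.Re z ^+ 2 + complex.Im z ^+ 2).
Proof. by case: z. Qed.

Lemma nc_ge0 z : 0 <= nc z.
Proof. by rewrite ncE sqrtr_ge0. Qed.

Lemma nc_sqr z : nc z ^+ 2 = complex.Re z ^+ 2 + complex.Im z ^+ 2.
Proof. by rewrite ncE sqr_sqrtr // addr_ge0 // sqr_ge0. Qed.

Lemma abs2E z : abs2 z = nc z ^+ 2.
Proof. by rewrite nc_sqr. Qed.

Lemma ncM z w : nc (z * w) = nc z * nc w.
Proof. exact: Normc.normcM. Qed.

Lemma ncX z n : nc (z ^+ n) = nc z ^+ n.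
Proof.
elim: n => [|n ih]; first by rewrite !expr0 (Normc.normc1 R).
by rewrite !exprS ncM ih.
Qed.

Lemma ncV z : nc z^-1 = (nc z)^-1.
Proof. exact: Normc.normcV. Qed.

Lemma nc_eq0 z : (nc z == 0) = (z == 0).
Proof.
apply/eqP/eqP => [/Normc.eq0_normc//|->]; exact: (Normc.normc0 R).
Qed.

Lemma nc0 : nc (0 : C) = 0. Proof. exact: (Normc.normc0 R). Qed.

Lemma nc1 : nc (1 : C) = 1. Proof. exact: (Normc.normc1 R). Qed.

Lemma nc_gt0 z : (0 < nc z) = (z != 0).
Proof. by rewrite lt_neqAle nc_ge0 andbT eq_sym nc_eq0. Qed.

Lemma ncN z : nc (- z) = nc z.
Proof. by case: z => a b; rewrite /= !sqrrN. Qed.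

Lemma ncD z w : nc (z + w) <= nc z + nc w.
Proof. exact: le_normcD. Qed.

Lemma ncB z w : nc (z - w) <= nc z + nc w.
Proof. by rewrite -(ncN w); exact: ncD. Qed.

Lemma ncBC z w : nc (z - w) = nc (w - z).
Proof. by rewrite -ncN opprB. Qed.

Lemma nc_dist z w : nc z - nc w <= nc (z - w).
Proof. by rewrite lerBlDr -{1}(subrK w z) ncD. Qed.

Lemma nc_conj z : nc (conjc z) = nc z.
Proof. by case: z => a b /=; rewrite sqrrN. Qed.

Lemma nc_real a : nc (a%:C)%C = `|a|.
Proof. by rewrite /= expr0n /= addr0 sqrtr_sqr. Qed.

Lemma Re_nc z : `|complex.Re z| <= nc z.
Proof.
by rewrite ncE -sqrtr_sqr ler_wsqrtr // lerDl sqr_ge0.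
Qed.

Lemma Im_nc z : `|complex.Im z| <= nc z.
Proof. by rewrite ncE -sqrtr_sqr ler_wsqrtr // lerDr sqr_ge0. Qed.

Lemma nc_ReIm z : nc z <= `|complex.Re z| + `|complex.Im z|.
Proof.
rewrite -(@ler_pXn2r _ 2) ?nnegrE ?addr_ge0 ?nc_ge0 //.
rewrite nc_sqr sqrrD !real_normK ?num_real // -addrA (addrC (_ *+ 2)) addrA.
by rewrite lerDl mulrn_wge0 // mulr_ge0.
Qed.

Lemma Re_le z : complex.Re z <= nc z.
Proof. exact: le_trans (ler_norm _) (Re_nc z). Qed.

(** The definitions measure distances with the norm valued in R[i]; the estimates below use the
    real-valued modulus. *)
Lemma norm_lt_nc z a : (`|z| < (a%:C)%C) = (nc z < a).
Proof. by rewrite normc_def ltcR ncE. Qed.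

Lemma nc_sum n (f : 'I_n -> C) : nc (\sum_i f i) <= \sum_i nc (f i).
Proof.
elim/big_ind2: _ => //; first by rewrite nc0.
by move=> x1 x2 y1 y2 h1 h2; apply: le_trans (ncD _ _) _; exact: lerD.
Qed.

Lemma cReD z w : complex.Re (z + w) = complex.Re z + complex.Re w.
Proof. by case: z w => [? ?] []. Qed.
Lemma cImD z w : complex.Im (z + w) = complex.Im z + complex.Im w.
Proof. by case: z w => [? ?] []. Qed.
Lemma cReN z : complex.Re (- z) = - complex.Re z.
Proof. by case: z. Qed.
Lemma cImN z : complex.Im (- z) = - complex.Im z.
Proof. by case: z. Qed.
Lemma cReM z w : complex.Re (z * w) =
  complex.Re z * complex.Re w - complex.Im z * complex.Im w.
Proof. by case: z w => [? ?] []. Qed.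
Lemma cImM z w : complex.Im (z * w) =
  complex.Re z * complex.Im w + complex.Im z * complex.Re w.
Proof. by case: z w => [? ?] []. Qed.
Lemma cReJ z : complex.Re (conjc z) = complex.Re z.
Proof. by case: z. Qed.
Lemma cImJ z : complex.Im (conjc z) = - complex.Im z.
Proof. by case: z. Qed.

Definition ReImE := (cReD, cImD, cReN, cImN, cReM, cImM, cReJ, cImJ).

Lemma complex_ext z w :
  complex.Re z = complex.Re w -> complex.Im z = complex.Im w -> z = w.
Proof. by case: z w => [? ?] [? ?] /= -> ->. Qed.

Lemma complexD a b a' b' :
  Complex a b + Complex a' b' = Complex (a + a') (b + b') :> C.
Proof. by []. Qed.

End ComplexModulus.

(** * Complex derivatives and continuity at a point *)

Section ComplexDifferentiability.
Variable R : realType.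
Local Notation C := R[i].
Implicit Types (z w d : C) (F G : C -> C).

Definition ccont F z := forall e : R, 0 < e -> exists2 del : R, 0 < del &
  forall h, nc h < del -> nc (F (z + h) - F z) < e.

(** The remainder form avoids the quotient and admits h = 0, so the rules of calculus need no case
    distinction; [has_cderP] links it to [holomorphic_on]. *)
Definition has_cder F z d := forall e : R, 0 < e -> exists2 del : R, 0 < del &
  forall h, nc h < del -> nc (F (z + h) - F z - d * h) <= e * nc h.

Definition cdiff F z := exists d, has_cder F z d.

Lemma has_cderP F z d : has_cder F z d <->
  forall e : R, 0 < e -> exists2 del : R, 0 < del & forall h : C, h != 0 ->
    `|h| < (del%:C)%C -> `|(F (z + h) - F z) / h - d| < (e%:C)%C.
Proof.
split=> hd e e0.
  have [del del0 H] := hd (e / 2) (divr_gt0 e0 (ltr0Sn _ 1)); exists del => // h h0.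
  rewrite !norm_lt_nc => /H.
  have -> : F (z + h) - F z - d * h = ((F (z + h) - F z) / h - d) * h by field.
  rewrite ncM ler_pM2r ?nc_gt0 // => /le_lt_trans; apply; lra.
have [del del0 H] := hd e e0; exists del => // h.
have [->|h0] := eqVneq h 0; first by rewrite addr0 subrr mulr0 subr0 nc0 mulr0.
move=> hdel; have := H h h0; rewrite !norm_lt_nc => /(_ hdel) /ltW.
have -> : F (z + h) - F z - d * h = ((F (z + h) - F z) / h - d) * h by field.
by move=> ?; rewrite ncM ler_wpM2r // nc_ge0.
Qed.

Lemma holomorphic_onP (D : set C) F :
  holomorphic_on D F <-> forall z, D z -> cdiff F z.
Proof. by split=> hF z /hF [d hd]; exists d; exact/has_cderP. Qed.

Lemma has_cder_cont F z d : has_cder F z d -> ccont F z.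
Proof.
move=> hd e e0; have [del del0 H] := hd 1 ltr01.
have K0 : 0 < 1 + nc d by rewrite ltr_pwDl ?nc_ge0.
exists (Num.min del (e / (1 + nc d))); first by rewrite lt_min del0 divr_gt0.
move=> h; rewrite lt_min ltr_pdivlMr // => /andP[/H h1 h2].
apply: le_lt_trans h2; rewrite -(subrK (d * h) (F (z + h) - F z)).
apply: le_trans (ncD _ _) _; rewrite ncM; lra.
Qed.

Lemma cdiff_cont F z : cdiff F z -> ccont F z.
Proof. by case=> d /has_cder_cont. Qed.

Lemma has_cder_cst (c z : C) : has_cder (fun=> c) z 0.
Proof.
move=> e e0; exists 1 => // h _; rewrite subrr mul0r subr0 nc0.
by rewrite mulr_ge0 ?nc_ge0 // ltW.
Qed.

Lemma has_cder_id z : has_cder id z 1.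
Proof.
move=> e e0; exists 1 => // h _; rewrite /= (_ : _ - _ = 0) ?nc0; last by ring.
by rewrite mulr_ge0 ?nc_ge0 // ltW.
Qed.

Lemma has_cderD F G z d d' : has_cder F z d -> has_cder G z d' ->
  has_cder (fun w => F w + G w) z (d + d').
Proof.
move=> hF hG e e0; have e2 : 0 < e / 2 by lra.
have [a a0 ha] := hF _ e2; have [b b0 hb] := hG _ e2.
exists (Num.min a b); first by rewrite lt_min a0.
move=> h; rewrite lt_min => /andP[/ha h1 /hb h2].
have -> : F (z + h) + G (z + h) - (F z + G z) - (d + d') * h =
  (F (z + h) - F z - d * h) + (G (z + h) - G z - d' * h) by ring.
apply: le_trans (ncD _ _) _; lra.
Qed.

Lemma has_cderM F G z d d' : has_cder F z d -> has_cder G z d' ->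
  has_cder (fun w => F w * G w) z (d * G z + F z * d').
Proof.
move=> hF hG e e0.
(* [K] dominates |F z|, |d| and, once e1 <= 1, also |G (z+h)|; each of the three remainder terms
   then costs at most K e1 |h|. *)
set K := 1 + nc (F z) + nc d + nc (G z).
have K0 : 0 < K by rewrite /K -!addrA ltr_pwDl // !addr_ge0 ?nc_ge0.
set e1 := Num.min 1 (e / (3 * K)).
have e10 : 0 < e1 by rewrite lt_min ltr01 divr_gt0 // mulr_gt0.
have e1e : 3 * K * e1 <= e.
  by rewrite mulrC -ler_pdivlMr ?mulr_gt0 // ge_min lexx orbT.
have [a a0 ha] := hF _ e10; have [b b0 hb] := hG _ e10.
have [c c0 hc] := has_cder_cont hG e10.
exists (Num.min a (Num.min b c)); first by rewrite !lt_min a0 b0.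
move=> h; rewrite !lt_min => /and3P[/ha h1 /hb h2 /hc /ltW h3].
have -> : F (z + h) * G (z + h) - F z * G z - (d * G z + F z * d') * h =
  (F (z + h) - F z - d * h) * G (z + h) + d * h * (G (z + h) - G z)
  + F z * (G (z + h) - G z - d' * h) by ring.
have hG1 : nc (G (z + h)) <= K.
  rewrite -(subrK (G z) (G (z + h))); apply: le_trans (ncD _ _) _.
  have : e1 <= 1 by rewrite ge_min lexx.
  have := nc_ge0 (F z); have := nc_ge0 d; rewrite /K; lra.
have Fz : nc (F z) <= K.
  by have := nc_ge0 (G z); have := nc_ge0 d; rewrite /K; lra.
have dK : nc d <= K.
  by have := nc_ge0 (G z); have := nc_ge0 (F z); rewrite /K; lra.
apply: le_trans (ncD _ _) _.
apply: (@le_trans _ _ (K * e1 * nc h + K * e1 * nc h + K * e1 * nc h)); last first.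
  rewrite -!mulrDl ler_wpM2r ?nc_ge0 //; lra.
apply: lerD; first apply: le_trans (ncD _ _) _; first apply: lerD.
- rewrite ncM mulrC -mulrA; apply: ler_pM; rewrite ?nc_ge0 //.
- rewrite !ncM mulrAC; apply: ler_wpM2r; rewrite ?nc_ge0 //.
  by apply: ler_pM; rewrite ?nc_ge0.
- by rewrite ncM -mulrA; apply: ler_pM; rewrite ?nc_ge0.
Qed.

Lemma has_cderV F z d : F z != 0 -> has_cder F z d ->
  has_cder (fun w => (F w)^-1) z (- d / F z ^+ 2).
Proof.
move=> Fz0 hF e e0; have n0 : 0 < nc (F z) by rewrite nc_gt0.
set m := nc (F z) in n0 *.
set K := nc d + 1.
have K0 : 0 < K by rewrite ltr_wpDl ?nc_ge0.
(* Each of the two numerator terms below is at most e m^2/4 |h|, while |F (z+h)| >= m/2 makes the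
   denominator at least m^2/2. *)
have e10 : 0 < e * m ^+ 2 / 4 by rewrite divr_gt0 // mulr_gt0 // exprn_gt0.
have e20 : 0 < Num.min (m / 2) (e * m ^+ 3 / (4 * K)).
  by rewrite lt_min !divr_gt0 // ?mulr_gt0 // exprn_gt0.
have [a a0 ha] := hF _ e10; have [b b0 hb] := has_cder_cont hF e20.
exists (Num.min a b); first by rewrite lt_min a0.
move=> h; rewrite lt_min => /andP[/ha h1 /hb]; rewrite lt_min => /andP[h2 h3].
have n2 : m / 2 <= nc (F (z + h)).
  have := nc_dist (F z) (F (z + h)); rewrite ncBC -/m; lra.
have Fh0 : F (z + h) != 0 by rewrite -nc_gt0; apply: lt_le_trans n2; lra.
have -> : (F (z + h))^-1 - (F z)^-1 - - d / F z ^+ 2 * h =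
  (- (F (z + h) - F z - d * h) + d * h * (F (z + h) - F z) / F z)
   / (F (z + h) * F z).
  by field; rewrite Fh0 Fz0.
rewrite ncM ncV ncM ler_pdivrMr; last by rewrite mulr_gt0 // nc_gt0.
apply: (@le_trans _ _ (e * m ^+ 2 / 4 * nc h + e * m ^+ 2 / 4 * nc h)).
  apply: le_trans (ncD _ _) _; rewrite ncN; apply: lerD => //.
  rewrite !ncM ncV -/m.
  rewrite [leLHS](_ : _ = nc d * nc (F (z + h) - F z) / m * nc h); last by ring.
  rewrite ler_wpM2r ?nc_ge0 //.
  rewrite ler_pdivrMr //.
  have dK : nc d <= K by rewrite /K; lra.
  apply: le_trans (ler_pM (nc_ge0 _) (nc_ge0 _) dK (ltW h3)) _.
  by rewrite le_eqVlt; apply/orP; left; apply/eqP; field; rewrite gt_eqF.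
rewrite -mulrDl -/m [leRHS](_ : _ = e * (nc (F (z + h)) * m) * nc h); last by ring.
apply: ler_wpM2r; rewrite ?nc_ge0 //.
rewrite [leLHS](_ : _ = e * (m / 2 * m)); last by field.
apply: ler_wpM2l; first exact: ltW.
by apply: ler_wpM2r => //; exact: ltW.
Qed.

Lemma cdiff_cst (c z : C) : cdiff (fun=> c) z.
Proof. by exists 0; exact: has_cder_cst. Qed.

Lemma cdiff_id z : cdiff id z.
Proof. by exists 1; exact: has_cder_id. Qed.

Lemma cdiffD F G z : cdiff F z -> cdiff G z -> cdiff (fun w => F w + G w) z.
Proof. by move=> [d hd] [d' hd']; exists (d + d'); exact: has_cderD. Qed.

Lemma cdiffM F G z : cdiff F z -> cdiff G z -> cdiff (fun w => F w * G w) z.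
Proof. by move=> [d hd] [d' hd']; eexists; exact: has_cderM hd hd'. Qed.

Lemma cdiffN F z : cdiff F z -> cdiff (fun w => - F w) z.
Proof.
move=> hF; rewrite (_ : (fun w => - F w) = fun w => -1 * F w); last first.
  by apply/funext => w; rewrite mulN1r.
exact: cdiffM (cdiff_cst _ _) hF.
Qed.

Lemma cdiffB F G z : cdiff F z -> cdiff G z -> cdiff (fun w => F w - G w) z.
Proof. by move=> hF /cdiffN; exact: cdiffD. Qed.

Lemma cdiffV F z : F z != 0 -> cdiff F z -> cdiff (fun w => (F w)^-1) z.
Proof. by move=> Fz [d hd]; eexists; exact: has_cderV Fz hd. Qed.

Lemma cdiff_sum n (F : 'I_n -> C -> C) z :
  (forall i, cdiff (F i) z) -> cdiff (fun w => \sum_i F i w) z.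
Proof.
elim: n F => [|n ih] F hF.
  by under eq_fun do rewrite big_ord0; exact: cdiff_cst.
under eq_fun do rewrite big_ord_recr /=.
by apply: cdiffD => //; apply: ih => i; exact: hF.
Qed.

Lemma cdiffX F z n : cdiff F z -> cdiff (fun w => F w ^+ n) z.
Proof.
move=> hF; elim: n => [|n ih].
  by under eq_fun do rewrite expr0; exact: cdiff_cst.
by under eq_fun do rewrite exprS; exact: cdiffM.
Qed.

Lemma cdiff_poly (p : {poly C}) z : cdiff (horner p) z.
Proof.
rewrite (_ : horner p = fun w => \sum_(i < size p) p`_i * w ^+ i); last first.
  by apply/funext => w; rewrite horner_coef.
apply: cdiff_sum => i; apply: cdiffM; first exact: cdiff_cst.
exact/cdiffX/cdiff_id.
Qed.

Lemma cdiff_near F G z (e : R) : 0 < e ->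
  (forall w, nc (w - z) < e -> F w = G w) -> cdiff F z -> cdiff G z.
Proof.
move=> e0 FG [d hd]; exists d => u u0; have [del del0 H] := hd u u0.
exists (Num.min del e); first by rewrite lt_min del0.
move=> h; rewrite lt_min => /andP[h1 h2].
rewrite -!FG; [exact: H| by rewrite subrr nc0 | by rewrite addrAC subrr add0r].
Qed.

End ComplexDifferentiability.

(** * Complex-valued Lebesgue integrals over subsets of the real line *)

Section ComplexIntegral.
Variable R : realType.
Local Notation C := R[i].
Local Notation mu := (@lebesgue_measure R).
Implicit Types (D : set R) (f g : R -> R) (phi psi : R -> C).

Definition rinteg D f := mu.-integrable D (EFin \o f).

Definition cinteg D phi :=
  rinteg D (fun t => complex.Re (phi t)) /\ rinteg D (fun t => complex.Im (phi t)).

(** Componentwise like [ip_line], which is therefore a [cint] up to the factor 1/(2 pi). *)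
Definition cint D phi : C :=
  Complex (\int[mu]_(t in D) complex.Re (phi t))
          (\int[mu]_(t in D) complex.Im (phi t)).

Lemma rintegD D f g : measurable D -> rinteg D f -> rinteg D g ->
  rinteg D (fun t => f t + g t).
Proof. by move=> mD hf hg; have := @integrableD _ _ _ mu D mD _ _ hf hg; exact. Qed.

Lemma rintegN D f : measurable D -> rinteg D f -> rinteg D (fun t => - f t).
Proof. by move=> mD hf; have := @integrableN _ _ _ mu D _ hf; exact. Qed.

Lemma rintegZ D f (k : R) : measurable D -> rinteg D f ->
  rinteg D (fun t => k * f t).
Proof. by move=> mD hf; have := @integrableZl _ _ _ mu D mD k _ hf; exact. Qed.

Lemma rinteg_le D f g : measurable D -> measurable_fun D f ->
  (forall t, D t -> `|f t| <= g t) -> rinteg D g -> rinteg D f.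
Proof.
move=> mD mf fg; apply: le_integrable => //; first exact/measurable_EFinP.
move=> t /fg; rewrite /= lee_fin => /le_trans; apply; exact: ler_norm.
Qed.

Lemma eq_rinteg D f g : (forall t, D t -> f t = g t) -> measurable D ->
  rinteg D f -> rinteg D g.
Proof.
move=> fg mD; apply: eq_integrable => // t /set_mem /fg /= ->; by [].
Qed.

Lemma rinteg_nneg D f (B : R) : measurable_fun D f ->
  (forall t, 0 <= f t) -> (\int[mu]_(t in D) (f t)%:E <= B%:E)%E ->
  rinteg D f /\ \int[mu]_(t in D) f t <= B.
Proof.
move=> mf f0 fB; split.
  apply/integrableP; split; first exact/measurable_EFinP.
  under eq_integral do rewrite /= ger0_norm //.
  by apply: le_lt_trans fB _; rewrite ltry.
rewrite /Rintegral -lee_fin fineK // ge0_fin_numE.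
  by apply: le_lt_trans fB _; rewrite ltry.
by apply: integral_ge0 => t _; rewrite lee_fin.
Qed.

Lemma eq_cint D phi psi : (forall t, D t -> phi t = psi t) ->
  cint D phi = cint D psi.
Proof.
by move=> e; congr Complex; apply: eq_Rintegral => t /set_mem /e ->.
Qed.

Lemma eq_cinteg D phi psi : (forall t, D t -> phi t = psi t) -> measurable D ->
  cinteg D phi -> cinteg D psi.
Proof.
by move=> e mD [h1 h2]; split; [apply: eq_rinteg h1|apply: eq_rinteg h2]
  => // t /e ->.
Qed.

Lemma cintegD D phi psi : measurable D -> cinteg D phi -> cinteg D psi ->
  cinteg D (fun t => phi t + psi t).
Proof.
move=> mD [h1 h2] [h3 h4]; split.
  by under eq_fun do rewrite cReD; exact: rintegD.
by under eq_fun do rewrite cImD; exact: rintegD.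
Qed.

Lemma cintegZ D phi (c : C) : measurable D -> cinteg D phi ->
  cinteg D (fun t => c * phi t).
Proof.
move=> mD [h1 h2]; split.
  under eq_fun do rewrite cReM; apply: rintegD => //; first exact: rintegZ.
  by apply: rintegN => //; exact: rintegZ.
by under eq_fun do rewrite cImM; apply: rintegD => //; exact: rintegZ.
Qed.

Lemma cintD D phi psi : measurable D -> cinteg D phi -> cinteg D psi ->
  cint D (fun t => phi t + psi t) = cint D phi + cint D psi.
Proof.
move=> mD [h1 h2] [h3 h4]; rewrite /cint complexD; congr Complex.
  by under eq_Rintegral do rewrite cReD; rewrite RintegralD.
by under eq_Rintegral do rewrite cImD; rewrite RintegralD.
Qed.

Lemma cintZ D phi (c : C) : measurable D -> cinteg D phi ->
  cint D (fun t => c * phi t) = c * cint D phi.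
Proof.
move=> mD [h1 h2]; apply: complex_ext => /=; rewrite ReImE /=.
  under eq_Rintegral do rewrite cReM.
  by rewrite RintegralB ?RintegralZl //; exact: rintegZ.
under eq_Rintegral do rewrite cImM.
by rewrite RintegralD ?RintegralZl //; exact: rintegZ.
Qed.

Lemma cintegB D phi psi : measurable D -> cinteg D phi -> cinteg D psi ->
  cinteg D (fun t => phi t - psi t).
Proof.
move=> mD h1 h2; rewrite (_ : (fun t => _) = fun t => phi t + -1 * psi t).
  by apply: cintegD => //; exact: cintegZ.
by apply/funext => t; rewrite mulN1r.
Qed.

Lemma cintB D phi psi : measurable D -> cinteg D phi -> cinteg D psi ->
  cint D (fun t => phi t - psi t) = cint D phi - cint D psi.
Proof.
move=> mD h1 h2; rewrite (_ : (fun t => _) = fun t => phi t + -1 * psi t).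
  by rewrite cintD // ?cintZ // ?mulN1r //; exact: cintegZ.
by apply/funext => t; rewrite mulN1r.
Qed.

(** The factor 2 comes from estimating real and imaginary parts one at a time; later constants
    absorb it. *)
Lemma nc_cint_le D phi g : measurable D -> cinteg D phi -> rinteg D g ->
  (forall t, D t -> nc (phi t) <= g t) ->
  nc (cint D phi) <= 2 * \int[mu]_(t in D) g t.
Proof.
move=> mD [h1 h2] hg le; apply: le_trans (nc_ReIm _) _; rewrite mulr2n mulrDl mul1r.
have key f : rinteg D f -> (forall t, D t -> `|f t| <= g t) ->
    `|\int[mu]_(t in D) f t| <= \int[mu]_(t in D) g t.
  move=> hf fg; have := @le_normr_Rintegral _ _ _ mu D f mD hf => /le_trans; apply.
  by apply: le_Rintegral => //; exact: integrable_norm.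
apply: lerD; apply: key => // t /le; apply: le_trans.
  exact: Re_nc.
exact: Im_nc.
Qed.

Lemma cinteg_le D phi g : measurable D ->
  measurable_fun D (fun t => complex.Re (phi t)) ->
  measurable_fun D (fun t => complex.Im (phi t)) -> rinteg D g ->
  (forall t, D t -> nc (phi t) <= g t) -> cinteg D phi.
Proof.
move=> mD m1 m2 hg le; split; apply: rinteg_le hg => // t /le; apply: le_trans.
  exact: Re_nc.
exact: Im_nc.
Qed.

Definition rcont phi (t : R) := forall e : R, 0 < e -> exists2 del : R, 0 < del &
  forall s, `|s - t| < del -> nc (phi s - phi t) < e.

Lemma rcont_Re phi t : rcont phi t ->
  {for t, continuous (fun s => complex.Re (phi s))}.
Proof.
move=> h; apply/cvgrPdist_lt => e /h[del del0 H]; near=> s.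
rewrite -cReN -cReD; apply: le_lt_trans (Re_nc _) _; rewrite ncBC; apply: H.
near: s; apply/nbhs_ballP; exists del => // s; rewrite /ball /= distrC //.
Unshelve. all: by end_near. Qed.

Lemma rcont_Im phi t : rcont phi t ->
  {for t, continuous (fun s => complex.Im (phi s))}.
Proof.
move=> h; apply/cvgrPdist_lt => e /h[del del0 H]; near=> s.
rewrite -cImN -cImD; apply: le_lt_trans (Im_nc _) _; rewrite ncBC; apply: H.
near: s; apply/nbhs_ballP; exists del => // s; rewrite /ball /= distrC //.
Unshelve. all: by end_near. Qed.

Lemma rcont_nc phi t : rcont phi t -> {for t, continuous (fun s => nc (phi s))}.
Proof.
move=> h; apply/cvgrPdist_lt => e /h[del del0 H]; near=> s.
suff : nc (phi s - phi t) < e.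
  move=> he; rewrite ltr_norml; apply/andP; split.
    by have := nc_dist (phi s) (phi t); lra.
  by have := nc_dist (phi t) (phi s); rewrite ncBC; lra.
apply: H; near: s; apply/nbhs_ballP; exists del => // s; rewrite /ball /= distrC //.
Unshelve. all: by end_near. Qed.

Lemma rcont_nc2 phi t : rcont phi t ->
  {for t, continuous (fun s => nc (phi s) ^+ 2)}.
Proof.
move=> /rcont_nc h.
rewrite (_ : (fun s => _) = (fun s => nc (phi s) * nc (phi s))); last first.
  by apply/funext => s; rewrite expr2.
exact: (cvgM h h).
Qed.

Lemma cont_rinteg f (a b : R) :
  (forall t, a <= t <= b -> {for t, continuous f}) -> rinteg `[a, b] f.
Proof.
move=> cf; apply: continuous_compact_integrable; first exact: segment_compact.
apply: continuous_in_subspaceT => t /set_mem /=; rewrite in_itv /=; exact: cf.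
Qed.

Lemma rcont_cinteg phi (a b : R) :
  (forall t, a <= t <= b -> rcont phi t) -> cinteg `[a, b] phi.
Proof.
move=> h; split; apply: cont_rinteg => t /h; [exact: rcont_Re|exact: rcont_Im].
Qed.

Lemma rint_cst (a b k : R) : a <= b -> \int[mu]_(_ in `[a, b]) k = k * (b - a).
Proof.
move=> ab; rewrite Rintegral_cst //=; congr (_ * _).
rewrite lebesgue_measure_itv /=; case: ifP => //=.
rewrite lte_fin => /negbT; rewrite -leNgt => ba.
by rewrite (le_anti (introT andP (conj ab ba))) subrr.
Qed.

Lemma rinteg_cst (a b k : R) : rinteg `[a, b] (fun=> k).
Proof. by apply: cont_rinteg => t _; exact: cst_continuous. Qed.

Lemma cint_cst (a b : R) (k : C) : a <= b ->
  cint `[a, b] (fun=> k) = k * ((b - a)%:C)%C.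
Proof.
move=> ab; rewrite /cint !rint_cst //; apply: complex_ext; rewrite ReImE /=; ring.
Qed.

Lemma rint_split f (a b c : R) : a <= c -> c <= b -> rinteg `[a, b] f ->
  \int[mu]_(t in `[a, b]) f t =
  \int[mu]_(t in `[a, c]) f t + \int[mu]_(t in `[c, b]) f t.
Proof.
move=> ac cb hf; have := @Rintegral_itvB R f (BLeft a) (BRight b) c hf.
rewrite !bnd_simp => /(_ ac cb) h; apply/eqP; rewrite addrC -subr_eq h.
rewrite Rintegral_itv_obnd_cbnd //; apply: integrableS hf => //.
by apply: subset_itvr; rewrite bnd_simp.
Qed.

Lemma cint_split phi (a b c : R) : a <= c -> c <= b -> cinteg `[a, b] phi ->
  cint `[a, b] phi = cint `[a, c] phi + cint `[c, b] phi.
Proof.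
move=> ac cb [h1 h2]; rewrite /cint complexD; congr Complex; exact: rint_split.
Qed.

Lemma nc_cint_bound phi (a b M : R) : a <= b -> cinteg `[a, b] phi ->
  (forall t, a <= t <= b -> nc (phi t) <= M) ->
  nc (cint `[a, b] phi) <= 2 * (M * (b - a)).
Proof.
move=> ab h le; rewrite -rint_cst //; apply: nc_cint_le => //.
  exact: rinteg_cst.
Qed.

End ComplexIntegral.

(** * The bisection argument for additive rectangle functions *)

Section Goursat.
Variable R : realType.
Local Notation C := R[i].
Implicit Types (a b c d : R) (G : C -> C).

Lemma nested_itv (a b : nat -> R) : (forall n, a n <= a n.+1) ->
  (forall n, b n.+1 <= b n) -> (forall n, a n <= b n) ->
  exists x, forall n, a n <= x <= b n.
Proof.
move=> ha hb hab.
have amono m n : (m <= n)%N -> a m <= a n.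
  by move=> /subnK <-; elim: (n - m)%N => // k; rewrite addSn => /le_trans; apply.
have bmono m n : (m <= n)%N -> b n <= b m.
  by move=> /subnK <-; elim: (n - m)%N => // k; rewrite addSn; apply: le_trans.
have ab m n : a m <= b n.
  apply: le_trans (amono m (maxn m n) _) _; first exact: leq_maxl.
  by apply: le_trans (hab _) _; apply: bmono; exact: leq_maxr.
exists (sup (range a)) => n; apply/andP; split.
  apply: ub_le_sup; last by exists n.
  by exists (b 0%N) => _ [k _ <-].
by apply: ge_sup; [exists (a 0%N), 0%N | move=> _ [k _ <-]].
Qed.

Lemma exp2_dominates (w del : R) : 0 < del -> exists n, w / 2 ^+ n < del.
Proof.
move=> del0; exists (Num.bound `|w / del|).
rewrite ltr_pdivrMr ?exprn_gt0 // mulrC -ltr_pdivrMr //.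
apply: le_lt_trans (ler_norm _) _; apply: lt_trans (archi_boundP (normr_ge0 _)) _.
by rewrite -natrX ltr_nat; apply: ltn_expl.
Qed.

(** If [J] were nonzero, the whole rectangle would violate a bound by e times the sum of its squared
    sides. These sums for the four quarters add up to that of the rectangle, so some quarter
    violates the bound as well; the nested quarters shrink to a point, where the local hypothesis
    forbids this. *)
Lemma rect_bisection (J : R -> R -> R -> R -> C) a0 b0 c0 d0 :
  a0 <= b0 -> c0 <= d0 ->
  (forall a b c d, a0 <= a -> a <= b -> b <= b0 -> c0 <= c -> c <= d -> d <= d0 ->
    J a b c d = J a ((a + b) / 2) c ((c + d) / 2) + J ((a + b) / 2) b c ((c + d) / 2)
     + J a ((a + b) / 2) ((c + d) / 2) d + J ((a + b) / 2) b ((c + d) / 2) d) ->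
  (forall x y, a0 <= x <= b0 -> c0 <= y <= d0 -> forall e, 0 < e ->
    exists2 del, 0 < del & forall a b c d, a0 <= a -> a <= x -> x <= b -> b <= b0 ->
      c0 <= c -> c <= y -> y <= d -> d <= d0 -> b - a < del -> d - c < del ->
      nc (J a b c d) <= e * ((b - a) ^+ 2 + (d - c) ^+ 2)) ->
  J a0 b0 c0 d0 = 0.
Proof.
move=> ab0 cd0 hsplit hloc; apply/eqP; rewrite -nc_eq0; apply/negP => /negP nz.
have J0 : 0 < nc (J a0 b0 c0 d0) by rewrite lt_neqAle eq_sym nz nc_ge0.
set D0 := (b0 - a0) ^+ 2 + (d0 - c0) ^+ 2.
have D0ge : 0 <= D0 by rewrite addr_ge0 // sqr_ge0.
(* Makes e D0 at most half of |J|, so the initial rectangle is bad; the added 1 covers the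
   degenerate rectangle. *)
set e := nc (J a0 b0 c0 d0) / (2 * (D0 + 1)).
have e0 : 0 < e by rewrite divr_gt0 // mulr_gt0 // ltr_wpDl.
pose ins (q : R * R * R * R) := let: (a, b, c, d) := q in
  [/\ a0 <= a, a <= b & b <= b0] /\ [/\ c0 <= c, c <= d & d <= d0].
pose bad (q : R * R * R * R) := let: (a, b, c, d) := q in
  e * ((b - a) ^+ 2 + (d - c) ^+ 2) < nc (J a b c d).
pose quarter (q q' : R * R * R * R) :=
  let: (a, b, c, d) := q in let: (a', b', c', d') := q' in
  [/\ a <= a', a' <= b', b' <= b & b' - a' = (b - a) / 2] /\
  [/\ c <= c', c' <= d', d' <= d & d' - c' = (d - c) / 2].
(* The hypotheses stand under the existential so that [choice] yields a total successor function. *)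
have step q : exists q', ins q -> bad q ->
    [/\ ins q', bad q' & quarter q q'].
  case: q => [[[a b] c] d].
  have [[[[ha hab hb] [hc hcd hd]] hbad]|nq] :=
    pselect (ins (a, b, c, d) /\ bad (a, b, c, d)); last first.
    by exists (a, b, c, d) => h1 h2; case: nq.
  set m := (a + b) / 2; set n := (c + d) / 2.
  have am : a <= m by rewrite /m; clear -hab; lra.
  have mb : m <= b by rewrite /m; clear -hab; lra.
  have cn : c <= n by rewrite /n; clear -hcd; lra.
  have nd : n <= d by rewrite /n; clear -hcd; lra.
  have wm1 : m - a = (b - a) / 2 by rewrite /m; field.
  have wm2 : b - m = (b - a) / 2 by rewrite /m; field.
  have wn1 : n - c = (d - c) / 2 by rewrite /n; field.
  have wn2 : d - n = (d - c) / 2 by rewrite /n; field.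
  have f1 := le_trans ha am; have f2 := le_trans mb hb.
  have f3 := le_trans hc cn; have f4 := le_trans nd hd.
  have [h1|h1] := ltP (e * ((m - a) ^+ 2 + (n - c) ^+ 2)) (nc (J a m c n)).
    by exists (a, m, c, n) => _ _; do !split.
  have [h2|h2] := ltP (e * ((b - m) ^+ 2 + (n - c) ^+ 2)) (nc (J m b c n)).
    by exists (m, b, c, n) => _ _; do !split.
  have [h3|h3] := ltP (e * ((m - a) ^+ 2 + (d - n) ^+ 2)) (nc (J a m n d)).
    by exists (a, m, n, d) => _ _; do !split.
  have [h4|h4] := ltP (e * ((b - m) ^+ 2 + (d - n) ^+ 2)) (nc (J m b n d)).
    by exists (m, b, n, d) => _ _; do !split.
  exfalso; move: hbad; rewrite /bad hsplit // -/m -/n ltNge => /negP; apply.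
  apply: le_trans (ncD _ _) _.
  apply: le_trans (lerD (ncD _ _) (lexx _)) _.
  apply: le_trans (lerD (lerD (ncD _ _) (lexx _)) (lexx _)) _.
  apply: le_trans (lerD (lerD (lerD h1 h2) h3) h4) _.
  rewrite wm1 wm2 wn1 wn2 le_eqVlt; apply/orP; left; apply/eqP; by field.
have [f hf] := choice step.
pose s n := iter n f (a0, b0, c0, d0).
have s0 : ins (s 0%N) /\ bad (s 0%N).
  split; first by do !split.
  rewrite /= -/D0 /e mulrAC -mulrA gtr_pMr // ltr_pdivrMr ?mulr_gt0 ?ltr_wpDl //.
  lra.
have sn n : ins (s n) /\ bad (s n).
  elim: n => // n [h1 h2]; have [] := hf (s n) h1 h2; by [].
have qn n : quarter (s n) (s n.+1).
  by have [h1 h2] := sn n; have [] := hf (s n) h1 h2.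
pose A n := (s n).1.1.1; pose B n := (s n).1.1.2.
pose Cc n := (s n).1.2; pose Dd n := (s n).2.
have sE n : s n = (A n, B n, Cc n, Dd n).
  by rewrite /A /B /Cc /Dd; case: (s n) => [[[]]].
have qn' n : [/\ A n <= A n.+1, A n.+1 <= B n.+1, B n.+1 <= B n
     & B n.+1 - A n.+1 = (B n - A n) / 2] /\
  [/\ Cc n <= Cc n.+1, Cc n.+1 <= Dd n.+1, Dd n.+1 <= Dd n
     & Dd n.+1 - Cc n.+1 = (Dd n - Cc n) / 2].
  by have := qn n; rewrite !sE.
have ABle n : A n <= B n by have := (sn n).1; rewrite sE => -[[]].
have CDle n : Cc n <= Dd n by have := (sn n).1; rewrite sE => -[_ []].
have [x hx] : exists x, forall n, A n <= x <= B n.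
  by apply: nested_itv => // n; have [[]] := qn' n.
have [y hy] : exists y, forall n, Cc n <= y <= Dd n.
  by apply: nested_itv => // n; have [_ []] := qn' n.
have wA n : B n - A n = (b0 - a0) / 2 ^+ n.
  elim: n => [|n ih]; first by rewrite expr0 divr1.
  by have [[_ _ _ ->] _] := qn' n; rewrite ih exprS; field; rewrite expf_neq0.
have wC n : Dd n - Cc n = (d0 - c0) / 2 ^+ n.
  elim: n => [|n ih]; first by rewrite expr0 divr1.
  by have [_ [_ _ _ ->]] := qn' n; rewrite ih exprS; field; rewrite expf_neq0.
have [del del0 H] := hloc x y (hx 0%N) (hy 0%N) e e0.
have [n hn] := exp2_dominates (Num.max (b0 - a0) (d0 - c0)) del0.
have := (sn n); rewrite sE => -[[[h1 h2 h3] [h4 h5 h6]]]; rewrite /bad ltNge => /negP; apply.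
have [/andP[x1 x2] /andP[y1 y2]] := (hx n, hy n).
apply: H => //.
  rewrite wA; apply: le_lt_trans hn; rewrite ler_wpM2r ?invr_ge0 ?exprn_ge0 //.
  by rewrite le_max lexx.
rewrite wC; apply: le_lt_trans hn; rewrite ler_wpM2r ?invr_ge0 ?exprn_ge0 //.
by rewrite le_max lexx orbT.
Qed.

End Goursat.

(** * Integrals over rectangle boundaries and Goursat's theorem *)

Section RectangleIntegral.
Variable R : realType.
Local Notation C := R[i].
Implicit Types (a b c d : R) (G : C -> C).

Definition hseg G (c : R) : R -> C := fun t => G (Complex t c).
Definition vseg G (a : R) : R -> C := fun u => G (Complex a u).

(** The counterclockwise boundary integral with opposite sides paired; the factor i is that of dz =
    i dy on the vertical sides. *)
Definition rect_int G a b c d : C :=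
  cint `[a, b] (fun t => hseg G c t - hseg G d t)
  + Complex 0 1 * cint `[c, d] (fun u => vseg G b u - vseg G a u).

Lemma ccont_hseg G c t : ccont G (Complex t c) -> rcont (hseg G c) t.
Proof.
move=> h e /h[del del0 H]; exists del => // s hs; rewrite /hseg.
rewrite (_ : Complex s c = Complex t c + ((s - t)%:C)%C).
  by apply: H; rewrite nc_real.
by rewrite complexD addr0 addrC subrK.
Qed.

Lemma ccont_vseg G a u : ccont G (Complex a u) -> rcont (vseg G a) u.
Proof.
move=> h e /h[del del0 H]; exists del => // s hs; rewrite /vseg.
rewrite (_ : Complex a s = Complex a u + Complex 0 (s - u)).
  by apply: H; rewrite ncE /= expr0n /= add0r sqrtr_sqr.
by rewrite complexD addr0 addrC subrK.
Qed.

Lemma hseg_integ G a b c : (forall t, a <= t <= b -> ccont G (Complex t c)) ->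
  cinteg `[a, b] (hseg G c).
Proof. by move=> h; apply: rcont_cinteg => t /h; exact: ccont_hseg. Qed.

Lemma vseg_integ G a c d : (forall u, c <= u <= d -> ccont G (Complex a u)) ->
  cinteg `[c, d] (vseg G a).
Proof. by move=> h; apply: rcont_cinteg => t /h; exact: ccont_vseg. Qed.

Lemma rect_int_hsplit G a b c d m : a <= m -> m <= b ->
  cinteg `[a, b] (hseg G c) -> cinteg `[a, b] (hseg G d) ->
  cinteg `[c, d] (vseg G a) -> cinteg `[c, d] (vseg G m) ->
  cinteg `[c, d] (vseg G b) ->
  rect_int G a b c d = rect_int G a m c d + rect_int G m b c d.
Proof.
move=> am mb hc hd va vm vb; rewrite /rect_int.
rewrite (cint_split am mb); last exact: cintegB.
rewrite !(@cintB R `[c, d]) //; ring.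
Qed.

Lemma rect_int_vsplit G a b c d n : c <= n -> n <= d ->
  cinteg `[c, d] (vseg G a) -> cinteg `[c, d] (vseg G b) ->
  cinteg `[a, b] (hseg G c) -> cinteg `[a, b] (hseg G n) ->
  cinteg `[a, b] (hseg G d) ->
  rect_int G a b c d = rect_int G a b c n + rect_int G a b n d.
Proof.
move=> cn nd va vb hc hn hd; rewrite /rect_int.
rewrite (cint_split cn nd); last exact: cintegB.
rewrite !(@cintB R `[a, b]) //; ring.
Qed.

Lemma rect_int_bound G a b c d M : a <= b -> c <= d ->
  cinteg `[a, b] (hseg G c) -> cinteg `[a, b] (hseg G d) ->
  cinteg `[c, d] (vseg G a) -> cinteg `[c, d] (vseg G b) ->
  (forall x y, a <= x <= b -> c <= y <= d -> nc (G (Complex x y)) <= M) ->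
  nc (rect_int G a b c d) <= 4 * M * ((b - a) + (d - c)).
Proof.
move=> ab cd hc hd va vb hM; rewrite /rect_int.
have nI : nc (Complex 0 1 : C) = 1 by rewrite /= expr0n /= add0r expr1n sqrtr1.
apply: le_trans (ncD _ _) _; rewrite ncM nI mul1r mulrDr.
rewrite (_ : 4 * M * (b - a) = 2 * ((M + M) * (b - a))); last by ring.
rewrite (_ : 4 * M * (d - c) = 2 * ((M + M) * (d - c))); last by ring.
apply: lerD; apply: nc_cint_bound => //; try exact: cintegB.
  by move=> t ht; apply: le_trans (ncB _ _) _; apply: lerD; apply: hM; rewrite // ?cd ?lexx.
by move=> t ht; apply: le_trans (ncB _ _) _; apply: lerD; apply: hM; rewrite // ?ab ?lexx.
Qed.

(* The two opposite sides of a rectangle see an affine function differing by a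
   constant, and the two constants cancel. *)
Lemma rect_int_affine G (A B : C) a b c d : a <= b -> c <= d ->
  (forall x y, a <= x <= b -> c <= y <= d ->
     G (Complex x y) = A + B * Complex x y) ->
  rect_int G a b c d = 0.
Proof.
move=> ab cd hG; rewrite /rect_int.
rewrite (@eq_cint _ _ _ (fun=> B * Complex 0 (c - d))); last first.
  move=> t /=; rewrite in_itv /= => ht; rewrite /hseg !hG ?lexx ?cd //.
  by apply: complex_ext; rewrite !ReImE /=; ring.
rewrite (@eq_cint _ `[c, d] _ (fun=> B * Complex (b - a) 0)); last first.
  move=> t /=; rewrite in_itv /= => ht; rewrite /vseg !hG ?lexx ?ab //.
  by apply: complex_ext; rewrite !ReImE /=; ring.
by rewrite !cint_cst //; apply: complex_ext; rewrite !ReImE /=; ring.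
Qed.

(** Near a point [G] is affine up to an error small relative to the distance. The affine part
    integrates to 0, and the error satisfies the local hypothesis of the bisection. *)
Lemma goursat_rect G a b c d : a <= b -> c <= d ->
  (forall x y, a <= x <= b -> c <= y <= d -> cdiff G (Complex x y)) ->
  rect_int G a b c d = 0.
Proof.
move=> ab0 cd0 hG.
have cG x y : a <= x <= b -> c <= y <= d -> ccont G (Complex x y).
  by move=> hx hy; exact/cdiff_cont/hG.
have ih x1 x2 y : a <= x1 -> x2 <= b -> c <= y <= d -> cinteg `[x1, x2] (hseg G y).
  move=> h1 h2 hy; apply: hseg_integ => t /andP[t1 t2]; apply: cG => //.
  by rewrite (le_trans h1 t1) (le_trans t2 h2).
have iv y1 y2 x : c <= y1 -> y2 <= d -> a <= x <= b -> cinteg `[y1, y2] (vseg G x).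
  move=> h1 h2 hy; apply: vseg_integ => t /andP[t1 t2]; apply: cG => //.
  by rewrite (le_trans h1 t1) (le_trans t2 h2).
apply: (@rect_bisection R (rect_int G)) => //.
  move=> a' b' c' d' h1 h2 h3 h4 h5 h6.
  set m := (a' + b') / 2; set n := (c' + d') / 2.
  have am : a' <= m by rewrite /m; clear -h2; lra.
  have mb : m <= b' by rewrite /m; clear -h2; lra.
  have cn : c' <= n by rewrite /n; clear -h5; lra.
  have nd : n <= d' by rewrite /n; clear -h5; lra.
  have xm : a <= m <= b by rewrite (le_trans h1 am) (le_trans mb h3).
  have xa : a <= a' <= b by rewrite h1 (le_trans h2 h3).
  have xb : a <= b' <= b by rewrite (le_trans h1 h2) h3.
  have yn : c <= n <= d by rewrite (le_trans h4 cn) (le_trans nd h6).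
  have yc : c <= c' <= d by rewrite h4 (le_trans h5 h6).
  have yd : c <= d' <= d by rewrite (le_trans h4 h5) h6.
  have nd' := le_trans nd h6; have cn' := le_trans h4 cn.
  rewrite (@rect_int_vsplit _ _ _ _ _ n) //;
    [|exact: iv|exact: iv|exact: ih|exact: ih|exact: ih].
  rewrite (@rect_int_hsplit _ a' b' c' n m) //;
    [|exact: ih|exact: ih|exact: iv|exact: iv|exact: iv].
  rewrite (@rect_int_hsplit _ a' b' n d' m) //;
    [|exact: ih|exact: ih|exact: iv|exact: iv|exact: iv].
  by rewrite addrA.
move=> x y hx hy e e0; have [D hD] := hG x y hx hy.
(* With W the half perimeter, the error is at most e/32 W and its boundary integral at most 4 (e/32)
   W^2 = e W^2/8, while W^2 is at most twice the sum of squared sides. Sides below del/2 give W <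
   del. *)
have e10 : 0 < e / 32 by lra.
have [del del0 H] := hD _ e10; exists (del / 2); first lra.
move=> a' b' c' d' h1 h2 h3 h4 h5 h6 h7 h8 w1 w2.
have sh u : a' <= u <= b' -> a <= u <= b.
  by move=> /andP[u1 u2]; rewrite (le_trans h1 u1) (le_trans u2 h4).
have sv u : c' <= u <= d' -> c <= u <= d.
  by move=> /andP[u1 u2]; rewrite (le_trans h5 u1) (le_trans u2 h8).
have ac : a' <= b' := le_trans h2 h3.
have cd : c' <= d' := le_trans h6 h7.
have aab : a' <= a' <= b' by rewrite lexx.
have bab : a' <= b' <= b' by rewrite lexx andbT.
have ccd : c' <= c' <= d' by rewrite lexx.
have dcd : c' <= d' <= d' by rewrite lexx andbT.
set z0 := Complex x y.
pose A z := (G z0 - D * z0) + D * z.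
pose E z := G z - A z.
have cA z : ccont A z.
  apply/cdiff_cont/cdiffD; first exact: cdiff_cst.
  by apply: cdiffM; [exact: cdiff_cst | exact: cdiff_id].
have cE u v : a <= u <= b -> c <= v <= d -> ccont E (Complex u v).
  move=> hu hv; apply/cdiff_cont/cdiffB; first exact: hG.
  apply: cdiffD; first exact: cdiff_cst.
  by apply: cdiffM; [exact: cdiff_cst | exact: cdiff_id].
have JG : rect_int G a' b' c' d' = rect_int A a' b' c' d' + rect_int E a' b' c' d'.
  have iA1 v : cinteg `[a', b'] (hseg A v) by apply: hseg_integ => t _.
  have iA2 v : cinteg `[c', d'] (vseg A v) by apply: vseg_integ => t _.
  have iE1 v : c' <= v <= d' -> cinteg `[a', b'] (hseg E v).
    by move=> hv; apply: hseg_integ => t ht; apply: cE; [exact: sh|exact: sv].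
  have iE2 v : a' <= v <= b' -> cinteg `[c', d'] (vseg E v).
    by move=> hv; apply: vseg_integ => t ht; apply: cE; [exact: sh|exact: sv].
  rewrite /rect_int addrACA -mulrDr.
  rewrite -(@cintD R `[a', b']) //; [|exact: cintegB|by apply: cintegB; [|exact: iE1|exact: iE1]].
  rewrite -(@cintD R `[c', d']) //; [|exact: cintegB|by apply: cintegB; [|exact: iE2|exact: iE2]].
  congr (_ + _ * _); apply: eq_cint => t _; rewrite /hseg /vseg /E; ring.
rewrite JG (@rect_int_affine A (G z0 - D * z0) D) // add0r.
set W := (b' - a') + (d' - c').
have hE u v : a' <= u <= b' -> c' <= v <= d' -> nc (E (Complex u v)) <= e / 32 * W.
  move=> hu hv.
  have hW : nc (Complex (u - x) (v - y) : C) <= W.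
    apply: le_trans (nc_ReIm _) _; rewrite /= /W; apply: lerD;
      rewrite ler_norml; clear -hu hv h2 h3 h6 h7; lra.
  have -> : E (Complex u v) =
      G (z0 + Complex (u - x) (v - y)) - G z0 - D * Complex (u - x) (v - y).
    have -> : z0 + Complex (u - x) (v - y) = Complex u v.
      by rewrite complexD !(addrC _ (_ - _)) !subrK.
    rewrite /E /A (_ : Complex (u - x) (v - y) = Complex u v - z0) //; ring.
  apply: le_trans (H _ _) _; last by rewrite ler_wpM2l // ltW.
  by apply: le_lt_trans hW _; rewrite /W; clear -w1 w2; lra.
apply: le_trans (rect_int_bound _ _ _ _ _ _ hE) _ => //.
- by apply: hseg_integ => t ht; apply: cE; [exact: sh|exact: sv].
- by apply: hseg_integ => t ht; apply: cE; [exact: sh|exact: sv].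
- by apply: vseg_integ => t ht; apply: cE; [exact: sh|exact: sv].
- by apply: vseg_integ => t ht; apply: cE; [exact: sh|exact: sv].
rewrite -/W (_ : 4 * _ * W = e * (W ^+ 2 / 8)); last by field.
apply: ler_wpM2l; first exact: ltW.
have := sqr_ge0 ((b' - a') - (d' - c')); have := sqr_ge0 (b' - a').
by have := sqr_ge0 (d' - c'); rewrite /W; clear; nra.
Qed.

(* Isolated singularities with bounded values do not contribute: all but a small
   square around the singularity is covered by [goursat_rect]. *)
Lemma goursat_removable G a b c d (x0 y0 M : R) : a < x0 < b -> c < y0 < d ->
  (forall x y, a <= x <= b -> c <= y <= d -> Complex x y != Complex x0 y0 ->
     cdiff G (Complex x y)) ->
  (exists2 rho : R, 0 < rho & forall x y, `|x - x0| <= rho -> `|y - y0| <= rho ->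
     nc (G (Complex x y)) <= M) ->
  rect_int G a b c d = 0.
Proof.
move=> /andP[ax xb] /andP[cy yd] hG [rho rho0 hM].
have M0 : 0 <= M by apply: le_trans (nc_ge0 _) (hM x0 y0 _ _); rewrite subrr normr0 ltW.
have ne x y : x != x0 \/ y != y0 -> Complex x y != Complex x0 y0.
  by case=> h; apply/eqP => -[/eqP e1 /eqP e2]; rewrite ?e1 ?e2 in h.
have ih x1 x2 y : a <= x1 -> x2 <= b -> c <= y <= d -> y != y0 ->
    cinteg `[x1, x2] (hseg G y).
  move=> h1 h2 hy ny; apply: hseg_integ => t /andP[t1 t2]; apply/cdiff_cont/hG => //.
    by rewrite (le_trans h1 t1) (le_trans t2 h2).
  by apply: ne; right.
have iv y1 y2 x : c <= y1 -> y2 <= d -> a <= x <= b -> x != x0 ->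
    cinteg `[y1, y2] (vseg G x).
  move=> h1 h2 hy nx; apply: vseg_integ => t /andP[t1 t2]; apply/cdiff_cont/hG => //.
    by rewrite (le_trans h1 t1) (le_trans t2 h2).
  by apply: ne; left.
have small (e : R) : 0 < e -> a < x0 - e -> x0 + e < b -> c < y0 - e -> y0 + e < d ->
    e <= rho -> nc (rect_int G a b c d) <= 16 * M * e.
  move=> e0 e1 e2 e3 e4 e5.
  have xe : x0 - e <= x0 + e by clear -e0; lra.
  have ye : y0 - e <= y0 + e by clear -e0; lra.
  have f1 := ltW e1; have f2 := ltW e2; have f3 := ltW e3; have f4 := ltW e4.
  have f5 := le_trans xe f2; have f6 := le_trans f1 xe.
  have f7 := le_trans ye f4; have f8 := le_trans f3 ye.
  have ab := le_trans f1 f5; have cd := le_trans f3 f7.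
  have xm : a <= x0 - e <= b by rewrite f1.
  have xp : a <= x0 + e <= b by rewrite f6.
  have ym : c <= y0 - e <= d by rewrite f3.
  have yp : c <= y0 + e <= d by rewrite f8.
  have xa : a <= a <= b by rewrite lexx.
  have xb' : a <= b <= b by rewrite lexx andbT.
  have yc : c <= c <= d by rewrite lexx.
  have yd' : c <= d <= d by rewrite lexx andbT.
  have side1 (x : R) : x <= x0 - e \/ x0 + e <= x -> x != x0.
    by clear -e0; case=> h; [rewrite lt_eqF //|rewrite gt_eqF //]; lra.
  have side2 (y : R) : y <= y0 - e \/ y0 + e <= y -> y != y0.
    by clear -e0; case=> h; [rewrite lt_eqF //|rewrite gt_eqF //]; lra.
  have n1 : x0 - e != x0 by apply: side1; left.
  have n2 : x0 + e != x0 by apply: side1; right.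
  have n3 : y0 - e != y0 by apply: side2; left.
  have n4 : y0 + e != y0 by apply: side2; right.
  have n5 : a != x0 by rewrite lt_eqF.
  have n6 : b != x0 by rewrite gt_eqF.
  have n7 : c != y0 by rewrite lt_eqF.
  have n8 : d != y0 by rewrite gt_eqF.
  rewrite (@rect_int_hsplit _ a b c d (x0 - e)) //;
    [|exact: ih|exact: ih|exact: iv|exact: iv|exact: iv].
  rewrite (@rect_int_hsplit _ (x0 - e) b c d (x0 + e)) //;
    [|exact: ih|exact: ih|exact: iv|exact: iv|exact: iv].
  rewrite (@rect_int_vsplit _ (x0 - e) (x0 + e) c d (y0 - e)) //;
    [|exact: iv|exact: iv|exact: ih|exact: ih|exact: ih].
  rewrite (@rect_int_vsplit _ (x0 - e) (x0 + e) (y0 - e) d (y0 + e)) //;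
    [|exact: iv|exact: iv|exact: ih|exact: ih|exact: ih].
  have out (x1 x2 y1 y2 : R) : a <= x1 -> x1 <= x2 -> x2 <= b -> c <= y1 -> y1 <= y2 ->
      y2 <= d -> (x2 <= x0 - e \/ x0 + e <= x1) \/ (y2 <= y0 - e \/ y0 + e <= y1) ->
      rect_int G x1 x2 y1 y2 = 0.
    move=> g1 g2 g3 g4 g5 g6 g7; apply: goursat_rect => // x y /andP[k1 k2] /andP[k3 k4].
    apply: hG; first by rewrite (le_trans g1 k1) (le_trans k2 g3).
      by rewrite (le_trans g4 k3) (le_trans k4 g6).
    apply: ne; case: g7 => -[g|g]; [left; apply: side1; left|left; apply: side1; right|
      right; apply: side2; left|right; apply: side2; right].
    - exact: le_trans k2 g.
    - exact: le_trans g k1.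
    - exact: le_trans k4 g.
    - exact: le_trans g k3.
  rewrite (out a (x0 - e)) //; last by left; left.
  rewrite (out (x0 + e) b) //; last by left; right.
  rewrite (out (x0 - e) (x0 + e) c) //; last by right; left.
  rewrite (out (x0 - e) (x0 + e) (y0 + e)) //; last by right; right.
  rewrite !add0r !addr0.
  have -> : 16 * M * e = 4 * M * ((x0 + e - (x0 - e)) + (y0 + e - (y0 - e))) by ring.
  apply: rect_int_bound => //; try by [exact: ih|exact: iv].
  by move=> x y hx hy; apply: hM; rewrite ler_norml; clear -hx hy e5; lra.
apply/eqP; rewrite -nc_eq0 eq_le nc_ge0 andbT.
set m := Num.min (Num.min (x0 - a) (b - x0)) (Num.min (Num.min (y0 - c) (d - y0)) rho).
have m0 : 0 < m by rewrite /m !lt_min !subr_gt0 ax xb cy yd.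
apply/ler_addgt0Pr => eta eta0; rewrite add0r.
(* The first bound keeps the square inside the rectangle and within rho of the singularity, the
   second brings 16 M e below eta; the added 1 allows M = 0. *)
set e := Num.min (m / 2) (eta / (16 * M + 1)).
have K0 : 0 < 16 * M + 1 by clear -M0; lra.
have e0 : 0 < e by rewrite lt_min !divr_gt0.
have em : e < m by apply: (@le_lt_trans _ _ (m / 2)); [rewrite ge_min lexx|clear -m0; lra].
have ee : e * (16 * M + 1) <= eta by rewrite -ler_pdivlMr // ge_min lexx orbT.
move: em; rewrite /m !lt_min -!andbA => /and5P[m1 m2 m3 m4 m5].
apply: le_trans (small e e0 _ _ _ _ (ltW m5)) _; [clear -m1|clear -m2|clear -m3|clear -m4|
  clear -ee e0]; lra.
Qed.

End RectangleIntegral.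

(** * Dominated convergence, truncation and the integral of the Cauchy kernel *)

Section RealIntegrals.
Variable R : realType.
Local Notation C := R[i].
Local Notation mu := (@lebesgue_measure R).

Lemma Rintegral_dominated_cvg (D : set R) (f_ : nat -> R -> R) (f g : R -> R) :
  measurable D -> (forall n, measurable_fun D (f_ n)) ->
  (forall x, D x -> f_ n x @[n --> \oo] --> f x) ->
  rinteg D g -> (forall n x, D x -> `|f_ n x| <= g x) ->
  rinteg D f /\
  (\int[mu]_(x in D) f_ n x) @[n --> \oo] --> (\int[mu]_(x in D) f x).
Proof.
move=> mD mf ff ig fg.
have mf' n : measurable_fun D (EFin \o f_ n) by exact/measurable_EFinP.
have ff' x : D x -> (EFin \o f_ n) x @[n --> \oo] --> (EFin \o f) x.
  by move=> Dx; apply: cvg_EFin; [exact: nearW|exact: ff].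
have mff : measurable_fun D f by exact: (@measurable_fun_cvg _ _ _ _ f_).
have hf : rinteg D f.
  apply: rinteg_le ig => // x Dx.
  apply: (ler_cvg_to (cvg_norm (ff x Dx)) (cvg_cst (g x))).
  by apply: nearW => n; exact: fg.
split => //; apply: fine_cvg; rewrite fineK; last exact: integrable_fin_num.
apply: (@dominated_cvg _ _ _ mu D mD (fun n => EFin \o f_ n) (EFin \o f) (EFin \o g)) => //.
Qed.

(** The end points are left free because the contours end at heights known only to lie within a unit
    interval beyond n and -n. *)
Lemma truncation_cvg (f : R -> R) (A B : nat -> R) : rinteg setT f ->
  (forall n, A n <= - n%:R) -> (forall n, n%:R <= B n) ->
  (\int[mu]_(x in `[A n, B n]) f x) @[n --> \oo] --> (\int[mu]_x f x).
Proof.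
move=> hf hA hB.
have := @Rintegral_dominated_cvg setT (fun n => f \_ `[A n, B n]) f (fun x => `|f x|).
move=> /(_ measurableT) [||||_].
- move=> n; have mf : measurable_fun setT f.
    by apply/measurable_EFinP; exact: (measurable_int mu hf).
  have mY : measurable (`[A n, B n]%classic : set R) by exact: measurable_itv.
  by apply: (measurable_restrictT f mY).1; exact: measurable_funTS.
- move=> x _; apply/cvgrPdist_lt => e e0; near=> n.
  rewrite patchE mem_set ?subrr ?normr0 //= in_itv /= /=.
  suff : `|x| <= n%:R by rewrite ler_norml; have := hA n; have := hB n; lra.
  apply: ltW; apply: lt_le_trans (archi_boundP (normr_ge0 _)) _.
  by rewrite ler_nat; near: n; exists (Num.bound `|x|).
- exact: integrable_norm.
- by move=> n x _; rewrite /= patchE; case: ifP => // _; rewrite normr0.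
by under eq_fun do rewrite -Rintegral_mkcond.
Unshelve. all: by end_near. Qed.

Lemma ctruncation (phi : R -> C) (A B : nat -> R) : cinteg setT phi ->
  (forall n, A n <= - n%:R) -> (forall n, n%:R <= B n) ->
  forall e, 0 < e -> exists N, forall n, (N <= n)%N ->
  nc (cint setT phi - cint `[A n, B n] phi) < e.
Proof.
move=> [h1 h2] hA hB e e0; have e2 : 0 < e / 2 by lra.
have /cvgrPdist_lt/(_ _ e2)[N1 _ H1] := truncation_cvg h1 hA hB.
have /cvgrPdist_lt/(_ _ e2)[N2 _ H2] := truncation_cvg h2 hA hB.
exists (maxn N1 N2) => n; rewrite geq_max => /andP[n1 n2].
apply: le_lt_trans (nc_ReIm _) _; rewrite !ReImE /=.
by have := H1 n n1; have := H2 n n2; rewrite /=; lra.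
Qed.

Lemma integral_oneDsqrV : (\int[mu]_x ((1 + x ^+ 2)^-1)%:E = pi%:E)%E.
Proof.
rewrite (@ge0_symfun_integralT R (fun x => (1 + x ^+ 2)^-1)).
- have -> : [set x : R | 0 <= x] = `[0, +oo[%classic.
    by apply/seteqP; split => x /=; rewrite in_itv /= andbT.
  rewrite integral0y_oneDsqr -EFinM; congr (_%:E).
  by rewrite mulrC divfK.
- by move=> x; rewrite invr_ge0 addr_ge0 // sqr_ge0.
- exact: continuous_oneDsqrV.
- by move=> x; rewrite /= sqrrN.
Qed.

Lemma cauchy_kernel_continuous (s t : R) : 0 < s ->
  continuous (fun w => (s ^+ 2 + (w - t) ^+ 2)^-1).
Proof.
move=> s0 w; apply: cvgV.
  by rewrite gt_eqF // ltr_pwDl ?sqr_ge0 // exprn_gt0.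
apply: cvgD; first exact: cvg_cst.
rewrite expr2; under eq_fun do rewrite expr2.
by apply: cvgM; apply: cvgB => //; exact: cvg_cst.
Qed.

(** The affine substitution (w - t)/s reduces this to the arctangent integral. The integrand is the
    squared modulus of 1/(z - z0) on a vertical line at distance s from z0. *)
Lemma cauchy_kernel_integral (s t : R) : 0 < s ->
  (\int[mu]_w ((s ^+ 2 + (w - t) ^+ 2)^-1)%:E = (pi / s)%:E)%E.
Proof.
move=> s0.
pose F (w : R) : R := (w - t) / s.
have dF (w : R) : is_derive w 1 F s^-1.
  rewrite /F; apply: is_derive_eq.
  by rewrite ?scaler0 ?subr0 ?add0r ?addr0 /GRing.scale /= mulr1.
have F' : F^`() = cst s^-1.
  by apply/funext => w; rewrite derive1E; exact: (@derive_val _ _ _ _ _ _ _ (dF w)).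
have := @increasing_ge0_integration_by_substitutionT R F (fun x => (1 + x ^+ 2)^-1).
rewrite integral_oneDsqrV F' => H.
have {H} : (pi%:E = \int[mu]_w (s * (s ^+ 2 + (w - t) ^+ 2)^-1)%:E)%E.
  rewrite H.
  - apply: eq_integral => w _; congr (_%:E); rewrite /= /F.
    rewrite -[LHS]/((1 + ((w - t) / s) ^+ 2)^-1 * s^-1).
    have s2 : s ^+ 2 + (w - t) ^+ 2 != 0.
      by rewrite gt_eqF // ltr_pwDl ?sqr_ge0 // exprn_gt0.
    have -> : 1 + ((w - t) / s) ^+ 2 = (s ^+ 2 + (w - t) ^+ 2) / s ^+ 2.
      by field; rewrite gt_eqF.
    by field; rewrite s2 gt_eqF.
  - by move=> x y xy; rewrite /F ltr_pM2r ?invr_gt0 // ltrD2r.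
  - by move=> x; exact: cst_continuous.
  - exact: is_cvg_cst.
  - exact: is_cvg_cst.
  - by move=> x; case: (dF x).
  - apply/cvgrNyPle => A; near=> w; rewrite /F ler_pdivrMr // lerBlDr.
    by near: w; apply: nbhs_ninfty_le; exact: num_real.
  - apply/cvgryPge => A; near=> w; rewrite /F ler_pdivlMr // lerBrDr.
    by near: w; apply: nbhs_pinfty_ge; exact: num_real.
  - exact: continuous_oneDsqrV.
  - by move=> x; rewrite invr_ge0 addr_ge0 // sqr_ge0.
under eq_integral do rewrite EFinM.
have ge w : 0 <= (s ^+ 2 + (w - t) ^+ 2)^-1.
  by rewrite invr_ge0 addr_ge0 // sqr_ge0.
rewrite ge0_integralZl_EFin //; first last.
- exact: ltW.
- apply/measurable_EFinP; apply: continuous_measurable_fun.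
  exact: (cauchy_kernel_continuous s0).
- by move=> w _; rewrite lee_fin.
set I := (\int[mu]_x _)%E => hI; rewrite EFinM [in RHS]hI muleAC -EFinM divff ?mul1e //.
by rewrite gt_eqF.
Unshelve. all: by end_near. Qed.

Lemma cauchy_kernel_integ (s t : R) : 0 < s ->
  rinteg setT (fun w => (s ^+ 2 + (w - t) ^+ 2)^-1) /\
  \int[mu]_w (s ^+ 2 + (w - t) ^+ 2)^-1 = pi / s.
Proof.
move=> s0; split; last by rewrite /Rintegral cauchy_kernel_integral.
apply: (@rinteg_nneg _ _ _ (pi / s) _ _ _).1.
- apply: continuous_measurable_fun; exact: (cauchy_kernel_continuous s0).
- by move=> w; rewrite invr_ge0 addr_ge0 // sqr_ge0.
- by rewrite cauchy_kernel_integral.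
Qed.

End RealIntegrals.

(** * Heights with a controlled horizontal integral *)

Section GoodHeights.
Variable R : realType.
Local Notation C := R[i].
Local Notation mu := (@lebesgue_measure R).

(** An open set is the union of the countably many rational boxes that it contains, and boxes belong
    to the product sigma-algebra required by Tonelli's theorem. *)
Lemma box_open_measurable (U : set (R * R)) :
  (forall p, U p -> exists2 e : R, 0 < e &
     forall x y, `|x - p.1| < e -> `|y - p.2| < e -> U (x, y)) ->
  measurable U.
Proof.
move=> hU.
pose box (k : rat * rat * (rat * rat)) : set (R * R) :=
  `]ratr k.1.1, ratr k.1.2[%classic `*` `]ratr k.2.1, ratr k.2.2[%classic.
pose bx (n : nat) : set (R * R) := if unpickle n is Some k then
  (if `[< box k `<=` U >] then box k else set0) else set0.
suff -> : U = \bigcup_n bx n.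
  apply: bigcup_measurable => n _; rewrite /bx; case: unpickle => // k.
  by case: ifP => // _; apply: measurableX; exact: measurable_itv.
apply/seteqP; split => [[x y] Uxy|p [n _]]; last first.
  rewrite /bx; case: unpickle => // k; case: ifP => // /asboolP; exact.
have [e e0 he] := hU _ Uxy.
have lt1 (z : R) : z - e < z by lra.
have lt2 (z : R) : z < z + e by lra.
have [a] := rat_in_itvoo (lt1 x); have [b] := rat_in_itvoo (lt2 x).
have [c] := rat_in_itvoo (lt1 y); have [d] := rat_in_itvoo (lt2 y).
rewrite !in_itv /= => /andP[d1 d2] /andP[c1 c2] /andP[b1 b2] /andP[a1 a2].
refine (ex_intro2 _ _ (pickle ((a, b), (c, d))) I _); rewrite /bx pickleK.
rewrite ifT; first by split => /=; rewrite in_itv /= ?a2 ?b1 ?c2 ?d1.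
apply/asboolP => -[u v] [] /=; rewrite !in_itv /= => /andP[u1 u2] /andP[v1 v2].
by apply: he; rewrite /= ltr_norml; lra.
Qed.

Lemma nc_measurable_halfplane (F : C -> C) : (forall z, Cplus z -> ccont F z) ->
  measurable_fun [set p : R * R | 0 < p.1] (fun p => nc (F (Complex p.1 p.2))).
Proof.
move=> cF mD; apply: (measurability _ (RGenOInfty.measurableE R)) => //.
move=> _ [_ [a ->] <-]; apply: box_open_measurable => -[t y] [/= t0].
rewrite in_itv /= andbT => ha.
have e0 : 0 < nc (F (Complex t y)) - a by lra.
have [del del0 H] := cF (Complex t y) t0 _ e0.
exists (Num.min t (del / 2)); first by rewrite lt_min t0 /=; lra.
move=> u v /=; rewrite !lt_min => /andP[u1 u2] /andP[_ v2].
split=> /=; first by move: u1; rewrite ltr_norml; lra.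
rewrite in_itv /= andbT.
have := H (Complex (u - t) (v - y)).
rewrite (_ : Complex t y + Complex (u - t) (v - y) = Complex u v); last first.
  by rewrite complexD !(addrC _ (_ - _)) !subrK.
have h : nc (Complex (u - t) (v - y) : C) < del.
  by apply: le_lt_trans (nc_ReIm _) _ => /=; lra.
move=> /(_ h); have := nc_dist (F (Complex t y)) (F (Complex u v)).
rewrite ncBC; lra.
Qed.

(** A mean value argument: if every height in the unit interval failed, integrating over the heights
    would give at least (X - x) M + 1, while the other order of integration gives at most (X - x) M.
    It serves in place of any pointwise decay of [F]. *)
Lemma good_height (F : C -> C) (x X M m : R) : 0 < x -> x <= X ->
  (forall z, Cplus z -> ccont F z) ->
  (forall t, 0 < t -> (\int[mu]_(w in setT) (abs2 (F (Complex t w)))%:E <= M%:E)%E) ->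
  exists2 Y, m <= Y <= m + 1 &
    \int[mu]_(t in `[x, X]) (nc (F (Complex t Y)) ^+ 2) <= (X - x) * M + 1.
Proof.
move=> x0 xX cF hM.
pose h (p : R * R) := nc (F (Complex p.1 p.2)) ^+ 2.
pose A := (`[x, X]%classic : set R); pose B := (`[m, m + 1]%classic : set R).
have mA : measurable A by exact: measurable_itv.
have mB : measurable B by exact: measurable_itv.
have mAB : measurable (A `*` B) by exact: measurableX.
have mh : measurable_fun (A `*` B) h.
  apply: measurable_funX.
  apply: (measurable_funS _ _ (nc_measurable_halfplane cF)).
    by apply: box_open_measurable => -[t y] /= t0; exists t => // u v /=; rewrite ltr_norml; lra.
  by move=> [t y] [+ _]; rewrite /A /= in_itv /= => /andP[? _]; lra.
have muA : mu A = (X - x)%:E.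
  rewrite /A lebesgue_measure_itv /= lte_fin; case: ltP => [_|Xx]; first by rewrite EFinB.
  by rewrite (le_anti (introT andP (conj xX Xx))) subrr.
(* Extension by zero turns the integral over [A] x [B] into one over the plane, to which Tonelli's
   theorem applies. *)
pose f (p : R * R) := ((h \_ (A `*` B)) p)%:E.
have mf : measurable_fun setT f.
  by apply/measurable_EFinP; apply: (measurable_restrictT h mAB).1.
have f0 p : (0 <= f p)%E.
  by rewrite /f lee_fin patchE; case: ifP => // _; rewrite sqr_ge0.
have h0 p : 0 <= h p by exact: sqr_ge0.
have Sl (t : R) : A t -> (\int[mu]_y f (t, y) <= M%:E)%E.
  move=> At; apply: le_trans (hM t _); last by move: At; rewrite /A /= in_itv /=; lra.
  apply: ge0_le_integral => //.
  - exact: (measurableT_comp mf (pair1_measurable t)).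
  - apply/measurable_EFinP; under eq_fun do rewrite abs2E; apply: measurable_funX.
    apply: continuous_measurable_fun => w; apply: rcont_nc; apply: ccont_vseg; apply: cF.
    by move: At; rewrite /A /= in_itv /= /Cplus /=; lra.
  - move=> y _; rewrite /f lee_fin abs2E patchE /h /=; case: ifP => // _; exact: sqr_ge0.
apply: contrapT => hn.
have hn' Y : B Y -> (X - x) * M + 1 < \int[mu]_(t in A) (nc (F (Complex t Y)) ^+ 2).
  move=> BY; rewrite ltNge; apply/negP => le; apply: hn; exists Y => //.
have up : (\int[mu]_t \int[mu]_y f (t, y) <= ((X - x) * M)%:E)%E.
  rewrite (_ : (\int[mu]_t _)%E = (\int[mu]_(t in A) \int[mu]_y f (t, y))%E).
    apply: (@le_trans _ _ (\int[mu]_(t in A) M%:E)%E).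
      apply: ge0_le_integral => //.
      - by move=> t _; exact: integral_ge0.
      - by apply: measurable_funTS; exact: measurable_fun_fubini_tonelli_F.
    by rewrite integral_cst // [X in (_ * X)%E](muA) -EFinM mulrC.
  rewrite [RHS]integral_mkcond; apply: eq_integral => t _; rewrite patchE.
  case: ifPn => // tA; apply: integral0_eq => y _; rewrite /f patchE ifF //.
  by apply/negbTE; apply: contra tA; rewrite !inE => -[].
have dn : (((X - x) * M + 1)%:E <= \int[mu]_y \int[mu]_t f (t, y))%E.
  apply: (@le_trans _ _ (\int[mu]_(y in B) ((X - x) * M + 1)%:E)%E).
    rewrite integral_cst //= lebesgue_measure_itv /= lte_fin ifT; last by clear; lra.
    by rewrite -EFinB -EFinM lee_fin; clear; lra.
  have K0 : 0 <= (X - x) * M + 1.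
    have M0 : 0 <= M.
      by rewrite -lee_fin; apply: le_trans (hM x x0); apply: integral_ge0 => w _;
        rewrite lee_fin abs2E sqr_ge0.
    by rewrite addr_ge0 // mulr_ge0 // subr_ge0.
  rewrite integral_mkcond; apply: ge0_le_integral => //.
  - by move=> y _; rewrite patchE; case: ifP.
  - by apply: (measurable_restrictT _ mB).1; exact: measurable_cst.
  - exact: measurable_fun_fubini_tonelli_G.
  move=> y _; rewrite patchE; case: ifPn => [|_]; last exact: integral_ge0.
  rewrite inE => By.
  have -> : (\int[mu]_t f (t, y) = \int[mu]_(t in A) (nc (F (Complex t y)) ^+ 2)%:E)%E.
    rewrite [RHS]integral_mkcond; apply: eq_integral => t _; rewrite /f !patchE.
    have [tA|tA] := boolP (t \in A).
      by rewrite ifT // inE; split => //=; exact: set_mem.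
    by rewrite ifF //; apply/negbTE; apply: contra tA; rewrite !inE => -[].
  have := hn' y By; rewrite /Rintegral => /ltW; rewrite -lee_fin fineK //.
  apply: integrable_fin_num => //.
  apply: cont_rinteg => t /andP[t1 t2].
  by apply: rcont_nc2; apply: (@ccont_hseg _ F); apply: cF; rewrite /Cplus /=; lra.
move: dn; rewrite -(@fubini_tonelli _ _ _ _ _ mu mu f mf f0) => /le_trans /(_ up).
by rewrite lee_fin; clear; lra.
Qed.

End GoodHeights.

(** * Square-integrable functions on a vertical line *)

Section SquareIntegrable.
Variable R : realType.
Local Notation C := R[i].
Local Notation mu := (@lebesgue_measure R).
Implicit Types (phi psi : R -> C) (F G : C -> C).

Definition cmeas phi := measurable_fun setT (fun t => complex.Re (phi t)) /\
  measurable_fun setT (fun t => complex.Im (phi t)).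

Lemma rcont_cmeas phi : (forall t, rcont phi t) -> cmeas phi.
Proof.
by move=> h; split; apply: continuous_measurable_fun => t; [exact: rcont_Re|exact: rcont_Im].
Qed.

Lemma cmeasM phi psi : cmeas phi -> cmeas psi -> cmeas (fun t => phi t * psi t).
Proof.
move=> [a1 a2] [b1 b2]; split.
  by under eq_fun do rewrite cReM; apply: measurable_funB; exact: measurable_funM.
by under eq_fun do rewrite cImM; apply: measurable_funD; exact: measurable_funM.
Qed.

Lemma cmeas_nc2 phi : cmeas phi -> measurable_fun setT (fun t => nc (phi t) ^+ 2).
Proof.
move=> [a1 a2]; under eq_fun do rewrite nc_sqr.
by apply: measurable_funD; exact: measurable_funX.
Qed.

Definition sqint phi := rinteg setT (fun t => nc (phi t) ^+ 2).
Definition sqn phi : R := \int[mu]_t (nc (phi t) ^+ 2).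

Lemma sqn_ge0 phi : 0 <= sqn phi.
Proof. by apply: Rintegral_ge0 => t _; exact: sqr_ge0. Qed.

(** The weight [t] is kept free through all integrations and limits; it is optimised only in
    [sqr_le_of_amgm], or chosen to fit where a small error is wanted. *)
Lemma amgm (a b t : R) : 0 < t -> 2 * (a * b) <= t * a ^+ 2 + t^-1 * b ^+ 2.
Proof.
move=> t0; have := mulr_ge0 (ltW t0) (sqr_ge0 (a - t^-1 * b)).
have -> : t * (a - t^-1 * b) ^+ 2 = t * a ^+ 2 + t^-1 * b ^+ 2 - 2 * (a * b).
  by field; rewrite gt_eqF.
lra.
Qed.

Lemma cint_pair phi psi : cmeas phi -> cmeas psi -> sqint phi -> sqint psi ->
  cinteg setT (fun t => phi t * psi t) /\
  forall t, 0 < t ->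
    nc (cint setT (fun t => phi t * psi t)) <= t * sqn phi + t^-1 * sqn psi.
Proof.
move=> m1 m2 i1 i2.
have ig t : rinteg setT (fun u => t * nc (phi u) ^+ 2 + t^-1 * nc (psi u) ^+ 2).
  by apply: rintegD => //; exact: rintegZ.
have I : cinteg setT (fun t => phi t * psi t).
  have [n1 n2] := cmeasM m1 m2.
  apply: (cinteg_le measurableT n1 n2 (ig 1)) => u _; rewrite ncM.
  have := amgm (nc (phi u)) (nc (psi u)) ltr01.
  have := mulr_ge0 (nc_ge0 (phi u)) (nc_ge0 (psi u)); lra.
split => // t t0.
(* The factor 1/2 given by AM-GM cancels the 2 of [nc_cint_le]. *)
have := @nc_cint_le R setT _ (fun u => 2^-1 * (t * nc (phi u) ^+ 2 + t^-1 * nc (psi u) ^+ 2))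
  measurableT I.
have -> : \int[mu]_u (2^-1 * (t * nc (phi u) ^+ 2 + t^-1 * nc (psi u) ^+ 2)) =
    2^-1 * (t * sqn phi + t^-1 * sqn psi).
  rewrite RintegralZl //; last exact: ig.
  rewrite RintegralD //; [|exact: rintegZ|exact: rintegZ].
  by rewrite !RintegralZl.
rewrite mulrA mulfV // mul1r; apply; first by apply: rintegZ => //; exact: ig.
by move=> u _; rewrite ncM; have := amgm (nc (phi u)) (nc (psi u)) t0; lra.
Qed.

Lemma H2_line F (M x : R) : (forall z, Cplus z -> ccont F z) -> 0 < x ->
  (\int[mu]_(w in setT) (abs2 (F (Complex x w)))%:E <= M%:E)%E ->
  [/\ cmeas (vseg F x), sqint (vseg F x) & sqn (vseg F x) <= M].
Proof.
move=> cF x0 hM.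
have m : cmeas (vseg F x).
  by apply: rcont_cmeas => t; apply: ccont_vseg; exact: cF.
have [] := @rinteg_nneg R setT (fun t => nc (vseg F x t) ^+ 2) M _ _ _ => //.
- exact: cmeas_nc2.
- by move=> t; exact: sqr_ge0.
by under eq_integral do rewrite -abs2E.
Qed.

End SquareIntegrable.

(** * Inequalities for the truncation heights *)

Section TruncationHeights.
Variable R : realType.
Implicit Types A B n t q e u v : R.

Lemma height_ge n t q : `|t| + 1 + q < n -> 0 <= q ->
  1 <= n - `|t| /\ q <= n - `|t|.
Proof. by move=> h q0; split; lra. Qed.

Lemma height_below A n t : A <= - n -> n - `|t| <= `|A - t|.
Proof.
move=> h; rewrite ler_normr; apply/orP; right.
by have := ler_norm (- t); rewrite normrN; lra.
Qed.

Lemma height_above B n t : n <= B -> n - `|t| <= `|B - t|.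
Proof.
by move=> h; rewrite ler_normr; apply/orP; left; have := ler_norm t; lra.
Qed.

Lemma height_between A B n t : A <= - n -> n <= B -> 1 <= n - `|t| -> A < t < B.
Proof.
move=> hA hB h; have := ler_norm t; have := ler_norm (- t); rewrite normrN.
by move=> h1 h2; apply/andP; split; lra.
Qed.

Lemma sum_quarters u v e : u <= e / 4 -> v <= e / 4 ->
  e / 4 + (u + v + e / 8 + e / 8) <= e.
Proof. by move=> hu hv; lra. Qed.

End TruncationHeights.

(** * Cauchy's formula on a vertical line *)

Section CauchyLine.
Variable R : realType.
Local Notation C := R[i].
Local Notation mu := (@lebesgue_measure R).
Variables (F : C -> C) (M : R).
Hypothesis dF : forall z, Cplus z -> cdiff F z.
Hypothesis hM : forall t, 0 < t ->
  (\int[mu]_(w in setT) (abs2 (F (Complex t w)))%:E <= M%:E)%E.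

Let cF z : Cplus z -> ccont F z. Proof. by move=> /dF/cdiff_cont. Qed.

Lemma nc_sub_re (z w : C) : complex.Re z - complex.Re w <= nc (z - w).
Proof. by apply: le_trans (Re_le _); rewrite cReD cReN. Qed.

Lemma neq_re (z w : C) : complex.Re w < complex.Re z -> z - w != 0.
Proof. by move=> h; rewrite -nc_gt0; apply: lt_le_trans (nc_sub_re z w); rewrite subr_gt0. Qed.

Lemma nc_sqr_neq0 (z : C) : nc z ^+ 2 != 0 -> z != 0.
Proof. by apply: contra => /eqP ->; rewrite nc0 expr0n. Qed.

Variables (x sg ta : R).
Hypotheses (x0 : 0 < x) (sg0 : 0 < sg).
Let s : C := Complex (x + sg) ta.
(** The mirror image of [s] in the line Re z = x, hence outside the region enclosed by the
    contours. *)
Let s' : C := Complex (x - sg) ta.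
Let K (z : C) : C := (z - s)^-1 - (z - s')^-1.
(* F/(z-s) corrected by a multiple of the Poisson kernel K: the singularity at s
   becomes removable and the line integral of K is known. *)
Let G (z : C) : C := F z / (z - s) - F s * K z.

Let Ps : Cplus s. Proof. by move: (x0) (sg0) => x1 g1; rewrite /Cplus /s /=; lra. Qed.

Let zs' (z : C) : x <= complex.Re z -> z - s' != 0.
Proof. by move: (sg0) => g1 h; apply: neq_re; rewrite /s' /=; lra. Qed.

(** A difference quotient of [F] plus a term regular to the right of the line: this exhibits the
    singularity at [s] as removable. *)
Let GE z : z - s != 0 -> x <= complex.Re z ->
  G z = (F z - F s) / (z - s) + F s / (z - s').
Proof. by move=> h1 h2; have h3 := zs' h2; rewrite /G /K; field; rewrite h1 h3. Qed.

Let G_diff z : x <= complex.Re z -> z != s -> cdiff G z.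
Proof.
move: (x0) (sg0) => x1 g1 hz zs; have h1 : z - s != 0 by rewrite subr_eq0.
have h2 := zs' hz.
have d1 (w : C) : z - w != 0 -> cdiff (fun u => (u - w)^-1) z.
  by move=> h; apply: cdiffV => //; apply: cdiffB; [exact: cdiff_id|exact: cdiff_cst].
apply: cdiffB; first by apply: cdiffM; [apply: dF; rewrite /Cplus; lra|exact: d1].
by apply: cdiffM; [exact: cdiff_cst|apply: cdiffB; exact: d1].
Qed.

Let G_rect X A B : x + sg < X -> A < ta < B -> rect_int G x X A B = 0.
Proof.
move: (x0) (sg0) => x1 g1 hX hAB; have [d hd] := dF Ps.
have [del del0 H] := hd 1 ltr01.
(* The bound adds |F'(s)| + 1 for the difference quotient of [F] near [s] and |F s|/sg for the other
   term of [GE], since [z] stays at distance at least sg from [s']. *)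
apply: (@goursat_removable R G x X A B (x + sg) ta (nc d + 1 + nc (F s) / sg)) => //.
- by rewrite hX andbT; lra.
- move=> u v hu hv huv; apply: G_diff => //=; lra.
exists (Num.min (del / 4) sg); first by rewrite lt_min sg0 andbT; lra.
move=> u v; rewrite !le_min => /andP[u1 u2] /andP[v1 _].
set z := Complex u v.
have hz : x <= complex.Re z by move: u2; rewrite /z /= ler_norml; lra.
have ls' : sg <= nc (z - s').
  by apply: le_trans (nc_sub_re _ _); move: u2; rewrite ler_norml /s' /=; lra.
have bs : nc (F s / (z - s')) <= nc (F s) / sg.
  rewrite ncM ncV ler_wpM2l ?nc_ge0 // lef_pV2 ?posrE //; exact: lt_le_trans ls'.
have [zs|zs] := eqVneq (z - s) 0.
  (* At [s] itself the inverse of 0 is 0, so only the regular term survives. *)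
  rewrite /G /K zs invr0 mulr0 !sub0r mulrN opprK.
  by apply: le_trans bs _; rewrite lerDr addr_ge0 // nc_ge0.
rewrite GE //; apply: le_trans (ncD _ _) _; apply: lerD => //.
have hh : nc (z - s) < del.
  by apply: le_lt_trans (nc_ReIm _) _; rewrite !ReImE /s /=; lra.
have := H _ hh; rewrite mul1r (_ : s + (z - s) = z) => [hd1|]; last by ring.
rewrite ncM ncV ler_pdivrMr ?nc_gt0 //.
rewrite -(subrK (d * (z - s)) (F z - F s)); apply: le_trans (ncD _ _) _.
by rewrite ncM; lra.
Qed.

Let c := 2 * sg * nc (F s).
Let c0 : 0 <= c. Proof. by rewrite mulr_ge0 ?nc_ge0 // mulr_ge0 // ltW. Qed.

Let zz' (z : C) : x <= complex.Re z -> nc (z - s) <= nc (z - s').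
Proof.
move: (x0) (sg0) => x1 g1 hz; rewrite -(@ler_pXn2r _ 2) ?nnegrE ?nc_ge0 //.
rewrite !nc_sqr !ReImE /s /s' /=.
nra.
Qed.

(** The difference of the two fractions is 2 sg/((z - s)(z - s')), and to the right of the line [s']
    is farther away than [s]: the correction decays quadratically. *)
Let K_bound (z : C) : x <= complex.Re z -> z - s != 0 ->
  nc (F s * K z) <= c / nc (z - s) ^+ 2.
Proof.
move: (x0) (sg0) => x1 g1 hz zs; have zs1 := zs' hz.
have -> : K z = Complex (2 * sg) 0 / ((z - s) * (z - s')).
  have -> : Complex (2 * sg) 0 = (z - s') - (z - s) :> C.
    by apply: complex_ext; rewrite !ReImE /s /s' /=; ring.
  by rewrite /K; field; rewrite zs zs1.
rewrite ncM ncM ncV ncM (_ : nc (Complex (2 * sg) 0) = 2 * sg); last first.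
  by rewrite nc_real gtr0_norm // mulr_gt0.
rewrite [leLHS](_ : _ = c * (nc (z - s) * nc (z - s'))^-1); last by rewrite /c; ring.
apply: ler_wpM2l; first exact: c0.
have p1 : 0 < nc (z - s) by rewrite nc_gt0.
have p2 := lt_le_trans p1 (zz' hz).
rewrite lef_pV2 ?posrE ?mulr_gt0 // ?exprn_gt0 //.
by rewrite expr2 ler_wpM2l ?zz' // ltW.
Qed.

Let k (X : R) (w : R) : C := (Complex X w - s)^-1.

(** Only the squared distance to [s] enters, so this serves both the line Re z = x on the left of
    [s] and the lines Re z = X on its right. *)
Let ker_line X a : 0 < a -> (X - (x + sg)) ^+ 2 = a ^+ 2 ->
  [/\ cmeas (k X), sqint (k X), sqn (k X) = pi / a &
     forall w, nc (k X w) ^+ 2 = (a ^+ 2 + (w - ta) ^+ 2)^-1].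
Proof.
move=> a0 ha.
have kE w : nc (k X w) ^+ 2 = (a ^+ 2 + (w - ta) ^+ 2)^-1.
  by rewrite /k ncV exprVn nc_sqr !ReImE /s /= ha.
have [i1 i2] := cauchy_kernel_integ ta a0.
split => //.
- apply: rcont_cmeas => w.
  apply: (@ccont_vseg R (fun z => (z - s)^-1)); apply: cdiff_cont.
  apply: cdiffV; last by apply: cdiffB; [exact: cdiff_id|exact: cdiff_cst].
  apply: nc_sqr_neq0; rewrite nc_sqr !ReImE /s /= ha.
  by rewrite gt_eqF // ltr_pwDl ?sqr_ge0 // exprn_gt0.
- by apply: eq_rinteg i1 => // w _; rewrite kE.
- by rewrite /sqn -i2; apply: eq_Rintegral => w _; rewrite kE.
Qed.

Let rint_sub (A B : R) (g : R -> R) : rinteg setT g -> (forall w, 0 <= g w) ->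
  \int[mu]_(w in `[A, B]) g w <= \int[mu]_w g w.
Proof.
move=> ig g0; rewrite /Rintegral fine_le //.
- by apply: integrable_fin_num => //; apply: integrableS ig.
- exact: integrable_fin_num.
apply: ge0_subset_integral => //.
- by apply: (measurable_int mu ig).
- by move=> w _; rewrite lee_fin.
Qed.

(** AM-GM with weight [t] treats F/(z - s), and [K_bound] the correction. A small [t] makes the
    first term small, after which a large [X] makes the second small, uniformly in [A] and [B]. *)
Let right_bound X A B t : x + sg < X -> 0 < t ->
  nc (cint `[A, B] (vseg G X)) <= 2 * (t * M + (t^-1 + c) * (pi / (X - (x + sg)))).
Proof.
move: (x0) (sg0) => x1 g1 hX t0.
have a0 : 0 < X - (x + sg) by lra.
have [_ ik sk kE] := ker_line a0 erefl.
have [_ iF sF] : [/\ cmeas (vseg F X), sqint (vseg F X) & sqn (vseg F X) <= M].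
  by apply: H2_line => //; [lra|apply: hM; lra].
pose g w := t * nc (vseg F X w) ^+ 2 + (t^-1 + c) * nc (k X w) ^+ 2.
have ig : rinteg setT g by apply: rintegD => //; exact: rintegZ.
have tc : 0 <= t^-1 + c by rewrite addr_ge0 // invr_ge0 ltW.
have g0 w : 0 <= g w by rewrite addr_ge0 // mulr_ge0 // ?sqr_ge0 // ltW.
have gE : \int[mu]_w g w = t * sqn (vseg F X) + (t^-1 + c) * sqn (k X).
  rewrite RintegralD //; [|exact: rintegZ|exact: rintegZ].
  by rewrite !RintegralZl.
have zs w : Complex X w - s != 0 by apply: neq_re; rewrite /s /=; lra.
have bG w : nc (vseg G X w) <= g w.
  apply: le_trans (ncB _ _) _; rewrite /g mulrDl addrA; apply: lerD.
    rewrite ncM; have := amgm (nc (vseg F X w)) (nc (k X w)) t0.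
    have := mulr_ge0 (nc_ge0 (vseg F X w)) (nc_ge0 (k X w)).
    by rewrite /vseg /k; lra.
  rewrite /k ncV exprVn; apply: K_bound => //=; lra.
have IG : cinteg `[A, B] (vseg G X).
  apply: vseg_integ => u _; apply/cdiff_cont/G_diff; rewrite /=; first lra.
  by rewrite -subr_eq0.
apply: le_trans (nc_cint_le _ IG (g := g) _ _) _ => //.
  by apply: integrableS ig.
apply: ler_wpM2l => //; apply: le_trans (rint_sub _ _ ig g0) _.
by rewrite gE sk lerD2r ler_wpM2l // ltW.
Qed.

(** The decay comes from the distance eta to [s]; the inequality |F| <= |F|^2 + 1 turns the square
    integral controlled at a good height into a bound for the integral of |F|. *)
Let horiz_bound X y eta : x + sg < X -> 1 <= eta -> eta <= `|y - ta| ->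
  \int[mu]_(t in `[x, X]) (nc (F (Complex t y)) ^+ 2) <= (X - x) * M + 1 ->
  nc (cint `[x, X] (hseg G y)) <=
    2 * (eta^-1 * (((X - x) * M + 1) + (1 + c) * (X - x))).
Proof.
move: (x0) (sg0) (c0) => x1 g1 c1 hX e1 ey hy.
have e0 : 0 < eta by lra.
have xX : x <= X by lra.
have ne (t : R) : eta <= nc (Complex t y - s).
  by apply: le_trans ey (le_trans _ (Im_nc _)); rewrite !ReImE /s /=.
have zs (t : R) : Complex t y - s != 0 by rewrite -nc_gt0; exact: lt_le_trans (ne t).
pose g (t : R) := eta^-1 * (nc (F (Complex t y)) ^+ 2 + (1 + c)).
have iF : rinteg `[x, X] (fun t => nc (F (Complex t y)) ^+ 2).
  apply: cont_rinteg => t /andP[t1 t2]; apply: rcont_nc2.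
  by apply: (@ccont_hseg _ F); apply: cF; rewrite /Cplus /=; lra.
have ic : rinteg `[x, X] (fun=> 1 + c) by exact: rinteg_cst.
have iFc : rinteg `[x, X] (fun t => nc (F (Complex t y)) ^+ 2 + (1 + c)).
  exact: rintegD.
have ig : rinteg `[x, X] g by exact: rintegZ.
have IG : cinteg `[x, X] (hseg G y).
  apply: hseg_integ => t /andP[t1 _]; apply/cdiff_cont/G_diff => //.
  by rewrite -subr_eq0.
apply: le_trans (nc_cint_le _ IG ig _) _ => //.
  move=> t; rewrite /= in_itv /= => /andP[t1 _].
  have i1 : (nc (Complex t y - s))^-1 <= eta^-1.
    by rewrite lef_pV2 ?posrE // (lt_le_trans e0).
  have i2 : (nc (Complex t y - s) ^+ 2)^-1 <= eta^-1.
    rewrite lef_pV2 ?posrE ?exprn_gt0 // ?(lt_le_trans e0) //.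
    apply: le_trans (ne t) _; rewrite expr2 ler_peMl ?nc_ge0 //.
    exact: le_trans e1 (ne t).
  apply: le_trans (ncB _ _) _.
  apply: (@le_trans _ _ (nc (F (Complex t y)) * eta^-1 + c * eta^-1)).
    apply: lerD; first by rewrite ncM ncV ler_wpM2l ?nc_ge0.
    by apply: le_trans (K_bound _ _) _ => //; rewrite ler_wpM2l.
  rewrite -mulrDl mulrC /g; apply: ler_wpM2l; first by rewrite invr_ge0 ltW.
  by rewrite addrA lerD2r; have := sqr_ge0 (nc (F (Complex t y)) - 1); nra.
apply: ler_wpM2l => //; rewrite /g RintegralZl //.
apply: ler_wpM2l; first by rewrite invr_ge0 ltW.
by rewrite RintegralD // rint_cst // lerD2r.
Qed.

(** On the line itself (z - s)(z - s') is real, so [K] is -2 sg |k|^2, a multiple of the Poisson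
    kernel, and its integral is -2 sg (pi/sg) = -2 pi. *)
Let left_line : [/\ cinteg setT (fun w => vseg F x w * k x w),
   cinteg setT (vseg G x) &
   cint setT (vseg G x) = cint setT (fun w => vseg F x w * k x w)
     + F s * ((2 * pi)%:C)%C].
Proof.
move: (x0) (sg0) => x1 g1.
have hx : (x - (x + sg)) ^+ 2 = sg ^+ 2 by ring.
have [mk ik sk kE] := ker_line g1 hx.
have [mF iF sF] := H2_line (F := F) (M := M) cF x1 (hM x1).
have [I1 _] := cint_pair mF mk iF ik.
have KE w : K (Complex x w) = ((- (2 * sg) * nc (k x w) ^+ 2)%:C)%C.
  have n0 : sg ^+ 2 + (w - ta) ^+ 2 != 0.
    by rewrite gt_eqF // ltr_pwDl ?sqr_ge0 // exprn_gt0.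
  have hz : x <= complex.Re (Complex x w : C) by [].
  have z1 : Complex x w - s != 0.
    apply: nc_sqr_neq0; rewrite nc_sqr !ReImE /s /=.
    by rewrite [X in X + _]hx.
  have z2 := zs' hz.
  have -> : K (Complex x w) = (s - s') / ((Complex x w - s) * (Complex x w - s')).
    by rewrite /K; field; rewrite z1 z2.
  have -> : (Complex x w - s) * (Complex x w - s') =
      ((- (sg ^+ 2 + (w - ta) ^+ 2))%:C)%C.
    by apply: complex_ext; rewrite !ReImE /s /s' /=; ring.
  have -> : s - s' = ((2 * sg)%:C)%C.
    by apply: complex_ext; rewrite !ReImE /s /s' /=; ring.
  by rewrite kE -fmorphV -rmorphM /= invrN mulrN mulNr.
have I2 : cinteg setT (fun w => K (Complex x w)).
  split; first by apply: (eq_rinteg _ _ (rintegZ (- (2 * sg)) _ ik)) => // w _; rewrite KE.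
  apply: (eq_rinteg _ _ (rintegZ 0 _ ik)) => // w _.
  by rewrite KE mul0r.
have GE' w : vseg G x w = vseg F x w * k x w - F s * K (Complex x w) by [].
have I3 : cinteg setT (vseg G x).
  by apply: (@eq_cinteg _ _ (fun w => vseg F x w * k x w - F s * K (Complex x w)));
     [by []|by []|apply: cintegB => //; exact: cintegZ].
split => //.
have -> : cint setT (vseg G x) =
  cint setT (fun w => vseg F x w * k x w - F s * K (Complex x w)) by apply: eq_cint.
rewrite cintB // ?cintZ //; last exact: cintegZ.
congr (_ + _); rewrite -mulrN; congr (_ * _).
rewrite (@eq_cint _ _ _ (fun w => ((- (2 * sg) * nc (k x w) ^+ 2)%:C)%C)) // /cint /=.
rewrite RintegralZl // [\int[mu]_(_ in _) _ ^+ 2]sk.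
have -> : \int[mu]_(t in setT) (0 : R) = 0.
  by rewrite /Rintegral; under eq_integral do rewrite -[0%:E]/0%E; rewrite integral0.
apply: complex_ext; rewrite !ReImE /= ?oppr0 //.
by field; rewrite gt_eqF.
Qed.

Let left_zero : cint setT (vseg G x) = 0.
Proof.
have [_ IG _] := left_line.
apply/eqP; rewrite -nc_eq0 eq_le nc_ge0 andbT; apply/ler_addgt0Pr => e e0.
rewrite add0r; move: (x0) (sg0) (c0) => x1 g1 c1.
have M0 : 0 <= M.
  rewrite -lee_fin; apply: le_trans (hM x1); apply: integral_ge0 => w _.
  by rewrite lee_fin abs2E sqr_ge0.
(* The order of choices is [t], then [X], then the heights. The truncation costs e/4, the two terms
   of the right side e/4 each, and the two horizontal sides e/8 each. *)
set t := e / (8 * (M + 1)).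
have t0 : 0 < t by rewrite divr_gt0 // mulr_gt0 //; lra.
have tM : 2 * (t * M) <= e / 4.
  have -> : 2 * (t * M) = e / 4 * (M / (M + 1)).
    by rewrite /t; field; rewrite gt_eqF //; lra.
  by rewrite ler_piMr //; [lra|rewrite ler_pdivrMr; lra].
set D := (t^-1 + c) * pi.
have D0 : 0 <= D by rewrite mulr_ge0 ?pi_ge0 // addr_ge0 // invr_ge0 ltW.
(* The distance from [s] to the right side, so large that 2 D/a <= e/4. *)
set a := 1 + 8 * D / e.
have De : 0 <= 8 * D / e by apply: divr_ge0; [exact: mulr_ge0|exact: ltW].
have a0 : 0 < a by rewrite /a; lra.
set X := x + sg + a.
have hX : x + sg < X by rewrite /X; lra.
have DX : 2 * ((t^-1 + c) * (pi / (X - (x + sg)))) <= e / 4.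
  have -> : X - (x + sg) = a by rewrite /X; ring.
  rewrite !mulrA -(mulrA 2) -/D ler_pdivrMr //.
  by rewrite /a mulrDr mulr1 (_ : e / 4 * (8 * D / e) = 2 * D) ?lerDr; [lra|field; rewrite gt_eqF].
set Q := 2 * (((X - x) * M + 1) + (1 + c) * (X - x)).
have Q0 : 0 <= Q.
  rewrite mulr_ge0 // addr_ge0 // ?addr_ge0 // mulr_ge0 //; rewrite /X; lra.
have Qe : 0 <= 8 * Q / e by apply: divr_ge0; [exact: mulr_ge0|exact: ltW].
have xX : x <= X by rewrite /X; lra.
have pick (n : nat) : exists AB : R * R,
    [/\ AB.1 <= - n%:R, - n%:R - 1 <= AB.1, n%:R <= AB.2 & AB.2 <= n%:R + 1] /\
    (\int[mu]_(t in `[x, X]) (nc (F (Complex t AB.1)) ^+ 2) <= (X - x) * M + 1 /\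
     \int[mu]_(t in `[x, X]) (nc (F (Complex t AB.2)) ^+ 2) <= (X - x) * M + 1).
  have [Y1 /andP[y1 y2] hY1] := @good_height R F x X M (- n%:R - 1) x1 xX cF hM.
  have [Y2 /andP[y3 y4] hY2] := @good_height R F x X M n%:R x1 xX cF hM.
  by exists (Y1, Y2); split => //; split => //=; lra.
have [AB hAB] := choice pick.
have hA1 n : (AB n).1 <= - n%:R by have [[]] := hAB n.
have hB1 n : n%:R <= (AB n).2 by have [[]] := hAB n.
have e4 : 0 < e / 4 by lra.
have [N1 HN1] := ctruncation IG hA1 hB1 e4.
set N := maxn N1 (Num.bound (`|ta| + 1 + 8 * Q / e)).
have hN : `|ta| + 1 + 8 * Q / e < N%:R.
  apply: lt_le_trans (archi_boundP _) _; last by rewrite ler_nat leq_maxr.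
  by apply: addr_ge0 => //; apply: addr_ge0.
have := HN1 N (leq_maxl _ _).
have [[a1 a2 b1 b2] [hA hB]] := hAB N.
move: a1 a2 b1 b2 hA hB; set A := (AB N).1; set B := (AB N).2 => a1 a2 b1 b2 hA hB hI.
set eta := N%:R - `|ta|.
have [e1 qeta] := height_ge hN Qe; rewrite -/eta in e1 qeta.
have eA : eta <= `|A - ta| := height_below ta a1.
have eB : eta <= `|B - ta| := height_above ta b1.
have etaQ : 2 * (eta^-1 * (((X - x) * M + 1) + (1 + c) * (X - x))) <= e / 8.
  rewrite mulrCA -/Q mulrC ler_pdivrMr; last exact: lt_le_trans ltr01 e1.
  rewrite mulrC -ler_pdivrMr; last exact: divr_gt0.
  by rewrite (_ : Q / (e / 8) = 8 * Q / e) //; field; rewrite gt_eqF.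
have hHA := le_trans (horiz_bound hX e1 eA hA) etaQ.
have hHB := le_trans (horiz_bound hX e1 eB hB) etaQ.
have hR := right_bound A B hX t0.
have hta : A < ta < B := height_between a1 b1 e1.
have zsh (y : R) : y != ta -> cinteg `[x, X] (hseg G y).
  move=> yt; apply: hseg_integ => u /andP[u1 _]; apply/cdiff_cont/G_diff => //.
  by apply: contra yt => /eqP [_ ->].
have zsv (u : R) : x <= u -> u != x + sg -> cinteg `[A, B] (vseg G u).
  move=> xu yt; apply: vseg_integ => v _; apply/cdiff_cont/G_diff => //.
  by apply: contra yt => /eqP [-> _].
have := G_rect hX hta; rewrite /rect_int cintB; [|by []|apply: zsh|apply: zsh]; last 2 first.
- by rewrite lt_eqF //; case/andP: hta.
- by rewrite gt_eqF //; case/andP: hta.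
have nX : X != x + sg by rewrite gt_eqF.
have nx : x != x + sg by rewrite lt_eqF // ltrDl.
rewrite cintB; [|by []|exact: zsv|exact: zsv].
move=> E.
(* The vanishing boundary integral is solved for the left side by means of i^2 = -1. *)
have {}E : cint `[A, B] (vseg G x) = cint `[A, B] (vseg G X) -
    Complex 0 1 * (cint `[x, X] (hseg G A) - cint `[x, X] (hseg G B)).
  have I2 : Complex 0 1 * Complex 0 1 = -1 :> C.
    by apply: complex_ext; rewrite !ReImE /=; ring.
  set P := cint _ (hseg G A) - _ in E *.
  set W := cint _ (vseg G X) in E *; set V := cint _ (vseg G x) in E *.
  have -> : P = - (Complex 0 1 * (W - V)) by apply/eqP; rewrite -addr_eq0 E.
  by rewrite mulrN mulrA I2; ring.
have nI : nc (Complex 0 1 : C) = 1 by rewrite /= expr0n /= add0r expr1n sqrtr1.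
have hV : nc (cint `[A, B] (vseg G x)) <=
    2 * (t * M + (t^-1 + c) * (pi / (X - (x + sg)))) + e / 8 + e / 8.
  rewrite E; apply: le_trans (ncB _ _) _; rewrite -addrA; apply: lerD => //.
  by rewrite ncM nI mul1r; apply: le_trans (ncB _ _) _; exact: lerD.
move: hV; rewrite (mulrDr 2 (t * M)) => hV.
rewrite -(subrK (cint `[A, B] (vseg G x)) (cint setT (vseg G x))).
apply: le_trans (ncD _ _) _; apply: le_trans (lerD (ltW hI) hV) _.
exact: sum_quarters tM DX.
Qed.

(** The line is parametrised by w with dz = i dw, so the constant is 2 pi and not 2 pi i. The sign
    in s - z reflects that the left side is followed downwards on the contour. *)
Lemma cauchy_line : cinteg setT (fun w => F (Complex x w) / (s - Complex x w)) /\
  cint setT (fun w => F (Complex x w) / (s - Complex x w)) = ((2 * pi)%:C)%C * F s.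
Proof.
have [I1 _ E] := left_line.
have e w : -1 * (vseg F x w * k x w) = F (Complex x w) / (s - Complex x w).
  by rewrite /k /vseg -(opprB s) invrN mulrN mulN1r opprK.
split; first by apply: eq_cinteg (cintegZ (-1) _ I1) => // w _; exact: e.
rewrite -(@eq_cint _ _ (fun w => -1 * (vseg F x w * k x w))); last by move=> w _; exact: e.
rewrite cintZ //; move: E; rewrite left_zero => /esym/eqP; rewrite addr_eq0 => /eqP ->.
by rewrite mulN1r opprK mulrC.
Qed.

End CauchyLine.

(** * The space H2, its kernels, and limits at the imaginary axis *)

Section HardySpace.
Variable R : realType.
Local Notation C := R[i].
Local Notation mu := (@lebesgue_measure R).
Implicit Types (F G f k : C -> C) (p z : C) (x : R).

Definition H2b F (M : R) := (forall z, Cplus z -> cdiff F z) /\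
  forall t, 0 < t -> (\int[mu]_(w in setT) (abs2 (F (Complex t w)))%:E <= M%:E)%E.

Lemma in_H2P F : in_H2 F <-> exists M, H2b F M.
Proof.
split=> [[/holomorphic_onP h [M hM]]|[M [h hM]]]; first by exists M.
by split; [exact/holomorphic_onP|exists M].
Qed.

Lemma in_H2_cdiff F z : in_H2 F -> Cplus z -> cdiff F z.
Proof. by move=> /in_H2P[M [h _]] /h. Qed.

Lemma H2_lineP F : in_H2 F -> exists2 M : R, 0 <= M & forall x, 0 < x ->
  [/\ cmeas (vseg F x), sqint (vseg F x) & sqn (vseg F x) <= M].
Proof.
move=> /in_H2P[M [h hM]].
have H x : 0 < x -> [/\ cmeas (vseg F x), sqint (vseg F x) & sqn (vseg F x) <= M].
  by move=> x0; apply: H2_line => //; [move=> z /h/cdiff_cont|exact: hM].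
exists M => //; have [_ _] := H 1 ltr01; apply: le_trans; exact: sqn_ge0.
Qed.

Lemma in_H2I F (M : R) : (forall z, Cplus z -> cdiff F z) ->
  (forall x, 0 < x -> sqint (vseg F x) /\ sqn (vseg F x) <= M) -> in_H2 F.
Proof.
move=> dF h; apply/in_H2P; exists M; split=> // x /h[i le].
rewrite (_ : (\int[mu]_(w in setT) _)%E = (sqn (vseg F x))%:E) ?lee_fin //.
rewrite /sqn /Rintegral fineK; last exact: (integrable_fin_num _ i).
by apply: eq_integral => w _; rewrite abs2E.
Qed.

Lemma sqint_le (phi : R -> C) (g : R -> R) : cmeas phi -> rinteg setT g ->
  (forall w, nc (phi w) ^+ 2 <= g w) -> sqint phi /\ sqn phi <= \int[mu]_w g w.
Proof.
move=> m ig le.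
have I : sqint phi.
  apply: rinteg_le ig => //; first exact: cmeas_nc2.
  by move=> w _; rewrite ger0_norm ?sqr_ge0.
by split => //; apply: le_Rintegral => // w _.
Qed.

Lemma cdiff_line_cmeas F x : (forall z, Cplus z -> cdiff F z) -> 0 < x ->
  cmeas (vseg F x).
Proof.
by move=> dF x0; apply: rcont_cmeas => t; apply: ccont_vseg; apply/cdiff_cont/dF.
Qed.

Lemma in_H2_dom F G (c : R) : (forall z, Cplus z -> cdiff F z) -> in_H2 G ->
  (forall z, Cplus z -> nc (F z) <= c * nc (G z)) -> in_H2 F.
Proof.
move=> dF /H2_lineP[M M0 hG] le; apply: (@in_H2I F (c ^+ 2 * M)) => // x x0.
have [mG iG sG] := hG x x0.
have [] := @sqint_le (vseg F x) (fun w => c ^+ 2 * nc (vseg G x w) ^+ 2).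
- exact: cdiff_line_cmeas.
- exact: rintegZ.
- move=> w; rewrite -exprMn; apply: lerXn2r; rewrite ?nnegrE ?nc_ge0 //.
    by apply: le_trans (nc_ge0 _) (le _ _).
  exact: le.
move=> i s; split => //; apply: le_trans s _.
by rewrite RintegralZl // ler_wpM2l ?sqr_ge0.
Qed.

Lemma nc2D (z w : C) : nc (z + w) ^+ 2 <= 2 * nc z ^+ 2 + 2 * nc w ^+ 2.
Proof.
have := ncD z w; have := nc_ge0 (z + w); have := sqr_ge0 (nc z - nc w); nra.
Qed.

Lemma sqnD F G x : in_H2 F -> in_H2 G -> 0 < x ->
  sqint (vseg (fun z => F z + G z) x) /\
  sqn (vseg (fun z => F z + G z) x) <= 2 * sqn (vseg F x) + 2 * sqn (vseg G x).
Proof.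
move=> hF hG x0.
have [M _ /(_ x x0)[mF iF _]] := H2_lineP hF.
have [M' _ /(_ x x0)[mG iG _]] := H2_lineP hG.
have [] := @sqint_le (vseg (fun z => F z + G z) x)
  (fun w => 2 * nc (vseg F x w) ^+ 2 + 2 * nc (vseg G x w) ^+ 2).
- by apply: cdiff_line_cmeas => // z hz; apply: cdiffD; exact: in_H2_cdiff.
- by apply: rintegD => //; exact: rintegZ.
- by move=> w; exact: nc2D.
rewrite RintegralD; [|by []|exact: rintegZ|exact: rintegZ].
by rewrite !RintegralZl.
Qed.

Lemma in_H2D F G : in_H2 F -> in_H2 G -> in_H2 (fun z => F z + G z).
Proof.
move=> hF hG; have [M _ hM] := H2_lineP hF; have [M' _ hM'] := H2_lineP hG.
apply: (@in_H2I _ (2 * M + 2 * M')).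
  by move=> z hz; apply: cdiffD; exact: in_H2_cdiff.
move=> x x0; have [i le] := sqnD hF hG x0; split => //; apply: le_trans le _.
by have [_ _ ?] := hM x x0; have [_ _ ?] := hM' x x0; lra.
Qed.

Lemma in_H2Z F (c : C) : in_H2 F -> in_H2 (fun z => c * F z).
Proof.
move=> hF; apply: (in_H2_dom (c := nc c) _ hF) => [z hz|z _]; last by rewrite ncM.
by apply: cdiffM; [exact: cdiff_cst|exact: in_H2_cdiff].
Qed.

Lemma in_H2B F G : in_H2 F -> in_H2 G -> in_H2 (fsub F G).
Proof.
move=> hF hG; rewrite (_ : fsub F G = fun z => F z + -1 * G z).
  by apply: in_H2D => //; exact: in_H2Z.
by apply/funext => z; rewrite mulN1r.
Qed.

Lemma in_H2_0 : in_H2 (fun=> 0 : C).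
Proof.
have m : cmeas (fun=> 0 : C) by split; exact: measurable_cst.
have E : (fun t : R => nc (0 : C) ^+ 2) = cst 0 by rewrite nc0 expr0n.
apply: (@in_H2I _ 0) => [z _|x _]; first exact: cdiff_cst.
rewrite /sqint /sqn /vseg E; split; first exact: integrable0.
by rewrite /Rintegral integral0.
Qed.

Lemma in_H2_sum n (F : 'I_n -> C -> C) : (forall i, in_H2 (F i)) ->
  in_H2 (fun z => \sum_i F i z).
Proof.
elim: n F => [|n ih] F hF.
  by under eq_fun do rewrite big_ord0; exact: in_H2_0.
under eq_fun do rewrite big_ord_recr /=.
by apply: in_H2D => //; apply: ih => i; exact: hF.
Qed.

Lemma vker_neq0 p z : Cplus p -> Cplus z -> z + conjc p != 0.
Proof.
rewrite /Cplus => hp hz; rewrite -nc_gt0; apply: lt_le_trans (Re_le _).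
by rewrite cReD cReJ addr_gt0.
Qed.

Lemma nc_vker_le p z : Cplus p -> Cplus z -> nc (vker p z) <= (complex.Re p)^-1.
Proof.
rewrite /Cplus => hp hz; rewrite /vker ncV lef_pV2 ?posrE //.
  by apply: le_trans (Re_le _); rewrite cReD cReJ; lra.
by rewrite nc_gt0; exact: vker_neq0.
Qed.

Lemma vker_cdiff p z : Cplus p -> Cplus z -> cdiff (vker p) z.
Proof.
move=> hp hz; apply: cdiffV; first exact: vker_neq0.
by apply: cdiffD; [exact: cdiff_id|exact: cdiff_cst].
Qed.

Lemma sqn_vker p x : Cplus p -> 0 < x ->
  sqint (vseg (vker p) x) /\ sqn (vseg (vker p) x) <= pi / complex.Re p.
Proof.
rewrite /Cplus => hp x0; have a0 : 0 < x + complex.Re p by lra.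
have kE w : nc (vseg (vker p) x w) ^+ 2 =
    ((x + complex.Re p) ^+ 2 + (w - complex.Im p) ^+ 2)^-1.
  by rewrite /vseg /vker ncV exprVn nc_sqr !ReImE.
have [i e] := cauchy_kernel_integ (complex.Im p) a0; split.
  by apply: eq_rinteg i => // w _; rewrite kE.
rewrite /sqn (_ : \int[mu]_t _ = pi / (x + complex.Re p)); last first.
  by rewrite -e; apply: eq_Rintegral => w _; rewrite kE.
rewrite ler_wpM2l ?pi_ge0 // lef_pV2 ?posrE //; lra.
Qed.

Lemma in_H2_vker p : Cplus p -> in_H2 (vker p).
Proof.
move=> hp; apply: (@in_H2I _ (pi / complex.Re p)) => [z|x x0].
  exact: vker_cdiff.
exact: sqn_vker.
Qed.

Lemma dvkerE p z : dvker p z = - (vker p z * vker p z).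
Proof. by rewrite /dvker /vker -exprVn expr2. Qed.

Lemma nc_dvker_le p z : Cplus p -> Cplus z ->
  nc (dvker p z) <= (complex.Re p)^-1 * nc (vker p z).
Proof.
by move=> hp hz; rewrite dvkerE ncN ncM ler_wpM2r ?nc_ge0 // nc_vker_le.
Qed.

Lemma in_H2_dvker p : Cplus p -> in_H2 (dvker p).
Proof.
move=> hp; apply: (in_H2_dom _ (in_H2_vker hp) (fun z => @nc_dvker_le p z hp)).
move=> z hz; rewrite (_ : dvker p = fun z => - (vker p z * vker p z)).
  by apply: cdiffN; apply: cdiffM; exact: vker_cdiff.
by apply/funext => w; rewrite dvkerE.
Qed.

(** Genuine convergence as x -> 0+, which a value of [ip] alone does not express; [lconv_ip] passes
    from the former to the latter. *)
Definition lconv (phi : R -> C) (l : C) := forall e : R, 0 < e ->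
  exists2 del : R, 0 < del & forall x, 0 < x < del -> nc (phi x - l) < e.

Lemma cvg_at_right0 (phi : R -> R) (l : R) :
  (forall e, 0 < e -> exists2 del, 0 < del &
     forall x, 0 < x < del -> `|phi x - l| < e) -> phi @ 0^'+ --> l.
Proof.
move=> h; apply/cvgrPdist_lt => e /h[del del0 H]; near=> x.
rewrite distrC; apply: H; apply/andP; split; near: x; first exact: nbhs_right_gt.
exact: nbhs_right_lt.
Unshelve. all: by end_near. Qed.

Lemma lconv_ip f F l : lconv (ip_line f F) l -> ip f F = l.
Proof.
move=> h; rewrite /ip; case: l h => a b h; congr Complex; apply: cvg_lim => //;
  apply: cvg_at_right0 => e /h[del del0 H]; exists del => // x /H; apply: le_lt_trans.
  by have := Re_nc (ip_line f F x - Complex a b); rewrite !ReImE.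
by have := Im_nc (ip_line f F x - Complex a b); rewrite !ReImE.
Qed.

Lemma lconvD (phi psi : R -> C) l m : lconv phi l -> lconv psi m ->
  lconv (fun x => phi x + psi x) (l + m).
Proof.
move=> h1 h2 e e0; have e2 : 0 < e / 2 by lra.
have [a a0 ha] := h1 _ e2; have [b b0 hb] := h2 _ e2.
exists (Num.min a b); first by rewrite lt_min a0.
move=> x; rewrite lt_min => /and3P[x0 xa xb].
rewrite opprD addrACA; apply: le_lt_trans (ncD _ _) _.
by have := ha x; have := hb x; rewrite x0 xa xb => /(_ isT) ? /(_ isT) ?; lra.
Qed.

Lemma lconvZ (phi : R -> C) l (c : C) : lconv phi l ->
  lconv (fun x => c * phi x) (c * l).
Proof.
move=> h e e0; have K0 : 0 < nc c + 1 by rewrite ltr_wpDl ?nc_ge0.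
have [a a0 ha] := h _ (divr_gt0 e0 K0); exists a => // x /ha.
rewrite -mulrBr ncM ltr_pdivlMr // => h2; apply: le_lt_trans h2.
by have := nc_ge0 (phi x - l); nra.
Qed.

Lemma lconv_eq (phi psi : R -> C) l : (forall x, 0 < x -> phi x = psi x) ->
  lconv phi l -> lconv psi l.
Proof.
move=> e h u /h[del del0 H]; exists del => // x hx; rewrite -e; first exact: H.
by case/andP: hx.
Qed.

Lemma lconv_le (phi : R -> C) l (B del : R) : 0 < del -> lconv phi l ->
  (forall x, 0 < x < del -> nc (phi x) <= B) -> nc l <= B.
Proof.
move=> del0 h le; apply/ler_addgt0Pr => e /h[a a0 ha].
set x := Num.min a del / 2.
have m0 : 0 < Num.min a del by rewrite lt_min a0.
have x0 : 0 < x by rewrite divr_gt0.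
have : x < Num.min a del by rewrite /x; lra.
rewrite lt_min => /andP[xa xd].
have := ha x; rewrite x0 xa => /(_ isT) h1.
have := le x; rewrite x0 xd => /(_ isT) h2.
by have := nc_dist l (phi x); rewrite ncBC; lra.
Qed.

End HardySpace.

(** * The reproducing property for v[p] and v[p]' *)

Section ReproducingKernels.
Variable R : realType.
Local Notation C := R[i].
Local Notation mu := (@lebesgue_measure R).
Implicit Types (F G f g k : C -> C) (p z c : C) (x : R).

Lemma ip_lineE f F x : ip_line f F x =
  (((2 * pi)^-1)%:C)%C * cint setT (fun w => conjc (f (Complex x w)) * F (Complex x w)).
Proof. by apply: complex_ext; rewrite !ReImE /= mul0r ?subr0 ?addr0. Qed.

Lemma conj_line f x : in_H2 f -> 0 < x ->
  [/\ cmeas (fun w => conjc (f (Complex x w))),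
      sqint (fun w => conjc (f (Complex x w))) &
      sqn (fun w => conjc (f (Complex x w))) = sqn (vseg f x)].
Proof.
move=> /H2_lineP[M _ h] /h[[m1 m2] i _]; split.
- split; first by under eq_fun do rewrite cReJ.
  by under eq_fun do rewrite cImJ; exact: measurableT_comp.
- by apply: eq_rinteg i => // w _; rewrite nc_conj.
- by apply: eq_Rintegral => w _; rewrite nc_conj.
Qed.

Lemma ip_line_integ f F x : in_H2 f -> in_H2 F -> 0 < x ->
  cinteg setT (fun w => conjc (f (Complex x w)) * F (Complex x w)).
Proof.
move=> hf hF x0; have [m i _] := conj_line hf x0.
have [M _ /(_ x x0)[m' i' _]] := H2_lineP hF.
by have [] := cint_pair m m' i i'.
Qed.

Lemma twopi_ge1 : 1 <= 2 * pi :> R.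
Proof. by have := @pi_ge2 R; lra. Qed.

Lemma ip_line_le f F x (t : R) : in_H2 f -> in_H2 F -> 0 < x -> 0 < t ->
  nc (ip_line f F x) <= t * sqn (vseg f x) + t^-1 * sqn (vseg F x).
Proof.
move=> hf hF x0 t0; have [m i s] := conj_line hf x0.
have [M _ /(_ x x0)[m' i' _]] := H2_lineP hF.
have [_ /(_ t t0)] := cint_pair m m' i i'; rewrite s => h.
rewrite ip_lineE ncM nc_real; apply: le_trans h; rewrite ler_piMl ?nc_ge0 //.
by rewrite ger0_norm ?invr_ge0 ?invf_le1; have := twopi_ge1; lra.
Qed.

Lemma ip_lineDr f F G x : in_H2 f -> in_H2 F -> in_H2 G -> 0 < x ->
  ip_line f (fun z => F z + G z) x = ip_line f F x + ip_line f G x.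
Proof.
move=> hf hF hG x0; rewrite !ip_lineE -mulrDr -cintD //; try exact: ip_line_integ.
by congr (_ * _); apply: eq_cint => w _; rewrite mulrDr.
Qed.

Lemma ip_lineZr f F c x : in_H2 f -> in_H2 F -> 0 < x ->
  ip_line f (fun z => c * F z) x = c * ip_line f F x.
Proof.
move=> hf hF x0; rewrite !ip_lineE [RHS]mulrCA -(cintZ c) //; last exact: ip_line_integ.
by congr (_ * _); apply: eq_cint => w _; rewrite mulrCA.
Qed.

Lemma ip_lineDl f g F x : in_H2 f -> in_H2 g -> in_H2 F -> 0 < x ->
  ip_line (fun z => f z + g z) F x = ip_line f F x + ip_line g F x.
Proof.
move=> hf hg hF x0; rewrite !ip_lineE -mulrDr -cintD //; try exact: ip_line_integ.
by congr (_ * _); apply: eq_cint => w _; rewrite rmorphD mulrDl.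
Qed.

Lemma ip_lineZl f F c x : in_H2 f -> in_H2 F -> 0 < x ->
  ip_line (fun z => c * f z) F x = conjc c * ip_line f F x.
Proof.
move=> hf hF x0; rewrite !ip_lineE [RHS]mulrCA -(cintZ (conjc c)) //; last exact: ip_line_integ.
by congr (_ * _); apply: eq_cint => w _; rewrite rmorphM mulrA.
Qed.

Lemma eq_ip_line f g F G x : 0 < x -> (forall z, Cplus z -> f z = g z) ->
  (forall z, Cplus z -> F z = G z) -> ip_line f F x = ip_line g G x.
Proof.
move=> x0 fg FG; rewrite !ip_lineE; congr (_ * _); apply: eq_cint => w _.
by rewrite fg ?FG.
Qed.

Lemma ip_line_self f x : ip_line f f x = (((2 * pi)^-1 * sqn (vseg f x))%:C)%C.
Proof.
rewrite ip_lineE rmorphM; congr (_ * _); apply: complex_ext => /=.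
  by apply: eq_Rintegral => w _; rewrite nc_sqr !ReImE; ring.
rewrite /Rintegral (eq_integral (cst 0%E)) ?integral0 // => w _.
by rewrite !ReImE (_ : _ + _ = 0) //; ring.
Qed.

(** On Re z = x the conjugate of z is 2x - z, so the conjugated kernel is 1/(p + 2x - z): Cauchy's
    formula evaluates [F] at the shifted point p + 2x. *)
Lemma ip_line_vker F p x : in_H2 F -> Cplus p -> 0 < x ->
  ip_line (vker p) F x = F (p + ((2 * x)%:C)%C).
Proof.
move=> /in_H2P[M [dF hM]] hp x0.
have sg0 : 0 < complex.Re p + x by rewrite addr_gt0.
have [_] := cauchy_line dF hM (complex.Im p) x0 sg0.
have -> : Complex (x + (complex.Re p + x)) (complex.Im p) = p + ((2 * x)%:C)%C.
  by apply: complex_ext; rewrite !ReImE /=; ring.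
move=> E; rewrite ip_lineE.
rewrite -[F _]mul1r (_ : 1 = (((2 * pi)^-1)%:C)%C * ((2 * pi)%:C)%C); last first.
  by rewrite -rmorphM mulVf // gt_eqF //; have := twopi_ge1; lra.
rewrite -mulrA -E; congr (_ * _); apply: eq_cint => w _; rewrite mulrC; congr (_ * _).
rewrite /vker conjc_inv; congr (_^-1).
by apply: complex_ext; rewrite !ReImE /=; ring.
Qed.

Lemma lconv_vker F p : in_H2 F -> Cplus p -> lconv (ip_line (vker p) F) (F p).
Proof.
move=> hF hp e e0; have [del del0 H] := cdiff_cont (in_H2_cdiff hF hp) e0.
exists (del / 2); first lra.
move=> x /andP[x0 xd]; rewrite ip_line_vker //; apply: H; rewrite nc_real.
by rewrite gtr0_norm; lra.
Qed.

Lemma sqn_dom k p (c x : R) : in_H2 k -> Cplus p -> 0 < x ->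
  (forall z, Cplus z -> nc (k z) <= c * nc (vker p z)) ->
  sqn (vseg k x) <= c ^+ 2 * (pi / complex.Re p).
Proof.
move=> hk hp x0 le; have [iv sv] := sqn_vker hp x0.
have [M _ /(_ x x0)[mk _ _]] := H2_lineP hk.
have [|w|_] := @sqint_le R (vseg k x) (fun w => c ^+ 2 * nc (vseg (vker p) x w) ^+ 2) mk.
- exact: rintegZ.
- rewrite -exprMn; apply: lerXn2r; rewrite ?nnegrE ?nc_ge0 //.
    by apply: le_trans (nc_ge0 _) (le _ _).
  exact: le.
by move=> /le_trans; apply; rewrite RintegralZl // ler_wpM2l // sqr_ge0.
Qed.

(** The resolvent identity, from which the estimates on displaced kernels follow. *)
Lemma vkerB p q z : Cplus p -> Cplus q -> Cplus z ->
  vker q z - vker p z = - conjc (q - p) * (vker q z * vker p z).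
Proof.
move=> hp hq hz; have := vker_neq0 hp hz; have := vker_neq0 hq hz => h1 h2.
by rewrite /vker rmorphB /=; field; rewrite h1 h2.
Qed.

(** v[p]' is approximated by the difference quotient [Q] of kernels at p and p + h with h real. The
    remainder [r] is at most c h |v[p]|, so its pairing with [F] is small uniformly in x, and the
    pairing with [Q] converges to the difference quotient of [F]. *)
Lemma lconv_dvker F p d : in_H2 F -> Cplus p -> has_cder F p d ->
  lconv (ip_line (dvker p) F) d.
Proof.
move=> hF hp hd e e0; have [M M0 hM] := H2_lineP hF.
set P := complex.Re p; have P0 : 0 < P by [].
set c := 2 / P / P.
set K := c ^+ 2 * (pi / P) + M.
have K0 : 0 <= K by rewrite addr_ge0 // mulr_ge0 ?sqr_ge0 // divr_ge0 ?pi_ge0 // ltW.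
have e4 : 0 < e / 4 by lra.
have [del del0 H] := hd _ e4.
(* The step is within reach of the derivative estimate at p, and the pairing with the remainder, at
   most h K, stays below e/4. *)
set h : R := Num.min (del / 2) (Num.min (P / 2) (e / 4 / (K + 1))).
have h0 : 0 < h by rewrite /h !lt_min !divr_gt0 //; lra.
have h1 : h <= del / 2 by rewrite /h ge_min lexx.
have h2 : h <= P / 2 by rewrite /h !ge_min lexx orbT.
have h3 : h * (K + 1) <= e / 4.
  by rewrite -ler_pdivlMr; [rewrite /h !ge_min lexx !orbT|lra].
set q := p + (h%:C)%C.
have hq : Cplus q by rewrite /Cplus /q cReD /= -/P; lra.
have hne : (h%:C)%C != 0 :> C by rewrite -nc_gt0 nc_real gtr0_norm.
have vq := in_H2_vker hq; have vp := in_H2_vker hp.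
pose Q z := (h^-1%:C)%C * (vker q z + -1 * vker p z).
have HQ : in_H2 Q by apply: in_H2Z; apply: in_H2D => //; exact: in_H2Z.
pose r z := dvker p z + -1 * Q z.
have Hr : in_H2 r by apply: in_H2D; [exact: in_H2_dvker|exact: in_H2Z].
have rE z : Cplus z -> nc (r z) <= (c * h) * nc (vker p z).
  move=> hz; have -> : r z = - (h%:C)%C * (vker p z * vker q z * vker p z).
    rewrite /r /Q !mulN1r vkerB // dvkerE.
    have -> : conjc (q - p) = (h%:C)%C.
      by apply: complex_ext; rewrite /q !ReImE /=; ring.
    have V : ((h^-1)%:C)%C * (h%:C)%C = 1 :> C by rewrite -rmorphM mulVf ?gt_eqF.
    have W : vker q z = vker p z - (h%:C)%C * (vker q z * vker p z).
      have := vkerB hp hq hz.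
      have -> : conjc (q - p) = (h%:C)%C.
        by apply: complex_ext; rewrite /q !ReImE /=; ring.
      by move=> E; rewrite -{1}(subrK (vker p z) (vker q z)) E; ring.
    have -> : ((h^-1)%:C)%C * (- (h%:C)%C * (vker q z * vker p z)) =
      - ((((h^-1)%:C)%C * (h%:C)%C) * (vker q z * vker p z)) by ring.
    by rewrite V mul1r {1}W; ring.
  rewrite ncM ncN nc_real gtr0_norm // !ncM.
  rewrite [leLHS](_ : _ = (nc (vker p z) * nc (vker q z)) * h * nc (vker p z)); last by ring.
  apply: ler_wpM2r; first exact: nc_ge0.
  apply: ler_wpM2r; first exact: ltW.
  rewrite (_ : c = P^-1 * (2 / P)); last by rewrite /c mulrC.
  apply: ler_pM; rewrite ?nc_ge0 //.
    exact: nc_vker_le.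
  apply: le_trans (nc_vker_le hq hz) _.
  rewrite -[2 / P]invf_div lef_pV2 ?posrE ?divr_gt0 //.
  by rewrite /q cReD /= -/P; lra.
have LQ : lconv (ip_line Q F) ((h^-1%:C)%C * (F q + -1 * F p)).
  apply: (@lconv_eq _ (fun x => (h^-1%:C)%C * (ip_line (vker q) F x + -1 * ip_line (vker p) F x))).
    move=> x x0; rewrite /Q ip_lineZl ?conjc_real //; last first.
      by apply: in_H2D => //; exact: in_H2Z.
    rewrite ip_lineDl // ?ip_lineZl ?rmorphN1 //; last exact: in_H2Z.
  by apply: lconvZ; apply: lconvD; [|apply: lconvZ]; exact: lconv_vker.
have [a a0 ha] := LQ _ e4.
exists a => // x hx; have x0 : 0 < x by case/andP: hx.
have -> : ip_line (dvker p) F x = ip_line Q F x + ip_line r F x.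
  rewrite -ip_lineDl //; apply: eq_ip_line => // z _; rewrite /r; ring.
have b1 := ha x hx.
have b2 : nc (ip_line r F x) <= h * K.
  (* The weight 1/h balances the two terms: [r] has squared norm of order h^2, so both become of
     order h. *)
  apply: le_trans (ip_line_le Hr hF x0 (t := h^-1) _) _; first by rewrite invr_gt0.
  rewrite invrK /K mulrDr; apply: lerD; last by have [_ _ s] := hM x x0; rewrite ler_wpM2l // ltW.
  have := sqn_dom Hr hp x0 rE; rewrite -/P => s.
  apply: le_trans (ler_wpM2l _ s) _; first by rewrite invr_ge0 ltW.
  by rewrite le_eqVlt; apply/orP; left; apply/eqP; field; rewrite !gt_eqF.
have b3 : nc ((h^-1%:C)%C * (F q + -1 * F p) - d) <= e / 4.
  have hn : nc (h%:C)%C = h :> R by rewrite nc_real gtr0_norm.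
  have := H (h%:C)%C; rewrite hn => /(_ ltac:(lra)) h4.
  have V : ((h^-1)%:C)%C * (h%:C)%C = 1 :> C by rewrite -rmorphM mulVf ?gt_eqF.
  have -> : (h^-1%:C)%C * (F q + -1 * F p) - d =
     (h^-1%:C)%C * (F q - F p - d * (h%:C)%C).
    by rewrite mulrBr (mulrCA _ d) V; ring.
  by rewrite ncM nc_real ger0_norm ?invr_ge0 ?(ltW h0) // mulrC ler_pdivrMr.
set u := (h^-1%:C)%C * (F q + -1 * F p) in b1 b3 *.
have -> : ip_line Q F x + ip_line r F x - d = (ip_line Q F x - u) + ip_line r F x + (u - d).
  by ring.
apply: le_lt_trans (ncD _ _) _.
apply: le_lt_trans (lerD (ncD _ _) (lexx _)) _.
by move: h3; rewrite mulrDr mulr1; lra.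
Qed.

(** A bound b for the upper limit at the imaginary axis of the squared norms on vertical lines,
    without the factor 1/(2 pi). It makes sense even if these norms have no known limit. *)
Definition nbd F (b : R) := forall e, 0 < e -> exists2 del, 0 < del &
  forall x, 0 < x < del -> sqn (vseg F x) <= b + e.

Lemma sqr_le_of_amgm (A a b : R) : 0 <= A -> 0 <= a -> 0 <= b ->
  (forall t, 0 < t -> A <= t * a + t^-1 * b) -> A ^+ 2 <= 4 * a * b.
Proof.
move=> A0 a0 b0 h; have [->|Ane] := eqVneq A 0.
  by rewrite expr0n /= mulr_ge0 // mulr_ge0.
have Ap : 0 < A by rewrite lt_neqAle eq_sym Ane.
apply/ler_addgt0Pr => e e0.
(* The weight A/(2a) would give A <= A/2 + 2ab/A at once; [u] replaces a, which may be 0, at a cost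
   of at most e. *)
set u := a + e / (4 * (b + 1)).
have ea : 0 < e / (4 * (b + 1)) by rewrite divr_gt0 //; lra.
have u0 : 0 < u by rewrite /u; lra.
have t0 : 0 < A / (2 * u) by rewrite divr_gt0 //; lra.
have := h _ t0.
have h1 : A / (2 * u) * a <= A / 2.
  have -> : A / (2 * u) * a = A / 2 * (a / u) by field; rewrite gt_eqF.
  by rewrite ler_piMr //; [lra|rewrite ler_pdivrMr // mul1r /u; lra].
have -> : (A / (2 * u))^-1 * b = 2 * u * b / A by field; rewrite Ane gt_eqF.
move=> h2; have : A / 2 <= 2 * u * b / A by lra.
rewrite ler_pdivlMr // => h3.
have h4 : 4 * (e / (4 * (b + 1))) * b <= e.
  have -> : 4 * (e / (4 * (b + 1))) * b = e * (b / (b + 1)) by field; rewrite gt_eqF //; lra.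
  by rewrite ler_piMr //; [lra|rewrite ler_pdivrMr; lra].
by move: h3; rewrite /u; lra.
Qed.

(** A Cauchy-Schwarz inequality for a function known only through [nbd]: AM-GM holds on every line
    near the axis, and the weight is optimised after passing to the limit. *)
Lemma nbd_pair_le k F p (c b : R) l : Cplus p -> in_H2 k -> in_H2 F -> 0 <= b ->
  (forall z, Cplus z -> nc (k z) <= c * nc (vker p z)) -> nbd F b ->
  lconv (ip_line k F) l -> nc l ^+ 2 <= 4 * (c ^+ 2 * (pi / complex.Re p)) * b.
Proof.
move=> hp hk hF b0 le hb hl.
apply: sqr_le_of_amgm => //; first exact: nc_ge0.
  by rewrite mulr_ge0 ?sqr_ge0 // divr_ge0 ?pi_ge0 // ltW.
move=> t t0; apply/ler_addgt0Pr => e e0.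
have [del del0 hdel] := hb (t * e) (mulr_gt0 t0 e0).
apply: (lconv_le del0 hl) => x hx; have x0 : 0 < x by case/andP: hx.
apply: le_trans (ip_line_le hk hF x0 t0) _; rewrite -addrA; apply: lerD.
  by rewrite ler_wpM2l ?(ltW t0) //; exact: sqn_dom.
have := ler_wpM2l (ltW (_ : 0 < t^-1)) (hdel x hx); rewrite mulrDr mulrA mulVf ?gt_eqF // mul1r.
by apply; rewrite invr_gt0.
Qed.

End ReproducingKernels.

(** * Kernel functions, Gram systems and orthogonal projections *)

Section KernelSpace.
Variable R : realType.
Local Notation C := R[i].
Implicit Types (F G f g k : C -> C) (p z c : C) (x : R).

(** The admissible first arguments of [ip]: with these the limit exists for every second argument in
    H2, which is what makes [ip] linear in both places. *)
Definition h2kernel k := in_H2 k /\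
  forall F, in_H2 F -> exists l, lconv (ip_line k F) l.

Lemma kernel_vker p : Cplus p -> h2kernel (vker p).
Proof.
move=> hp; split; first exact: in_H2_vker.
by move=> F hF; exists (F p); exact: lconv_vker.
Qed.

Lemma kernel_dvker p : Cplus p -> h2kernel (dvker p).
Proof.
move=> hp; split; first exact: in_H2_dvker.
by move=> F hF; have [d hd] := in_H2_cdiff hF hp; exists d; exact: lconv_dvker.
Qed.

Lemma kernelD k f : h2kernel k -> h2kernel f -> h2kernel (fun z => k z + f z).
Proof.
move=> [hk lk] [hf lf]; split; first exact: in_H2D.
move=> F hF; have [l hl] := lk F hF; have [m hm] := lf F hF; exists (l + m).
by apply: lconv_eq (lconvD hl hm) => x x0; rewrite ip_lineDl.
Qed.

Lemma kernelZ k c : h2kernel k -> h2kernel (fun z => c * k z).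
Proof.
move=> [hk lk]; split; first exact: in_H2Z.
move=> F hF; have [l hl] := lk F hF; exists (conjc c * l).
by apply: lconv_eq (lconvZ (conjc c) hl) => x x0; rewrite ip_lineZl.
Qed.

Lemma kernel0 : h2kernel (fun=> 0 : C).
Proof.
rewrite (_ : (fun=> 0) = fun z => 0 * vker 1 z).
  by apply/kernelZ/kernel_vker; rewrite /Cplus /= ltr01.
by apply/funext => z; rewrite mul0r.
Qed.

Lemma kernel_sum n (k : 'I_n -> C -> C) : (forall i, h2kernel (k i)) ->
  h2kernel (fun z => \sum_i k i z).
Proof.
elim: n k => [|n ih] k hk.
  by under eq_fun do rewrite big_ord0; exact: kernel0.
under eq_fun do rewrite big_ord_recr /=.
by apply: kernelD => //; apply: ih => i; exact: hk.
Qed.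

Lemma kernel_H2 k : h2kernel k -> in_H2 k. Proof. by case. Qed.

Lemma lconv_kernel k F : h2kernel k -> in_H2 F -> lconv (ip_line k F) (ip k F).
Proof. by move=> [hk lk] /lk[l hl]; rewrite (lconv_ip hl). Qed.

Lemma ip_vker F p : in_H2 F -> Cplus p -> ip (vker p) F = F p.
Proof. by move=> hF hp; apply: lconv_ip; exact: lconv_vker. Qed.

Lemma ipDr k F G : h2kernel k -> in_H2 F -> in_H2 G ->
  ip k (fun z => F z + G z) = ip k F + ip k G.
Proof.
move=> hk hF hG; apply: lconv_ip.
apply: lconv_eq (lconvD (lconv_kernel hk hF) (lconv_kernel hk hG)) => x x0.
by rewrite ip_lineDr //; exact: kernel_H2.
Qed.

Lemma ipZr k F c : h2kernel k -> in_H2 F -> ip k (fun z => c * F z) = c * ip k F.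
Proof.
move=> hk hF; apply: lconv_ip.
apply: lconv_eq (lconvZ c (lconv_kernel hk hF)) => x x0.
by rewrite ip_lineZr //; exact: kernel_H2.
Qed.

Lemma ipDl k f F : h2kernel k -> h2kernel f -> in_H2 F ->
  ip (fun z => k z + f z) F = ip k F + ip f F.
Proof.
move=> hk hf hF; apply: lconv_ip.
apply: lconv_eq (lconvD (lconv_kernel hk hF) (lconv_kernel hf hF)) => x x0.
by rewrite ip_lineDl //; exact: kernel_H2.
Qed.

Lemma ipZl k F c : h2kernel k -> in_H2 F -> ip (fun z => c * k z) F = conjc c * ip k F.
Proof.
move=> hk hF; apply: lconv_ip.
apply: lconv_eq (lconvZ (conjc c) (lconv_kernel hk hF)) => x x0.
by rewrite ip_lineZl //; exact: kernel_H2.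
Qed.

Lemma ipBr k F G : h2kernel k -> in_H2 F -> in_H2 G ->
  ip k (fsub F G) = ip k F - ip k G.
Proof.
move=> hk hF hG; rewrite (_ : fsub F G = fun z => F z + -1 * G z).
  by rewrite ipDr // ?ipZr ?mulN1r //; exact: in_H2Z.
by apply/funext => z; rewrite mulN1r.
Qed.

Lemma ip_eq_Cplus k F G : h2kernel k -> in_H2 F ->
  (forall z, Cplus z -> F z = G z) -> ip k F = ip k G.
Proof.
move=> hk hF FG; apply/esym/lconv_ip.
by apply: lconv_eq (lconv_kernel hk hF) => x x0; exact: eq_ip_line.
Qed.

Lemma ip0l F : in_H2 F -> ip (fun=> 0) F = 0.
Proof.
move=> hF; rewrite (_ : (fun=> 0) = fun z => 0 * vker 1 z).
  by rewrite ipZl // ?rmorph0 ?mul0r //; apply: kernel_vker; rewrite /Cplus /= ltr01.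
by apply/funext => z; rewrite mul0r.
Qed.

Lemma ip0r k : h2kernel k -> ip k (fun=> 0) = 0.
Proof.
move=> hk; rewrite (_ : (fun=> 0) = fun z => 0 * k z).
  by rewrite ipZr ?mul0r //; exact: kernel_H2.
by apply/funext => z; rewrite mul0r.
Qed.

Lemma ip_suml n (k : 'I_n -> C -> C) (c : 'I_n -> C) F :
  (forall i, h2kernel (k i)) -> in_H2 F ->
  ip (fun z => \sum_i c i * k i z) F = \sum_i conjc (c i) * ip (k i) F.
Proof.
move=> hk hF; elim: n k c hk => [|n ih] k c hk.
  by under eq_fun do rewrite big_ord0; rewrite big_ord0 ip0l.
under eq_fun do rewrite big_ord_recr /=.
rewrite big_ord_recr /= ipDl //; [|by apply: kernel_sum => i; exact: kernelZ|exact: kernelZ].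
by rewrite ih // ipZl.
Qed.

Lemma ip_sumr n k (F : 'I_n -> C -> C) (c : 'I_n -> C) :
  h2kernel k -> (forall i, in_H2 (F i)) ->
  ip k (fun z => \sum_i c i * F i z) = \sum_i c i * ip k (F i).
Proof.
move=> hk; elim: n F c => [|n ih] F c hF.
  by under eq_fun do rewrite big_ord0; rewrite big_ord0 ip0r.
under eq_fun do rewrite big_ord_recr /=.
rewrite big_ord_recr /= ipDr //; [|by apply: in_H2_sum => i; exact: in_H2Z|exact: in_H2Z].
by rewrite ih // ipZr.
Qed.

Lemma nbd_ext F (b b' : R) : b <= b' -> nbd F b -> nbd F b'.
Proof.
move=> bb h e /h[del del0 H]; exists del => // x /H; move=> /le_trans; apply.
by rewrite lerD2r.
Qed.

(** The factor 2 pi undoes the normalisation of [ip]. *)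
Lemma lconv_self_nbd f l : lconv (ip_line f f) l -> nbd f (2 * pi * complex.Re l).
Proof.
move=> h e e0; have p0 : 0 < 2 * pi :> R by have := @twopi_ge1 R; lra.
have [del del0 H] := h _ (divr_gt0 e0 p0); exists del => // x /H; rewrite ip_line_self => hx.
have := le_lt_trans (Re_le _) hx; rewrite !ReImE /= ltr_pdivlMr //.
rewrite mulrBl mulrAC mulVf ?gt_eqF // mul1r; lra.
Qed.

Lemma ip_self_ge0 f : h2kernel f -> 0 <= complex.Re (ip f f).
Proof.
move=> hf; apply/ler_addgt0Pr => e e0.
have [del del0 H] := lconv_kernel hf (kernel_H2 hf) e0.
have hx : 0 < del / 2 < del by apply/andP; split; lra.
have := le_lt_trans (Re_nc _) (H _ hx); rewrite ip_line_self !ReImE /= ltr_norml.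
have : 0 <= (2 * pi)^-1 * sqn (vseg f (del / 2)).
  by rewrite mulr_ge0 ?sqn_ge0 // invr_ge0; have := @twopi_ge1 R; lra.
lra.
Qed.

Lemma kernel_nbd f : h2kernel f -> nbd f (2 * pi * complex.Re (ip f f)).
Proof. by move=> hf; apply: lconv_self_nbd; apply: lconv_kernel => //; exact: kernel_H2. Qed.

(** Zero norm means [nbd] with bound 0, and the reproducing property bounds each value by it. Values
    off the half-plane remain unconstrained. *)
Lemma kernel_null f : h2kernel f -> complex.Re (ip f f) = 0 ->
  forall z, Cplus z -> f z = 0.
Proof.
move=> hf h0 z hz; have := kernel_nbd hf; rewrite h0 mulr0 => nb.
have := @nbd_pair_le R (vker z) f z 1 0 (f z) hz (in_H2_vker hz) (kernel_H2 hf) (lexx 0) _ nb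
  (lconv_vker (kernel_H2 hf) hz).
rewrite mulr0 => h; apply/eqP; rewrite -nc_eq0 -sqrf_eq0 eq_le sqr_ge0 andbT.
by apply: h => w _; rewrite mul1r.
Qed.

(** Let N be the squared norm of [g]. AM-GM with weight 1/(4 pi) bounds its pairing with [F] by N/2
    + 4 pi b; as this pairing is N itself, N <= 8 pi b, and 2 pi N is the bound for the line
    integrals. *)
Lemma proj_nbd g F (b : R) : h2kernel g -> in_H2 F -> nbd F b ->
  ip g g = ip g F -> nbd g (16 * pi ^+ 2 * b).
Proof.
move=> hg hF hb E; apply: nbd_ext (kernel_nbd hg).
set N := complex.Re (ip g g).
have p0 : 0 < pi :> R := pi_gt0 R.
suff : nc (ip g F) <= N / 2 + 4 * pi * b.
  rewrite -E => h; have := le_trans (Re_le _) h; rewrite -/N => h1.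
  have {}h1 : N <= 8 * pi * b by lra.
  have p2 : 0 <= 2 * pi :> R by lra.
  apply: le_trans (ler_wpM2l p2 h1) _.
  by rewrite le_eqVlt; apply/orP; left; apply/eqP; ring.
apply/ler_addgt0Pr => e e0.
set t : R := (4 * pi)^-1.
have t0 : 0 < t by rewrite invr_gt0; lra.
have tV : t^-1 = 4 * pi by rewrite invrK.
set kp := t + t^-1.
have tV1 : 0 < t^-1 by rewrite invr_gt0.
have kp0 : 0 < kp := addr_gt0 t0 tV1.
have kpne : kp != 0 := lt0r_neq0 kp0.
have e'0 : 0 < e / kp by exact: divr_gt0.
have [d1 d10 H1] := kernel_nbd hg e'0; have [d2 d20 H2] := hb _ e'0.
have m0 : 0 < Num.min d1 d2 by rewrite lt_min d10.
apply: (lconv_le m0 (lconv_kernel hg hF)) => x; rewrite lt_min => /and3P[x0 x1 x2].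
have := H1 x; rewrite x0 x1 => /(_ isT); rewrite -/N => h1.
have := H2 x; rewrite x0 x2 => /(_ isT) h2.
apply: le_trans (ip_line_le (kernel_H2 hg) hF x0 t0) _.
have tV0 : 0 <= t^-1 by rewrite tV; lra.
apply: le_trans (lerD (ler_wpM2l (ltW t0) h1) (ler_wpM2l tV0 h2)) _.
have -> : t * (2 * pi * N + e / kp) + t^-1 * (b + e / kp) =
    t * (2 * pi * N) + t^-1 * b + e.
  have -> : t * (2 * pi * N + e / kp) + t^-1 * (b + e / kp) =
      t * (2 * pi * N) + t^-1 * b + kp * (e / kp) by rewrite /kp; ring.
  by congr (_ + _); rewrite mulrCA (mulfV kpne) mulr1.
rewrite lerD2r tV lerD2r le_eqVlt; apply/orP; left; apply/eqP.
have cancel (P n : R) : P != 0 -> (4 * P)^-1 * (2 * P * n) = n / 2 by move=> h; field.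
by apply: cancel; rewrite gt_eqF.
Qed.

Definition elt (S : seq (C -> C)) (i : 'I_(size S)) : C -> C := nth (fun=> 0) S i.

Lemma span_kernel (S : seq (C -> C)) g : (forall i, h2kernel (@elt S i)) ->
  Defs.span S g -> h2kernel g.
Proof. by move=> hS [c ->]; apply: kernel_sum => i; apply: kernelZ; exact: hS. Qed.

(* The Gram system is consistent because a null vector of the Gram matrix is a
   combination of zero norm, which vanishes identically on the half-plane. *)
Lemma proj_exists (S : seq (C -> C)) F : (forall i, h2kernel (@elt S i)) -> in_H2 F ->
  exists g, Defs.span S g /\ forall i, ip (@elt S i) (fsub F g) = 0.
Proof.
move=> hS hF; set n := size S.
pose T (i : 'I_n) := @elt S i.
pose Gm : 'M[C]_n := \matrix_(j, i) ip (T i) (T j).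
pose b : 'rV[C]_n := \row_i ip (T i) F.
have H i : in_H2 (T i) by apply: kernel_H2; exact: hS.
have null (y : 'cV[C]_n) : Gm *m y = 0 -> b *m y = 0.
  (* Coefficients are conjugated because [ip] is conjugate-linear in its first argument. *)
  move=> hy; pose f z := \sum_i conjc (y i 0) * T i z.
  have kf : h2kernel f by apply: kernel_sum => i; apply: kernelZ; exact: hS.
  have fT j : ip f (T j) = 0.
    have /matrixP/(_ j 0) := hy; rewrite !mxE ip_suml // => hj.
    by rewrite -[RHS]hj; apply: eq_bigr => i _; rewrite conjcK mxE mulrC.
  have ff : ip f f = 0.
    by rewrite {2}/f ip_sumr // big1 // => j _; rewrite fT mulr0.
  have f0 := kernel_null kf (congr1 (@complex.Re _) ff).
  have : ip f F = 0.
    transitivity (ip (fun=> 0) F); last exact: ip0l.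
    apply: lconv_ip; apply: lconv_eq (lconv_kernel kernel0 hF) => x x0.
    by apply: eq_ip_line => // z /f0.
  rewrite ip_suml // => E; apply/matrixP => i j; rewrite !ord1 [RHS]mxE -E mxE.
  by apply: eq_bigr => k _; rewrite conjcK mxE mulrC.
(* Solvability amounts to [b] vanishing on the cokernel of [Gm], each column of which is a null
   vector. Linear independence of the family is not assumed. *)
have /submxP[c hc] : (b <= Gm)%MS.
  rewrite submxE; apply/eqP/matrixP => i j.
  have h : b *m col j (cokermx Gm) = 0.
    by apply: null; rewrite colE mulmxA mulmx_coker mul0mx.
  have /matrixP/(_ i 0) := h; rewrite colE mulmxA -colE mxE => ->.
  by rewrite !mxE.
exists (fun z => \sum_i c 0 i * T i z); split; first by exists (fun i => c 0 i).
move=> i; rewrite ipBr //; last by apply: in_H2_sum => j; exact: in_H2Z.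
rewrite ip_sumr //; apply/eqP; rewrite subr_eq0; apply/eqP.
have /matrixP/(_ 0 i) := hc; rewrite !mxE => ->.
by apply: eq_bigr => j _; rewrite mxE.
Qed.

Lemma orth_projP (S : seq (C -> C)) F : (forall i, h2kernel (@elt S i)) -> in_H2 F ->
  Defs.span S (orth_proj S F) /\ forall i, ip (@elt S i) (fsub F (orth_proj S F)) = 0.
Proof. by move=> hS hF; exact: ClassicalEpsilon.epsilon_spec (proj_exists hS hF). Qed.

Lemma orth_proj_ip (S : seq (C -> C)) F : (forall i, h2kernel (@elt S i)) -> in_H2 F ->
  h2kernel (orth_proj S F) /\ forall i, ip (@elt S i) F = ip (@elt S i) (orth_proj S F).
Proof.
move=> hS hF; have [sp o] := orth_projP hS hF; have kg := span_kernel hS sp.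
split => // i; have := o i; rewrite (ipBr (hS i) hF (kernel_H2 kg)).
by move/eqP; rewrite subr_eq0 => /eqP.
Qed.

(** The projection is a combination of the elements of [S], against each of which [F] and its
    projection pair alike. *)
Lemma orth_proj_self (S : seq (C -> C)) F : (forall i, h2kernel (@elt S i)) -> in_H2 F ->
  ip (orth_proj S F) (orth_proj S F) = ip (orth_proj S F) F.
Proof.
move=> hS hF; have [[c cE] _] := orth_projP hS hF; have [kg o] := orth_proj_ip hS hF.
set g := orth_proj S F in cE kg o *.
have E G : in_H2 G -> ip g G = \sum_(i < size S) conjc (c i) * ip (elt i) G.
  by move=> hG; rewrite cE ip_suml.
rewrite (E g (kernel_H2 kg)) (E F hF).
by apply: eq_bigr => i _; rewrite o.
Qed.

Lemma h2norm_eq0 f : h2kernel f -> h2norm f = 0 <-> complex.Re (ip f f) = 0.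
Proof.
move=> hf; rewrite /h2norm; split => [/eqP|->]; last by rewrite sqrtr0.
by rewrite sqrtr_eq0 => h; apply/eqP; rewrite eq_le h ip_self_ge0.
Qed.

(** This translates a vanishing projection norm into interpolation conditions; both the optimality
    hypothesis and the final conclusion are read through it. *)
Lemma orth_proj_null (S : seq (C -> C)) F : (forall i, h2kernel (@elt S i)) ->
  in_H2 F -> h2norm (orth_proj S F) = 0 <-> forall i, ip (@elt S i) F = 0.
Proof.
move=> hS hF; have [kg o] := orth_proj_ip hS hF; rewrite h2norm_eq0 //; split.
  move=> /(kernel_null kg) h i; rewrite o; transitivity (ip (elt i) (fun=> 0)); last exact: ip0r.
  by apply: ip_eq_Cplus => //; exact: kernel_H2.
have [sp _] := orth_projP hS hF; case: sp => c cE h.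
set g := orth_proj S F in kg o cE *.
have gg : ip g g = 0.
  rewrite {1}cE ip_suml //; last exact: kernel_H2.
  by apply: big1 => i _; rewrite -[ip _ g]o h mulr0.
by rewrite gg.
Qed.

End KernelSpace.

(** * Stable rational functions in H2 *)

Section RationalFunctions.
Variable R : realType.
Local Notation C := R[i].
Local Notation mu := (@lebesgue_measure R).
Implicit Types (F G f : C -> C) (p q : {poly C}) (z a : C).

Definition ratf p q : C -> C := fun z => p.[z] / q.[z].
Definition stable q := q != 0 /\ forall z, root q z -> Cminus z.

Lemma stable_neq0 q z : stable q -> 0 <= complex.Re z -> q.[z] != 0.
Proof.
move=> [_ h] hz; apply/negP => /h; rewrite /Cminus => hh.
by have := lt_le_trans hh hz; rewrite ltxx.
Qed.

Lemma ratf_cdiff p q z : q.[z] != 0 -> cdiff (ratf p q) z.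
Proof. by move=> h; apply: cdiffM; [exact: cdiff_poly|apply: cdiffV => //; exact: cdiff_poly]. Qed.

Lemma nc_horner p z (B : R) : 1 <= B -> nc z <= B ->
  nc p.[z] <= (\sum_(i < size p) nc p`_i) * B ^+ (size p).-1.
Proof.
move=> B1 zB; rewrite horner_coef mulr_suml; apply: le_trans (nc_sum _) _.
apply: ler_sum => i _; rewrite ncM ncX ler_wpM2l ?nc_ge0 //.
apply: (@le_trans _ _ (B ^+ i)).
  by apply: lerXn2r; rewrite ?nnegrE ?nc_ge0 // (le_trans ler01).
by apply: ler_weXn2l => //; case: (size p) i => [[]|n i] //=; rewrite -ltnS.
Qed.

(** For each factor z + 1 = (z - a) + (1 + a), and |z - a| >= -Re a on the closed half-plane bounds
    the constant 1 + a by a multiple of |z - a|. *)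
Lemma stable_prod_lower (s : seq C) : (forall a, a \in s -> Cminus a) ->
  exists2 c : R, 0 < c & forall z, 0 <= complex.Re z ->
    nc (z + 1) ^+ size s <= c * nc (\prod_(a <- s) (z - a)).
Proof.
elim: s => [|a s ih] h.
  by exists 1 => // z _; rewrite big_nil expr0 nc1 mulr1.
have [c c0 hc] := ih (fun b hb => h b (mem_behead (s := a :: s) hb)).
have a0 : complex.Re a < 0 by apply: h; exact: mem_head.
set K := 1 + nc (1 + a) / - complex.Re a.
have K0 : 0 < K by rewrite ltr_pwDl // divr_ge0 ?nc_ge0 // oppr_ge0 ltW.
exists (K * c); first exact: mulr_gt0.
move=> z hz; rewrite big_cons ncM /= exprS.
rewrite [leRHS](_ : _ = (K * nc (z - a)) * (c * nc (\prod_(a0 <- s) (z - a0)))); last by ring.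
apply: ler_pM; rewrite ?nc_ge0 ?exprn_ge0 ?nc_ge0 //; last exact: hc.
have -> : z + 1 = (z - a) + (1 + a) by ring.
apply: le_trans (ncD _ _) _; rewrite /K mulrDl mul1r lerD2l mulrAC.
rewrite ler_pdivlMr ?oppr_gt0 // ler_wpM2l ?nc_ge0 //.
by apply: le_trans (Re_le _); rewrite cReD cReN lerDr.
Qed.

Lemma poly_split q : exists s : seq C, q = lead_coef q *: \prod_(a <- s) ('X - a%:P).
Proof. by have [s hs] := closed_field_poly_normal q; exists s. Qed.

Lemma size_split q (s : seq C) : q != 0 ->
  q = lead_coef q *: \prod_(a <- s) ('X - a%:P) -> size q = (size s).+1.
Proof.
by move=> q0 ->; rewrite size_scale ?lead_coef_eq0 // size_prod_XsubC.
Qed.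

Lemma horner_split q (s : seq C) z :
  q = lead_coef q *: \prod_(a <- s) ('X - a%:P) ->
  q.[z] = lead_coef q * \prod_(a <- s) (z - a).
Proof.
move=> {1}->; rewrite hornerZ horner_prod; congr (_ * _).
by apply: eq_bigr => a _; rewrite !hornerE.
Qed.

Lemma root_split q (s : seq C) a : q != 0 ->
  q = lead_coef q *: \prod_(a <- s) ('X - a%:P) -> root q a = (a \in s).
Proof.
by move=> q0 ->; rewrite rootZ ?lead_coef_eq0 // root_prod_XsubC.
Qed.

(** The comparison function is |v[1]|, which gives membership in H2; including the imaginary axis
    makes dominated convergence possible down to x = 0. *)
Lemma ratf_dominated p q : stable q -> (size p < size q)%N ->
  exists2 K : R, 0 <= K & forall z, 0 <= complex.Re z ->
    nc (ratf p q z) <= K * (nc (z + 1))^-1.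
Proof.
move=> hq pq; have [q0 hr] := hq.
have [s qs] := poly_split q.
have [|c c0 hc] := @stable_prod_lower s.
  by move=> a ha; apply: hr; rewrite (root_split _ q0 qs).
have [->|p0] := eqVneq p 0.
  by exists 0 => // z _; rewrite /ratf horner0 !mul0r nc0.
set P := \sum_(i < size p) nc p`_i.
have P0 : 0 <= P by apply: sumr_ge0 => i _; exact: nc_ge0.
have L0 : 0 < nc (lead_coef q) by rewrite nc_gt0 lead_coef_eq0.
exists (P * c / nc (lead_coef q)).
  by apply: divr_ge0; [apply: mulr_ge0 => //; exact: ltW|exact: nc_ge0].
move=> z hz.
have B1 : 1 <= nc (z + 1).
  by apply: le_trans (Re_le _); rewrite cReD /= lerDr.
have zB : nc z <= nc (z + 1).
  rewrite -(@ler_pXn2r _ 2) ?nnegrE ?nc_ge0 // !nc_sqr !ReImE /= addr0; nra.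
have hp := nc_horner p B1 zB; rewrite -/P in hp.
have Bn : 0 < nc (z + 1) by lra.
have qz : 0 < nc q.[z] by rewrite nc_gt0; exact: stable_neq0.
rewrite /ratf ncM ncV ler_pdivrMr //.
apply: le_trans hp _.
have sp : ((size p).-1 <= (size s).-1)%N.
  by move: pq; rewrite (size_split q0 qs) ltnS => h; rewrite -!subn1 leq_sub2r.
have s1 : (0 < size s)%N.
  by move: pq; rewrite (size_split q0 qs) ltnS; apply: leq_trans; rewrite size_poly_gt0.
have := hc z hz; rewrite -{1}(prednK s1) exprS => h1.
rewrite (horner_split z qs) ncM.
set N := nc (\prod_(a <- s) (z - a)) in h1 *.
have -> : P * c / nc (lead_coef q) * (nc (z + 1))^-1 * (nc (lead_coef q) * N) =
   P * (c * N / nc (z + 1)) by field; rewrite !gt_eqF.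
apply: ler_wpM2l => //; rewrite ler_pdivlMr //; apply: le_trans h1.
by rewrite mulrC ler_wpM2l ?nc_ge0 // ler_weXn2l.
Qed.

Lemma in_H2_ext F G : (forall z, Cplus z -> F z = G z) -> in_H2 F -> in_H2 G.
Proof.
move=> FG hF; apply: (in_H2_dom (c := 1) _ hF) => [z hz|z hz]; last by rewrite FG ?mul1r.
apply: (cdiff_near (e := complex.Re z) hz _ (in_H2_cdiff hF hz)) => w hw; apply: FG.
rewrite /Cplus; have := le_lt_trans (Re_nc _) hw; rewrite cReD cReN ltr_norml.
by move=> /andP[]; rewrite ltrBrDr addNr.
Qed.

Lemma Cplus1 : Cplus (1 : C). Proof. by rewrite /Cplus /= ltr01. Qed.

Lemma vker1E z : vker 1 z = (z + 1)^-1.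
Proof. by rewrite /vker rmorph1. Qed.

Lemma in_H2_ratf p q : stable q -> (size p < size q)%N -> in_H2 (ratf p q).
Proof.
move=> hq pq; have [K K0 hK] := ratf_dominated hq pq.
apply: (in_H2_dom (c := K) _ (in_H2_vker Cplus1)).
  by move=> z hz; apply/ratf_cdiff/stable_neq0 => //; exact: ltW.
by move=> z hz; rewrite vker1E ncV; apply: hK; exact: ltW.
Qed.

(** Dominated convergence speaks of sequences, the boundary limit of a real parameter. *)
Lemma seq_eps_delta (phi : R -> R) (l : R) :
  (forall u : nat -> R, (forall n, 0 < u n < n.+1%:R^-1) ->
     phi (u n) @[n --> \oo] --> l) ->
  forall e, 0 < e -> exists2 del, 0 < del & forall x, 0 < x < del -> `|phi x - l| < e.
Proof.
move=> h e e0; apply: contrapT => hn.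
have ex (n : nat) : exists x, 0 < x < n.+1%:R^-1 /\ e <= `|phi x - l|.
  apply: contrapT => hx; apply: hn; exists n.+1%:R^-1; first by rewrite invr_gt0.
  by move=> x hx'; rewrite ltNge; apply/negP => le; apply: hx; exists x.
have [u hu] := choice ex.
have /cvgrPdist_lt/(_ e e0)[N _ /(_ N (leqnn N))] := h u (fun n => (hu n).1).
by rewrite /= distrC ltNge (hu N).2.
Qed.

(** The functions extend continuously to the imaginary axis and their squared moduli are dominated
    by K^2/(1 + w^2). Hence [h2norm] of a stable strictly proper function is a true limit. *)
Lemma lconv_ratf p q : stable q -> (size p < size q)%N ->
  lconv (ip_line (ratf p q) (ratf p q))
    (((2 * pi)^-1 * sqn (vseg (ratf p q) 0))%:C)%C.
Proof.
move=> hq pq; have [K K0 hK] := ratf_dominated hq pq.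
set f := ratf p q.
have cf z : 0 <= complex.Re z -> ccont f z.
  by move=> hz; apply/cdiff_cont/ratf_cdiff/stable_neq0.
have T : forall e, 0 < e -> exists2 del, 0 < del &
    forall x, 0 < x < del -> `|sqn (vseg f x) - sqn (vseg f 0)| < e.
  apply: seq_eps_delta => u hu.
  have u0 n : 0 < u n by case/andP: (hu n).
  have [||||_] := @Rintegral_dominated_cvg R setT (fun n w => nc (vseg f (u n) w) ^+ 2)
    (fun w => nc (vseg f 0 w) ^+ 2) (fun w => K ^+ 2 * (1 ^+ 2 + (w - 0) ^+ 2)^-1) measurableT.
  - move=> n; apply: cmeas_nc2; apply: rcont_cmeas => w; apply: ccont_vseg; apply: cf => /=.
    exact: ltW.
  - move=> w _.
    have hc : rcont (hseg f w) 0 by apply: ccont_hseg; exact: cf.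
    have := rcont_nc2 hc => /cvgrPdist_lt hcc; apply/cvgrPdist_lt => e e0.
    have /nbhs_ballP[del del0 H] := hcc e e0.
    near=> n; apply: H; rewrite /ball /= sub0r normrN gtr0_norm //.
    have /andP[_ h] := hu n; apply: lt_trans h _.
    near: n; exists (Num.bound del^-1) => // n /= hn.
    rewrite -[ltRHS]invrK ltf_pV2 ?posrE ?invr_gt0 //.
    apply: lt_le_trans (archi_boundP _) _; first by rewrite invr_ge0 ltW.
    by rewrite ler_nat; apply: leq_trans hn (leqnSn n).
  - by apply: rintegZ => //; have [] := cauchy_kernel_integ 0 (ltr01 : 0 < 1 :> R).
  - move=> n w _; rewrite ger0_norm ?sqr_ge0 //.
    have h0 : 0 <= complex.Re (Complex (u n) w : C) by rewrite /= ltW.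
    have := hK _ h0; rewrite -/f => le.
    apply: le_trans (lerXn2r 2 _ _ le) _; rewrite ?nnegrE ?nc_ge0 //.
      by rewrite mulr_ge0 // invr_ge0 nc_ge0.
    rewrite exprMn ler_wpM2l ?sqr_ge0 // exprVn nc_sqr !ReImE /=.
    rewrite lef_pV2 ?posrE.
    + by rewrite addr0 subr0 lerD2r lerXn2r ?nnegrE ?addr_ge0 ?ltW // ltrDr.
    + by rewrite ltr_pwDl ?sqr_ge0 // exprn_gt0 // addr_gt0.
    + by rewrite ltr_pwDl ?sqr_ge0 // exprn_gt0.
  exact.
move=> e e0; have [del del0 H] := T e e0; exists del => // x hx.
rewrite ip_line_self -rmorphB nc_real -mulrBr normrM.
have p1 := @twopi_ge1 R.
rewrite ger0_norm; last by rewrite invr_ge0; lra.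
apply: le_lt_trans (H x hx); rewrite ler_piMl // invf_le1 //; lra.
Unshelve. all: by end_near. Qed.

Lemma poly_Cplus0 (P : {poly C}) : (forall z, Cplus z -> P.[z] = 0) -> P = 0.
Proof.
move=> h; apply: (@roots_geq_poly_eq0 _ P [seq n.+1%:R | n <- iota 0 (size P)]).
- by apply/allP => _ /mapP[n _ ->]; apply/rootP; apply: h; rewrite /Cplus raddfMn /= ltr0n.
- rewrite map_inj_uniq ?iota_uniq // => m n /eqP; rewrite eqr_nat => /eqP []; exact.
- by rewrite size_map size_iota.
Qed.

Lemma ratf_cross p q p' q' F : q != 0 -> q' != 0 ->
  (forall z, Cplus z -> F z = ratf p q z) -> (forall z, Cplus z -> F z = ratf p' q' z) ->
  p * q' = p' * q.
Proof.
move=> q0 q'0 h1 h2; apply/eqP; rewrite -subr_eq0.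
(* The factor q q' takes care of the points where a denominator vanishes and the quotient is 0 by
   convention. *)
have : (p * q' - p' * q) * (q * q') = 0.
  apply: poly_Cplus0 => z hz; rewrite !hornerM hornerD hornerN !hornerM.
  have := h1 z hz; rewrite (h2 z hz) /ratf => E.
  have [->|nq] := eqVneq q.[z] 0; first by rewrite mul0r !mulr0.
  have [->|nq'] := eqVneq q'.[z] 0; first by rewrite !mulr0.
  have -> : p.[z] = p'.[z] / q'.[z] * q.[z] by rewrite E divfK.
  by field.
by move/eqP; rewrite mulf_eq0 => /orP[->//|]; rewrite mulf_eq0 (negbTE q0) (negbTE q'0).
Qed.

(** A fraction in [in_Rr] may have common factors, the one in [poles_of] is reduced. By Gauss's
    lemma the reduced denominator divides the other one, which passes on stability and the degree
    bound; comparing degrees gives strict properness. *)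
Lemma in_Rr_coprime r p q F : (0 < r)%N -> in_Rr r F -> q != 0 -> coprimep p q ->
  (forall z, Cplus z -> F z = ratf p q z) ->
  [/\ stable q, (size q <= r.+1)%N & (size p < size q)%N].
Proof.
move=> r0 [p' [q' [sp' sq' hq' hF]]] q0 cpq h.
have q'0 : q' != 0 by rewrite -size_poly_gt0 sq'.
have E := ratf_cross q0 q'0 h hF.
have dq : q %| q'.
  have : q %| p * q' by rewrite E dvdp_mull.
  by rewrite Gauss_dvdpr // coprimep_sym.
split.
- split=> // z rz; apply: hq'; by have [u ->] := dvdpP _ _ dq; rewrite rootM rz orbT.
- by rewrite -sq' dvdp_leq.
have [->|p0] := eqVneq p 0; first by rewrite size_poly0 size_poly_gt0.
have p'0 : p' != 0.
  apply: contraTneq isT => p'0; move: E; rewrite p'0 mul0r => /eqP.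
  by rewrite mulf_eq0 (negbTE p0) (negbTE q'0).
have := congr1 (fun P : {poly C} => size P) E; rewrite /= !size_mul // => E2.
have p'1 : (0 < size p')%N by rewrite size_poly_gt0.
have q1 : (0 < size q)%N by rewrite size_poly_gt0.
move: E2 p'1 q1 sp'; rewrite sq' addnS /=.
by move: (size p) (size q) (size p') => a b c; clear; lia.
Qed.

End RationalFunctions.

(** * Convergence of poles *)

Section PoleConvergence.
Variable R : realType.
Local Notation C := R[i].
Implicit Types (F : C -> C) (p q : {poly C}) (z a : C).

Lemma H2_nbd F : in_H2 F -> exists2 M : R, 0 <= M & nbd F M.
Proof.
move=> /H2_lineP[M M0 h]; exists M => // e e0; exists 1 => // x /andP[x0 _].
by have [_ _ s] := h x x0; apply: le_trans s _; rewrite lerDl ltW.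
Qed.

Lemma H2_value_le F (M : R) z : in_H2 F -> Cplus z -> 0 <= M -> nbd F M ->
  nc (F z) ^+ 2 <= 4 * (pi / complex.Re z) * M.
Proof.
move=> hF hz M0 hb.
have := @nbd_pair_le R (vker z) F z 1 M (F z) hz (in_H2_vker hz) hF M0 _ hb
  (lconv_vker hF hz).
rewrite expr1n mul1r; apply => w _; by rewrite mul1r.
Qed.

(** Otherwise |p/q| would stay away from 0 at large real points s, whereas values of an H2 function
    are O(s^(-1/2)) there. *)
Lemma H2_strictly_proper p q F : stable q -> in_H2 F ->
  (forall z, Cplus z -> F z = ratf p q z) -> (size p < size q)%N.
Proof.
move=> hq hF hE; have [q0 _] := hq; rewrite ltnNge; apply/negP => qp.
have p0 : p != 0 by rewrite -size_poly_gt0; apply: leq_trans qp; rewrite size_poly_gt0.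
have [M M0 hM] := H2_nbd hF.
have [t pt] := poly_split p; have sp := size_split p0 pt.
set L := nc (lead_coef p); have L0 : 0 < L by rewrite nc_gt0 lead_coef_eq0.
set Q := \sum_(i < size q) nc q`_i.
set m := size t.
(* The value estimate will force s <= [D]; below, s exceeds [D], and also twice the sum of the
   moduli of the roots of p, so that |z - a| >= s/2 at each root a. *)
set D := 4 * pi * M * Q ^+ 2 * 4 ^+ m / L ^+ 2.
have D0 : 0 <= D.
  apply: divr_ge0; last exact: sqr_ge0.
  apply: mulr_ge0; last exact: exprn_ge0.
  apply: mulr_ge0; last exact: sqr_ge0.
  by apply: mulr_ge0 => //; apply: mulr_ge0 => //; exact: pi_ge0.
set S := 2 * \sum_(a <- t) nc a.
have S0 : 0 <= S by rewrite mulr_ge0 // sumr_ge0 // => a _; exact: nc_ge0.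
set s := 1 + S + D.
have s1 : 1 <= s by rewrite /s; lra.
have s0 : 0 < s by lra.
set z : C := (s%:C)%C.
have hz : Cplus z by rewrite /Cplus.
have nz : nc z = s by rewrite nc_real gtr0_norm.
have low : (s / 2) ^+ m <= nc (\prod_(a <- t) (z - a)).
  have : forall a, a \in t -> s / 2 <= nc (z - a).
    move=> a at_; have := nc_dist z a; rewrite nz.
    have : nc a <= \sum_(a <- t) nc a.
      by rewrite (big_rem a) //= lerDl sumr_ge0 // => b _; exact: nc_ge0.
    by rewrite /s /S in D0 *; lra.
  rewrite /m; elim: (t) => [|a u ih] hu; first by rewrite big_nil expr0 nc1.
  rewrite big_cons ncM exprS; apply: ler_pM; rewrite ?exprn_ge0 //; try lra.
    by apply: hu; exact: mem_head.
  by apply: ih => b hb; apply: hu; rewrite inE hb orbT.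
have zs : nc z <= s by rewrite nz.
have up := nc_horner q s1 zs; rewrite -/Q in up.
have qz : 0 < nc q.[z] by rewrite nc_gt0; apply: stable_neq0 => //=; exact: ltW.
have := H2_value_le hF hz M0 hM; rewrite hE // /ratf ncM ncV exprMn exprVn.
rewrite ler_pdivrMr ?exprn_gt0 // (horner_split z pt) ncM -/L => h.
have h1 : (L * (s / 2) ^+ m) ^+ 2 <= 4 * (pi / s) * M * (Q * s ^+ m) ^+ 2.
  apply: le_trans (le_trans h _).
    by apply: lerXn2r; rewrite ?nnegrE ?mulr_ge0 ?exprn_ge0 ?nc_ge0 ?ler_wpM2l //; lra.
  apply: ler_wpM2l.
    by rewrite mulr_ge0 // mulr_ge0 // divr_ge0 ?pi_ge0 // ltW.
  apply: lerXn2r; rewrite ?nnegrE ?nc_ge0 //.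
    by rewrite mulr_ge0 ?exprn_ge0 ?(ltW s0) // sumr_ge0 // => i _; exact: nc_ge0.
  apply: le_trans up _; rewrite ler_wpM2l ?sumr_ge0 // => *; rewrite ?nc_ge0 //.
  by rewrite ler_weXn2l // /m -ltnS -sp prednK // size_poly_gt0.
have sm : 0 < s ^+ m by rewrite exprn_gt0.
have E1 : (L * (s / 2) ^+ m) ^+ 2 = L ^+ 2 / 4 ^+ m * (s ^+ m) ^+ 2.
  have e4 : 4 = 2 ^+ 2 :> R by ring.
  have -> : 4 ^+ m = (2 ^+ m) ^+ 2 :> R by rewrite e4 -!exprM mulnC.
  by rewrite expr_div_n; field; rewrite expf_neq0.
have E2 : 4 * (pi / s) * M * (Q * s ^+ m) ^+ 2 = (4 * pi * M * Q ^+ 2 / s) * (s ^+ m) ^+ 2.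
  by ring.
move: h1; rewrite E1 E2 ler_pM2r ?exprn_gt0 // ler_pdivlMr // mulrAC ler_pdivrMr ?exprn_gt0 //.
rewrite mulrC -ler_pdivlMr ?exprn_gt0 // -/D => h2.
by move: h2; rewrite /s; lra.
Qed.

(** The weights do not depend on the polynomial: this is what makes the constants of [pole_near]
    uniform in the approximating fraction. *)
Lemma lagrange_functional (s : seq C) (x : C) : uniq s -> exists w : C -> C,
  forall P : {poly C}, (size P <= size s)%N -> P.[x] = \sum_(z <- s) w z * P.[z].
Proof.
move=> us.
pose den z := \prod_(y <- rem z s) (z - y).
pose L z := (den z)^-1 *: \prod_(y <- rem z s) ('X - y%:P).
exists (fun z => (L z).[x]) => P sP.
have den0 z : z \in s -> den z != 0.
  move=> zs; rewrite /den prodf_seq_neq0; apply/allP => y.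
  rewrite mem_rem_uniq // inE => /andP[yz _].
  by rewrite /= subr_eq0 eq_sym.
have LE t z : (L z).[t] = (den z)^-1 * \prod_(y <- rem z s) (t - y).
  rewrite hornerZ horner_prod; congr (_ * _).
  by apply: eq_bigr => y _; rewrite !hornerE.
have Lz z : z \in s -> (L z).[z] = 1 by move=> zs; rewrite LE mulVf // den0.
have Lt t z : t \in s -> t != z -> (L z).[t] = 0.
  move=> ts tz; rewrite LE (big_rem t) /= ?subrr ?mul0r ?mulr0 //.
  by rewrite mem_rem_uniq // inE tz.
pose D := P - \sum_(z <- s) P.[z] *: L z.
have D0 : D = 0.
  apply: (@roots_geq_poly_eq0 _ D s) => //.
    apply/allP => t ts; apply/rootP; rewrite /D hornerD hornerN horner_sum.
    rewrite (bigD1_seq t) //= hornerZ Lz // mulr1 big_seq_cond big1 ?addr0 ?subrr //.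
    by move=> z /andP[zs tz]; rewrite hornerZ Lt ?mulr0 // eq_sym.
  apply: leq_trans (size_polyD _ _) _; rewrite geq_max sP size_polyN.
  apply: leq_trans (size_sum _ _ _) _; apply/bigmax_leqP_seq => z zs _.
  apply: leq_trans (size_scale_leq _ _) _; apply: leq_trans (size_scale_leq _ _) _.
  by rewrite size_prod_XsubC size_rem //; case: (s) zs.
have /(congr1 (horner^~ x)) := D0; rewrite /D hornerD hornerN horner_sum horner0 => /eqP.
rewrite subr_eq0 => /eqP ->; apply: eq_bigr => z _; rewrite hornerZ mulrC //.
Qed.

Lemma nc_sum_seq (T : Type) (s : seq T) (f : T -> C) :
  nc (\sum_(i <- s) f i) <= \sum_(i <- s) nc (f i).
Proof.
elim: s => [|a s ih]; first by rewrite !big_nil nc0.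
by rewrite !big_cons; apply: le_trans (ncD _ _) _; rewrite lerD2l.
Qed.

Lemma le_sum_seq (s : seq C) (f : C -> R) z : (forall z, 0 <= f z) -> z \in s ->
  f z <= \sum_(i <- s) f i.
Proof. by move=> f0 zs; rewrite (big_rem z) //= lerDl sumr_ge0. Qed.

(* p1 q - p q1 is small at many points of the half-plane, hence (Lagrange) at the
   poles la, where it equals - p(la) q1(la); normalising q1 by its values at these
   points, q1(la) is small compared with the leading coefficient of q1. *)
Lemma pole_near p q (lam : seq C) r (eps : R) : coprimep p q -> stable q ->
  uniq lam -> size lam = r -> (forall z, z \in lam -> root q z) -> 0 < eps ->
  exists pts : seq C, (forall z, z \in pts -> 1 <= complex.Re z) /\
  exists2 eta : R, 0 < eta & forall p1 q1, stable q1 -> (size q1 <= r.+1)%N ->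
    (size p1 <= r)%N ->
    (forall z, z \in pts -> nc (ratf p1 q1 z - ratf p q z) <= eta) ->
    forall la, la \in lam -> exists2 a, root q1 a & nc (a - la) < eps.
Proof.
move=> cpq hq ul sl rl eps0.
(* Enough nodes to determine both p1 q - p q1 and q1. *)
set N := (size p + size q + r).+1.
set pts : seq C := [seq n.+1%:R | n <- iota 0 N].
have upts : uniq pts.
  rewrite map_inj_uniq ?iota_uniq // => m n /eqP; rewrite eqr_nat => /eqP []; exact.
have spts : size pts = N by rewrite size_map size_iota.
have Pp z : z \in pts -> 1 <= complex.Re z.
  by move=> /mapP[n _ ->]; rewrite raddfMn /= ler1n.
have Pp0 z : z \in pts -> 0 <= complex.Re z by move=> /Pp; exact: le_trans.
have [W hW] := choice (fun x => lagrange_functional x upts).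
have [V hV] := choice (fun x => lagrange_functional x ul).
have pl la : la \in lam -> p.[la] != 0.
  by move=> /rl hr; apply: coprimep_root hr; rewrite coprimep_sym.
pose q0 := \prod_(y <- lam) ('X - y%:P).
(* [B] will bound q1 at the poles relative to m eta, [A] is the size of the limiting monic
   denominator at the nodes, and [Vc] that of the weights which lead from the poles back to the
   nodes. *)
pose B := \sum_(la <- lam) \sum_(z <- pts) nc (W la z) * nc q.[z] / nc p.[la].
pose A := \sum_(z <- pts) nc q0.[z].
pose Vc := \sum_(z <- pts) \sum_(y <- lam) nc (V z y).
have B0 : 0 <= B.
  by do 2 apply: sumr_ge0 => ? _; rewrite divr_ge0 ?mulr_ge0 ?nc_ge0.
have A0 : 0 <= A by apply: sumr_ge0 => ? _; exact: nc_ge0.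
have V0 : 0 <= Vc by do 2 apply: sumr_ge0 => ? _; exact: nc_ge0.
have BV0 := mulr_ge0 B0 V0; have AB0 := mulr_ge0 A0 B0.
exists pts; split => //.
(* The first bound lets the term m eta B Vc be absorbed into m/2, the second gives 2 A B eta < eps^r
   for the final contradiction. *)
pose eta := Num.min (2 * (B * Vc + 1))^-1 (eps ^+ r / (2 * (2 * (A * B) + 1))).
have er : 0 < eps ^+ r by exact: exprn_gt0.
have eta0 : 0 < eta by rewrite lt_min invr_gt0 divr_gt0 //; lra.
have eta1 : eta * (B * Vc) <= 1 / 2.
  have : eta <= (2 * (B * Vc + 1))^-1 by rewrite ge_min lexx.
  by move=> /(ler_wpM2r BV0) /le_trans; apply; rewrite mulrC ler_pdivrMr; lra.
have eta2 : eta * (2 * (A * B)) < eps ^+ r.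
  have : eta <= eps ^+ r / (2 * (2 * (A * B) + 1)) by rewrite ge_min lexx orbT.
  have AB2 : 0 <= 2 * (A * B) by lra.
  move=> /(ler_wpM2r AB2) /le_lt_trans; apply; rewrite mulrAC ltr_pdivrMr; last by lra.
  by rewrite ltr_pM2l //; lra.
exists eta => // p1 q1 hq1 sq1 sp1 hd la lal.
have [q10 _] := hq1.
pose m := \sum_(z <- pts) nc q1.[z].
have m0 : 0 <= m by apply: sumr_ge0 => ? _; exact: nc_ge0.
have mz z : z \in pts -> nc q1.[z] <= m by apply: le_sum_seq => y; exact: nc_ge0.
have small y : y \in lam -> nc q1.[y] <= m * eta * B.
  move=> yl; pose D := p1 * q - p * q1.
  have sD : (size D <= N)%N.
    apply: leq_trans (size_polyD _ _) _; rewrite geq_max size_polyN.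
    apply/andP; split; apply: leq_trans (size_polyMleq _ _) _; rewrite /N.
      by move: sp1; clear; move: (size p1) (size q) (size p) => a b c; lia.
    by move: sq1; clear; move: (size q1) (size q) (size p) => a b c; lia.
  have Dy : D.[y] = - (p.[y] * q1.[y]).
    by rewrite /D hornerD hornerN !hornerM (rootP (rl y yl)) mulr0 sub0r.
  have Dz z : z \in pts -> nc D.[z] <= m * nc q.[z] * eta.
    move=> zp; have nq := stable_neq0 hq (Pp0 z zp); have nq1 := stable_neq0 hq1 (Pp0 z zp).
    have -> : D.[z] = q1.[z] * q.[z] * (ratf p1 q1 z - ratf p q z).
      by rewrite /D /ratf hornerD hornerN !hornerM; field; rewrite nq nq1.
    rewrite !ncM; apply: ler_pM; rewrite ?mulr_ge0 ?nc_ge0 //; last exact: hd.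
    by rewrite ler_wpM2r ?nc_ge0 // mz.
  have py : 0 < nc p.[y] by rewrite nc_gt0 pl.
  have : nc D.[y] <= m * eta * \sum_(z <- pts) nc (W y z) * nc q.[z].
    rewrite hW ?spts //; apply: le_trans (nc_sum_seq _ _) _.
    rewrite mulr_sumr big_seq [leRHS]big_seq; apply: ler_sum => z zp; rewrite ncM.
    apply: le_trans (ler_wpM2l (nc_ge0 _) (Dz z zp)) _.
    by rewrite le_eqVlt; apply/orP; left; apply/eqP; ring.
  rewrite Dy ncN ncM mulrC -ler_pdivlMr // => /le_trans; apply.
  rewrite -(mulrA (m * eta)); apply: ler_wpM2l.
    by rewrite mulr_ge0 // ltW.
  rewrite mulr_suml.
  apply: (@le_sum_seq lam (fun la => \sum_(z <- pts) nc (W la z) * nc q.[z] / nc p.[la])) => //.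
  by move=> z; apply: sumr_ge0 => ? _; rewrite divr_ge0 ?mulr_ge0 ?nc_ge0.
(* Subtracting c q0 removes the coefficient of degree r without changing the values at [lam], so q1
   - c q0 is recovered from the small values of q1 there. Thus m <= |c| A + m eta B Vc, and |c|
   controls m. *)
pose c := q1`_r.
have sq0 : size q0 = r.+1 by rewrite size_prod_XsubC sl.
have mc : m <= 2 * (nc c * A).
  suff : m <= nc c * A + m * (eta * (B * Vc)).
    by have := ler_wpM2l m0 eta1; lra.
  have E z : q1.[z] = c * q0.[z] + \sum_(y <- lam) V z y * q1.[y].
    have := hV z (q1 - c *: q0).
    have -> : (size (q1 - c *: q0)%R <= size lam)%N.
      rewrite sl; apply/leq_sizeP => j; rewrite leq_eqVlt => /orP[/eqP <-|rj].
        have : q0`_r = 1.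
          by have := monic_prod_XsubC lam xpredT id; rewrite monicE lead_coefE -/q0 sq0 => /eqP.
        by rewrite coefB coefZ => ->; rewrite mulr1 subrr.
      by rewrite coefB coefZ !nth_default ?mulr0 ?subrr ?sq0 //; apply: leq_trans sq1 rj.
    move=> /(_ isT); rewrite hornerD hornerN hornerZ => /eqP; rewrite subr_eq addrC => /eqP ->.
    congr (_ + _); rewrite big_seq [RHS]big_seq; apply: eq_bigr => y yl.
    rewrite hornerD hornerN hornerZ (_ : q0.[y] = 0) ?mulr0 ?subr0 //.
    by apply/rootP; rewrite root_prod_XsubC.
  rewrite {1}/m /A mulr_sumr.
  have -> : m * (eta * (B * Vc)) = \sum_(z <- pts) \sum_(y <- lam) nc (V z y) * (m * eta * B).
    rewrite /Vc; under [RHS]eq_bigr do rewrite -mulr_suml.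
    by rewrite -mulr_suml; ring.
  rewrite -big_split /=; apply: ler_sum => z _; rewrite E.
  apply: le_trans (ncD _ _) _; rewrite ncM lerD2l.
  apply: le_trans (nc_sum_seq _ _) _; rewrite big_seq [leRHS]big_seq.
  by apply: ler_sum => y yl; rewrite ncM ler_wpM2l ?nc_ge0 // small.
have mp : 0 < m.
  rewrite lt_neqAle m0 andbT eq_sym; apply/negP => /eqP me.
  move: q10; rewrite (_ : q1 = 0) ?eqxx //.
  apply: (@roots_geq_poly_eq0 _ q1 pts) => //.
    apply/allP => z zp; apply/rootP/eqP; rewrite -nc_eq0 eq_le nc_ge0 andbT -me.
    exact: mz.
  rewrite spts /N; apply: leq_trans sq1 _; clear; lia.
have c0 : 0 < nc c.
  by rewrite lt_neqAle nc_ge0 andbT eq_sym; apply: contraTneq mp => ce;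
    rewrite -leNgt; apply: le_trans mc _; rewrite ce mul0r mulr0.
have s1 : size q1 = r.+1.
  apply/eqP; rewrite eqn_leq sq1 ltnNge; apply/negP => h.
  by move: c0; rewrite /c nth_default // nc0 ltxx.
have lc : lead_coef q1 = c by rewrite lead_coefE s1.
have [t qt] := poly_split q1.
have st : size t = r by have := size_split q10 qt; rewrite s1 => -[].
(* If all roots of q1 were at distance at least eps from la, then |q1(la)| >= |c| eps^r; but it is
   at most m eta B <= 2 |c| A B eta. *)
apply: contrapT => hn.
have far a : a \in t -> eps <= nc (la - a).
  move=> ta; rewrite leNgt; apply/negP => lt; apply: hn; exists a; last by rewrite ncBC.
  by rewrite (root_split _ q10 qt).
have low : eps ^+ size t <= nc (\prod_(a <- t) (la - a)).
  elim: (t) far => [|a u ih] hu; first by rewrite big_nil expr0 nc1.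
  rewrite big_cons ncM exprS; apply: ler_pM; rewrite ?exprn_ge0 //; try exact: ltW.
    by apply: hu; exact: mem_head.
  by apply: ih => b hb; apply: hu; rewrite inE hb orbT.
have := small la lal; rewrite (horner_split la qt) ncM lc => h.
have : nc c * eps ^+ r <= nc c * (eta * (2 * (A * B))).
  rewrite -st; apply: le_trans (ler_wpM2l (nc_ge0 c) low) _; apply: le_trans h _.
  have e0B : 0 <= eta * B by rewrite mulr_ge0 // ltW.
  have := ler_wpM2r e0B mc; rewrite -mulrA => /le_trans; apply.
  by rewrite le_eqVlt; apply/orP; left; apply/eqP; ring.
by rewrite ler_pM2l // leNgt eta2.
Qed.

End PoleConvergence.

(** * Small pairings from nearby zeros *)

Section LocalEstimates.
Variable R : realType.
Local Notation C := R[i].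
Implicit Types (F G g : C -> C) (p q : {poly C}).

(** Bounding the square root of 4PB by 1 + 4PB avoids roots and keeps the estimate linear in the
    small factor c. *)
Lemma le_of_sqr (X c P B : R) : 0 <= X -> 0 <= c -> 0 <= P -> 0 <= B ->
  X ^+ 2 <= 4 * (c ^+ 2 * P) * B -> X <= c * (1 + 4 * P * B).
Proof.
move=> X0 c0 P0 B0 h; have PB := mulr_ge0 P0 B0.
rewrite -(@ler_pXn2r _ 2) ?nnegrE //; last by rewrite mulr_ge0 //; lra.
apply: le_trans h _; rewrite exprMn.
rewrite (_ : 4 * (c ^+ 2 * P) * B = c ^+ 2 * (4 * (P * B))); last by ring.
apply: ler_wpM2l; first exact: sqr_ge0.
by rewrite -mulrA; nra.
Qed.

Lemma near_Cplus (pt d : C) : Cplus pt -> nc (d - pt) <= complex.Re pt / 2 ->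
  Cplus d /\ complex.Re pt / 2 <= complex.Re d.
Proof.
rewrite /Cplus => hp hd; have := le_trans (Re_nc _) hd.
by rewrite cReD cReN ler_norml => /andP[h1 _]; split; lra.
Qed.

Lemma nc_vker_near (pt d z : C) : Cplus pt -> nc (d - pt) <= complex.Re pt / 2 ->
  Cplus z -> nc (vker d z) <= 2 / complex.Re pt.
Proof.
move=> hp hd hz; have [h1 h2] := near_Cplus hp hd; apply: le_trans (nc_vker_le h1 hz) _.
by rewrite -[leRHS]invf_div lef_pV2 ?posrE // divr_gt0.
Qed.

Lemma vker_near (pt d z : C) : Cplus pt -> nc (d - pt) <= complex.Re pt / 2 -> Cplus z ->
  nc (vker d z - vker pt z) <= nc (d - pt) * (2 / complex.Re pt) * nc (vker pt z).
Proof.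
move=> hp hd hz; have [h1 _] := near_Cplus hp hd.
rewrite vkerB // ncM ncN nc_conj ncM mulrA ler_wpM2r ?nc_ge0 //.
by rewrite ler_wpM2l ?nc_ge0 // nc_vker_near.
Qed.

Lemma kernel_pair_le (k F : C -> C) (pt : C) (c B : R) : Cplus pt -> h2kernel k -> in_H2 F ->
  0 <= c -> 0 <= B -> nbd F B ->
  (forall z, Cplus z -> nc (k z) <= c * nc (vker pt z)) ->
  nc (ip k F) <= c * (1 + 4 * (pi / complex.Re pt) * B).
Proof.
move=> hp hk hF c0 B0 hB le.
have P0 : 0 <= pi / complex.Re pt by apply: divr_ge0; [exact: pi_ge0|exact: ltW].
apply: le_of_sqr => //; first exact: nc_ge0.
by apply: (nbd_pair_le (F := F)) le hB (lconv_kernel hk hF) => //; exact: kernel_H2.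
Qed.

(** Since F vanishes at d, v[d] may be subtracted from v[pt] without changing the pairing, and the
    difference is small relative to v[pt]. *)
Lemma vker_ip_near F (pt d : C) (B : R) : in_H2 F -> Cplus pt ->
  nc (d - pt) <= complex.Re pt / 2 -> 0 <= B -> nbd F B -> F d = 0 ->
  nc (ip (vker pt) F) <=
    nc (d - pt) * (2 / complex.Re pt) * (1 + 4 * (pi / complex.Re pt) * B).
Proof.
move=> hF hp hd B0 hB Fd; have [hd' _] := near_Cplus hp hd.
have kp := kernel_vker hp; have kd := kernel_vker hd'.
have -> : ip (vker pt) F = ip (fun z => vker pt z + -1 * vker d z) F.
  rewrite ipDl // ?ipZl // ?(ip_vker hF hd') ?Fd ?mulr0 ?addr0 //; exact: kernelZ.
apply: kernel_pair_le => //.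
- by apply: kernelD => //; exact: kernelZ.
- by rewrite mulr_ge0 ?nc_ge0 // divr_ge0 // ltW.
by move=> z hz; rewrite mulN1r (ncBC (vker pt z)); exact: vker_near.
Qed.

(** The same subtraction for derivatives: the difference of the two squares factors into a small and
    a bounded term. *)
Lemma dvker_ip_near F (pt d : C) (B : R) : in_H2 F -> Cplus pt ->
  nc (d - pt) <= complex.Re pt / 2 -> 0 <= B -> nbd F B -> ip (dvker d) F = 0 ->
  nc (ip (dvker pt) F) <=
    nc (d - pt) * (2 * (2 / complex.Re pt) ^+ 2) * (1 + 4 * (pi / complex.Re pt) * B).
Proof.
move=> hF hp hd B0 hB Fd; have [hd' _] := near_Cplus hp hd.
have kp := kernel_dvker hp; have kd := kernel_dvker hd'.
have K0 : 0 <= 2 / complex.Re pt by rewrite divr_ge0 // ltW.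
have pp : nc (pt - pt) <= complex.Re pt / 2 by rewrite subrr nc0 divr_ge0 // ltW.
have -> : ip (dvker pt) F = ip (fun z => dvker pt z + -1 * dvker d z) F.
  by rewrite ipDl // ?ipZl // ?Fd ?mulr0 ?addr0 //; exact: kernelZ.
apply: kernel_pair_le => //.
- by apply: kernelD => //; exact: kernelZ.
- by rewrite mulr_ge0 ?nc_ge0 // mulr_ge0 // sqr_ge0.
move=> z hz; have -> : dvker pt z + -1 * dvker d z =
    (vker d z - vker pt z) * (vker d z + vker pt z) by rewrite !dvkerE; ring.
rewrite ncM [leRHS](_ : _ = nc (d - pt) * (2 / complex.Re pt) * nc (vker pt z) *
  (2 / complex.Re pt + 2 / complex.Re pt)); last by ring.
apply: ler_pM; rewrite ?nc_ge0 //; first exact: vker_near.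
by apply: le_trans (ncD _ _) _; apply: lerD; exact: nc_vker_near.
Qed.

(** Two simple zeros do the work of a double one. By the resolvent identity the divided difference
    of v[d1] and v[d2] is -v[d1] v[d2], which is close to v[pt]' = -v[pt]^2. The bound does not
    involve the distance from d1 to d2; it only has to be nonzero. *)
Lemma dvker_ip_two_zeros F (pt d1 d2 : C) (B : R) : in_H2 F -> Cplus pt ->
  nc (d1 - pt) <= complex.Re pt / 2 -> nc (d2 - pt) <= complex.Re pt / 2 ->
  d1 != d2 -> 0 <= B -> nbd F B -> F d1 = 0 -> F d2 = 0 ->
  nc (ip (dvker pt) F) <= (nc (d1 - pt) + nc (d2 - pt)) * (2 / complex.Re pt) ^+ 2
     * (1 + 4 * (pi / complex.Re pt) * B).
Proof.
move=> hF hp h1 h2 d12 B0 hB F1 F2.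
have [c1 _] := near_Cplus hp h1; have [c2 _] := near_Cplus hp h2.
have K0 : 0 <= 2 / complex.Re pt by rewrite divr_ge0 // ltW.
have pp : nc (pt - pt) <= complex.Re pt / 2 by rewrite subrr nc0 divr_ge0 // ltW.
set u := (conjc (d1 - d2))^-1.
have kp := kernel_dvker hp.
have k1 := kernel_vker c1; have k2 := kernel_vker c2.
have kd : h2kernel (fun z => vker d1 z + -1 * vker d2 z) by apply: kernelD => //; exact: kernelZ.
have -> : ip (dvker pt) F = ip (fun z => dvker pt z + - u * (vker d1 z + -1 * vker d2 z)) F.
  rewrite ipDl //; last exact: kernelZ.
  rewrite ipZl // ipDl //; last exact: kernelZ.
  by rewrite ipZl // !ip_vker // F1 F2 mulr0 addr0 mulr0 addr0.
apply: kernel_pair_le => //.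
- by apply: kernelD => //; exact: kernelZ.
- by rewrite mulr_ge0 ?sqr_ge0 // addr_ge0 // nc_ge0.
move=> z hz.
have E1 : - u * (vker d1 z + -1 * vker d2 z) = vker d1 z * vker d2 z.
  rewrite mulN1r vkerB // !mulNr mulrN opprK mulrA /u mulVf ?mul1r //.
  by rewrite conjc_eq0 subr_eq0.
have -> : dvker pt z + - u * (vker d1 z + -1 * vker d2 z) =
   vker pt z * (vker d1 z - vker pt z) + vker d1 z * (vker d2 z - vker pt z).
  by rewrite E1 dvkerE; ring.
apply: le_trans (ncD _ _) _; rewrite !ncM.
set K := 2 / complex.Re pt in K0 *.
rewrite [leRHS](_ : _ = K * (nc (d1 - pt) * K * nc (vker pt z)) +
  K * (nc (d2 - pt) * K * nc (vker pt z))); last by ring.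
apply: lerD; apply: ler_pM; rewrite ?nc_ge0 //; try exact: vker_near.
- exact: nc_vker_near.
- exact: nc_vker_near.
Qed.

Lemma dvker_ip_le F (pt : C) (B : R) : in_H2 F -> Cplus pt -> 0 <= B -> nbd F B ->
  nc (ip (dvker pt) F) ^+ 2 <= 4 * ((complex.Re pt)^-1 ^+ 2 * (pi / complex.Re pt)) * B.
Proof.
move=> hF hp B0 hB.
have kp := kernel_dvker hp.
apply: (@nbd_pair_le R (dvker pt) F pt) (lconv_kernel kp hF) => //.
- exact: kernel_H2.
- by move=> z hz; exact: nc_dvker_le.
Qed.

Lemma nbdD F G (a b : R) : in_H2 F -> in_H2 G -> nbd F a -> nbd G b ->
  nbd (fun z => F z + G z) (2 * a + 2 * b).
Proof.
move=> hF hG ha hb e e0; have e4 : 0 < e / 4 by lra.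
have [d1 d10 H1] := ha _ e4; have [d2 d20 H2] := hb _ e4.
exists (Num.min d1 d2); first by rewrite lt_min d10.
move=> x; rewrite lt_min => /and3P[x0 x1 x2].
have [_ s] := sqnD hF hG x0; apply: le_trans s _.
by have := H1 x; have := H2 x; rewrite x0 x1 x2 => /(_ isT) ? /(_ isT) ?; lra.
Qed.

Lemma nbdN F (a : R) : nbd F a -> nbd (fun z => -1 * F z) a.
Proof.
move=> ha e /ha[del del0 H]; exists del => // x /H.
suff -> : sqn (vseg (fun z => -1 * F z) x) = sqn (vseg F x) by [].
by apply: eq_Rintegral => t _; rewrite /vseg ncM ncN nc1 mul1r.
Qed.

Lemma Tfam_all (P : (C -> C) -> Prop) (lam : seq C) :
  (forall n, (n < size (Tfam lam))%N -> P (nth (fun=> 0) (Tfam lam) n)) <->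
  (forall la, la \in lam -> P (vker (- conjc la)) /\ P (dvker (- conjc la))).
Proof.
elim: lam => [|a lam ih]; first by split.
split=> [h la|h].
  rewrite inE => /predU1P[->|hl]; first by split; [exact: (h 0%N)|exact: (h 1%N)].
  by move: la hl; apply/ih => n hn; exact: (h n.+2).
case=> [|[|n]] hn; try by have [] := h a (mem_head _ _).
by move: n hn; apply/ih => la hl; apply: h; rewrite inE hl orbT.
Qed.

Lemma Tfam_elt (P : (C -> C) -> Prop) (lam : seq C) :
  (forall i, P (@elt R (Tfam lam) i)) <->
  (forall la, la \in lam -> P (vker (- conjc la)) /\ P (dvker (- conjc la))).
Proof.
rewrite -Tfam_all; split=> h; first by move=> n hn; exact: (h (Ordinal hn)).
by move=> i; apply: h.
Qed.

Lemma vker_elt (P : (C -> C) -> Prop) (mu : seq C) :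
  (forall i, P (@elt R [seq vker m | m <- mu] i)) <->
  (forall m, m \in mu -> P (vker m)).
Proof.
split=> [h m hm|h i].
  have hi : (index m mu < size [seq vker m | m <- mu])%N by rewrite size_map index_mem.
  by have := h (Ordinal hi); rewrite /elt /= (nth_map m) ?index_mem // nth_index.
have hi : (i < size mu)%N by case: i => i /=; rewrite size_map.
by rewrite /elt (nth_map 0) //; apply: h; rewrite mem_nth.
Qed.

Lemma Cplus_mirror (a : C) : Cminus a -> Cplus (- conjc a).
Proof. by rewrite /Cplus /Cminus cReN cReJ oppr_gt0. Qed.

Lemma Tfam_kernel (lam : seq C) : (forall a, a \in lam -> Cminus a) ->
  forall i, h2kernel (@elt R (Tfam lam) i).
Proof.
move=> h; apply/Tfam_elt => a /h /Cplus_mirror hp.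
by split; [exact: kernel_vker|exact: kernel_dvker].
Qed.

Lemma vker_elt_kernel (mu : seq C) : (forall m, m \in mu -> Cplus m) ->
  forall i, h2kernel (@elt R [seq vker m | m <- mu] i).
Proof. by move=> h; apply/vker_elt => m /h; exact: kernel_vker. Qed.

End LocalEstimates.

(** * Rational differences and the passage to the limit *)

Section Assembly.
Variable R : realType.
Local Notation C := R[i].
Implicit Types (F G g H : C -> C) (p q : {poly C}).

Lemma size_sub_cross p q p1 q1 : q != 0 -> q1 != 0 ->
  (size p < size q)%N -> (size p1 < size q1)%N ->
  (size (p1 * q - p * q1)%R < size (q1 * q)%R)%N.
Proof.
move=> q0 q10 h h1; rewrite size_mul //.
apply: leq_ltn_trans (size_polyD _ _) _; rewrite gtn_max size_polyN.
have a1 := size_polyMleq p1 q; have a2 := size_polyMleq p q1.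
have b1 : (0 < size q)%N by rewrite size_poly_gt0.
have b2 : (0 < size q1)%N by rewrite size_poly_gt0.
apply/andP; split.
  apply: leq_ltn_trans a1 _; move: h1 b1 b2; clear.
  by move: (size p1) (size q) (size q1) => a b c; lia.
apply: leq_ltn_trans a2 _; move: h b1 b2; clear.
by move: (size p) (size q) (size q1) => a b c; lia.
Qed.

(** The difference is again stable and strictly proper, so its [h2norm] is a true limit and controls
    the lines near the axis. The convergence hypothesis enters the estimates here. *)
Lemma ratf_diff_nbd p q p1 q1 F G : stable q -> stable q1 ->
  (size p < size q)%N -> (size p1 < size q1)%N ->
  (forall z, Cplus z -> F z = ratf p1 q1 z) -> (forall z, Cplus z -> G z = ratf p q z) ->
  nbd (fsub F G) (2 * pi * h2norm (fsub F G) ^+ 2).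
Proof.
move=> hq hq1 sp sp1 hF hG.
have [q0 rq] := hq; have [q10 rq1] := hq1.
have hs : stable (q1 * q).
  by split=> [|z]; [rewrite mulf_neq0|rewrite rootM => /orP[/rq1|/rq]].
have ss := size_sub_cross q0 q10 sp sp1.
have E z : Cplus z -> ratf (p1 * q - p * q1) (q1 * q) z = fsub F G z.
  move=> hz; have n1 := stable_neq0 hq (ltW hz); have n2 := stable_neq0 hq1 (ltW hz).
  rewrite /fsub hF // hG // /ratf hornerD hornerN !hornerM.
  by field; rewrite n1 n2.
have L := lconv_ratf hs ss.
set l : R := (2 * pi)^-1 * _ in L.
have l0 : 0 <= l.
  by rewrite mulr_ge0 ?sqn_ge0 // invr_ge0; have := @twopi_ge1 R; lra.
have L' : lconv (ip_line (fsub F G) (fsub F G)) (l%:C)%C.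
  by apply: lconv_eq L => x x0; apply: eq_ip_line.
have := lconv_self_nbd L'; rewrite /h2norm (lconv_ip L') /=.
by rewrite sqr_sqrtr.
Qed.

Lemma poles_stable F (lam : seq C) : poles_of F lam ->
  (forall z, z \in lam -> Cminus z) ->
  exists p q, [/\ stable q, coprimep p q, (forall z, Cplus z -> F z = ratf p q z)
    & forall z, (z \in lam) = root q z].
Proof.
move=> [p [q [q0 cpq hF _ hr]]] hl; exists p, q; split => //.
by split => // z; rewrite -hr; exact: hl.
Qed.

Lemma in_Rr_H2 r F (lam : seq C) : (0 < r)%N -> in_Rr r F -> poles_of F lam ->
  exists p q, [/\ stable q, (size p < size q)%N, (size q <= r.+1)%N,
    (forall z, Cplus z -> F z = ratf p q z) & forall z, (z \in lam) = root q z].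
Proof.
move=> r0 hF [p [q [q0 cpq hE _ hr]]].
by have [h1 h2 h3] := in_Rr_coprime r0 hF q0 cpq hE; exists p, q.
Qed.

Lemma nc_le_eps_eq0 (z : C) : (forall e, 0 < e -> nc z <= e) -> z = 0.
Proof.
move=> h; apply/eqP; rewrite -nc_eq0 eq_le nc_ge0 andbT.
by apply/ler_addgt0Pr => e /h; rewrite add0r.
Qed.

Lemma le_of_sqr_le (x c h : R) : 0 <= c -> 0 <= h -> 0 <= x ->
  x ^+ 2 <= c * h ^+ 2 -> x <= (1 + c) * h.
Proof.
move=> c0 h0 x0 hx; rewrite -(@ler_pXn2r _ 2) ?nnegrE // ?mulr_ge0 ?addr_ge0 //.
by apply: le_trans hx _; rewrite exprMn ler_wpM2r ?sqr_ge0 //; nra.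
Qed.

Lemma nc_add3_le (x y z : C) (e : R) : nc x <= e / 3 -> nc y <= e / 3 ->
  nc z <= e / 3 -> nc (x + (y + z)) <= e.
Proof.
by move=> hx hy hz; have := ncD x (y + z); have := ncD y z; lra.
Qed.

Lemma conj_mirror (a b : C) : nc (- conjc a - - conjc b) = nc (a - b).
Proof. by rewrite -opprD -rmorphB ncN nc_conj. Qed.

End Assembly.

Unset Implicit Arguments.
Set Strict Implicit.

Theorem theorem5p1 (R : realType) (H : R[i] -> R[i]) (n0 r : nat)
    (mu mustar : nat -> seq R[i]) (Hhat : nat -> R[i] -> R[i])
    (lams : nat -> seq R[i]) (Hr : R[i] -> R[i]) (lam : seq R[i]) :
  in_H2 H ->
  (0 < n0)%N -> (0 < r)%N -> (2 * r <= n0)%N ->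
  size (mu 0%N) = n0 ->
  (forall z, z \in mu 0%N -> Cplus z) ->
  (forall l, mu l.+1 = mu l ++ mustar l) ->
  (forall l z, z \in mustar l -> Cplus z) ->
  (forall l, uniq (mu l)) ->
  (forall l, loc_opt_proj r H (mu l) (Hhat l)) ->
  (forall l, poles_of (Hhat l) (lams l)) ->
  (forall l, h2norm (Qproj (lams l) (Pproj (mu l) (fsub H (Hhat l)))) = 0) ->
  in_H2 Hr ->
  poles_of Hr lam -> size lam = r -> (forall z, z \in lam -> Cminus z) ->
  (fun l => h2norm (fsub (Hhat l) Hr)) @ \oo --> (0 : R) ->
  (forall z, z \in lam -> limit_point_of_entries mustar (- conjc z)) ->
  h2norm (Qproj lam (fsub H Hr)) = 0.
Proof.
move=> hH _ r0 _ _ hmu0 hmuS hms umu hopt hpol hQ hHr polr slam hlam hcv hlim.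
have hRr l : in_Rr r (Hhat l) by case: (hopt l).
have [p [q [hq cpq Hrq lamq]]] := poles_stable polr hlam.
have spq := H2_strictly_proper hq hHr Hrq.
have ulam : uniq lam by case: polr => [? [? []]].
have hHhat l : in_H2 (Hhat l).
  have [p1 [q1 [h1 h2 _ h3 _]]] := in_Rr_H2 r0 (hRr l) (hpol l).
  by apply: in_H2_ext (in_H2_ratf h1 h2) => z hz; rewrite h3.
have hmu l z : z \in mu l -> Cplus z.
  elim: l z => [|l ih] z; first exact: hmu0.
  by rewrite hmuS mem_cat => /orP[/ih|/hms].
have mumono l l' z : (l <= l')%N -> z \in mu l -> z \in mu l'.
  move=> /subnK <-; elim: (l' - l)%N => // n ih /ih.
  by rewrite addSn hmuS mem_cat => ->.
set E := fsub H Hr.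
have hE : in_H2 E by exact: in_H2B.
have [ME ME0 hME] := H2_nbd hE.
apply: (orth_proj_null (Tfam_kernel hlam) hE).2.
apply: (Tfam_elt (fun k => ip k E = 0) lam).2 => la hla.
set pt := - conjc la.
have hpt : Cplus pt by apply: Cplus_mirror; exact: hlam.
set Pt := complex.Re pt; have Pt0 : 0 < Pt by [].
set P := pi / Pt; have P0 : 0 <= P by apply: divr_ge0; [exact: pi_ge0|exact: ltW].
set K := 2 / Pt; have K0 : 0 <= K by apply: divr_ge0 => //; exact: ltW.
have pi0 : 0 < pi :> R := pi_gt0 R.
(* Bounds in the sense of [nbd], all independent of the stage: [b] for H - Hhat_l once Hhat_l - Hr
   has bound 1, [Bg] for its projection by [proj_nbd], and [Be] for the residual of that
   projection. *)
pose b := 2 * ME + 2 * 1.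
pose Bg := 16 * pi ^+ 2 * b.
pose Be := 2 * b + 2 * Bg.
have b0 : 0 <= b by rewrite /b; lra.
have Bg0 : 0 <= Bg by rewrite mulr_ge0 // mulr_ge0 // sqr_ge0.
have Be0 : 0 <= Be by rewrite /Be; lra.
have BgBe : Bg <= Be by rewrite /Be; lra.
pose Z := 1 + 4 * P * Be.
have PBe := mulr_ge0 P0 Be0.
have Z0 : 0 < Z by rewrite /Z; lra.
(* With this constant both squared pairings of Hhat_l - Hr, with v[pt] and with v[pt]', are at most
   c3 times its squared norm. *)
pose c3 := 8 * pi * P * (1 + Pt^-1 ^+ 2).
have c30 : 0 <= c3.
  rewrite mulr_ge0 //; last by rewrite addr_ge0 // sqr_ge0.
  by rewrite mulr_ge0 // mulr_ge0 // ltW.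
suff key (eta : R) : 0 < eta -> nc (ip (vker pt) E) <= eta /\ nc (ip (dvker pt) E) <= eta.
  by split; apply: nc_le_eps_eq0 => e /key [].
move=> eta0.
pose K2 := K + 2 * K ^+ 2.
have K20 : 0 <= K2 by rewrite addr_ge0 // mulr_ge0 // sqr_ge0.
have KZ0 : 0 <= K2 * Z by rewrite mulr_ge0 // ltW.
(* Points within [del] of pt have real part at least Pt/2, and a zero that close makes the pairings
   at most eta/3; [K2] covers the factors K and 2 K^2 of the estimates used below. *)
pose del := Num.min (Pt / 2) (eta / 3 / (K2 * Z + 1)).
have del0 : 0 < del by rewrite lt_min !divr_gt0 //; lra.
have delP : del <= Pt / 2 by rewrite ge_min lexx.
have delE (x c : R) : 0 <= x -> x <= del -> 0 <= c -> c <= K2 -> x * c * Z <= eta / 3.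
  move=> x0 xd c0 cK; apply: (@le_trans _ _ (del * (K2 * Z + 1))).
    rewrite -mulrA; apply: ler_pM => //; first by rewrite mulr_ge0 // ltW.
    by apply: (@le_trans _ _ (K2 * Z)); [rewrite ler_wpM2r // ltW|lra].
  by rewrite -ler_pdivlMr; [rewrite ge_min lexx orbT|lra].
have [l1 _ [d1 d1l hd1]] := hlim la hla del del0 0%N.
(* Searching only from stage l1 + 1 on, when [d1] has already joined the list, makes [d2] distinct
   from [d1] by uniqueness of the entries. *)
have [l2 l12 [d2 d2l hd2]] := hlim la hla del del0 l1.+1.
rewrite norm_lt_nc -/pt in hd1; rewrite norm_lt_nc -/pt in hd2.
have d1m : d1 \in mu l2 by apply: (mumono _ _ _ l12); rewrite hmuS mem_cat d1l orbT.
have d12 : d1 != d2.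
  apply/eqP => d12; have := umu l2.+1; rewrite hmuS cat_uniq => /and3P[_ /hasPn/(_ d2 d2l)].
  by rewrite -d12 /= d1m.
have d1P : nc (d1 - pt) <= Pt / 2 by apply: le_trans (ltW hd1) delP.
have d2P : nc (d2 - pt) <= Pt / 2 by apply: le_trans (ltW hd2) delP.
have rlam z : z \in lam -> root q z by rewrite lamq.
have [pts [hpts [et et0 hnear]]] := pole_near cpq hq ulam slam rlam del0.
(* The three bounds give, in order: [nbd] of Hhat_l - Hr at most 1, closeness [et] at the test
   points of [pole_near], and pairings at most eta/3. *)
pose h0 := Num.min (2 * pi + 1)^-1 (Num.min (et / (3 * pi)) (eta / 3 / (1 + c3))).
have h00 : 0 < h0.
  rewrite !lt_min invr_gt0; apply/and3P; split; first by clear -pi0; lra.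
    by rewrite divr_gt0 // mulr_gt0.
  by rewrite !divr_gt0 //; clear -c30; lra.
have /cvgrPdist_lt/(_ h0 h00)[N _ HN] := hcv.
(* Late enough for both [d1] and [d2] to be interpolation points and for the norm to be below
   [h0]. *)
pose l := maxn l2.+1 N.
have l2l : (l2.+1 <= l)%N by rewrite leq_maxl.
have hh := HN l (leq_maxr _ _); rewrite /= sub0r normrN in hh.
set rho := fsub (Hhat l) Hr in hh *; set h := h2norm rho in hh *.
have h_ge0 : 0 <= h by rewrite /h /h2norm sqrtr_ge0.
move: hh; rewrite ger0_norm // !lt_min => /and3P[hA hB hC].
have hrho : in_H2 rho by exact: in_H2B.
have [p1 [q1 [hq1 sp1 sq1 Hq1 lamsq]]] := in_Rr_H2 r0 (hRr l) (hpol l).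
have nrho : nbd rho (2 * pi * h ^+ 2) by exact: ratf_diff_nbd hq hq1 spq sp1 Hq1 Hrq.
have h1 : 2 * pi * h ^+ 2 <= 1.
  have : h * (2 * pi + 1) <= 1.
    by rewrite -ler_pdivlMr; [rewrite mul1r ltW|clear -pi0; lra].
  by clear -pi0 h_ge0; nra.
have rho0 : 0 <= 2 * pi * h ^+ 2.
  by rewrite mulr_ge0 ?sqr_ge0 // mulr_ge0 // ltW.
have hsq (x : R) : 0 <= x -> x ^+ 2 <= c3 * h ^+ 2 -> x <= eta / 3.
  move=> x0 hx; apply: le_trans (le_of_sqr_le c30 h_ge0 x0 hx) _.
  by rewrite mulrC -ler_pdivlMr; [exact: ltW|clear -c30; lra].
have P8 : 0 <= 8 * pi * P by rewrite mulr_ge0 // mulr_ge0 // ltW.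
have rv : nc (ip (vker pt) rho) <= eta / 3.
  apply: hsq; first exact: nc_ge0.
  rewrite ip_vker //; apply: le_trans (H2_value_le hrho hpt rho0 nrho) _.
  rewrite -/Pt -/P (_ : 4 * P * _ = 8 * pi * P * h ^+ 2); last by ring.
  rewrite ler_wpM2r ?sqr_ge0 // /c3 ler_peMr // lerDl; exact: sqr_ge0.
have rd : nc (ip (dvker pt) rho) <= eta / 3.
  apply: hsq; first exact: nc_ge0.
  apply: le_trans (dvker_ip_le hrho hpt rho0 nrho) _.
  rewrite -/Pt -/P (_ : 4 * _ * _ = 8 * pi * P * Pt^-1 ^+ 2 * h ^+ 2); last by ring.
  by rewrite ler_wpM2r ?sqr_ge0 // /c3 ler_wpM2l // lerDr.
have [|a raq1 ala] := hnear p1 q1 hq1 sq1 (leq_trans sp1 sq1) _ la hla.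
  move=> z hz; have z1 := hpts z hz; have zp : Cplus z by exact: lt_le_trans ltr01 z1.
  rewrite -Hq1 // -Hrq // -[_ - _]/(rho z).
  (* The value estimate gives 8 pi^2 h^2 at points with real part at least 1, which is below the
     square of 3 pi h. *)
  apply: (@le_trans _ _ (3 * pi * h)); last first.
    by rewrite mulrC -ler_pdivlMr ?mulr_gt0 //; exact: ltW.
  rewrite -(@ler_pXn2r _ 2) ?nnegrE ?nc_ge0 //; last first.
    by rewrite mulr_ge0 // mulr_ge0 // ltW.
  apply: le_trans (H2_value_le hrho zp rho0 nrho) _.
  apply: (@le_trans _ _ (4 * pi * (2 * pi * h ^+ 2))).
    rewrite ler_wpM2r // ler_wpM2l // ler_pdivrMr ?(lt_le_trans ltr01 z1) //.
    by rewrite ler_peMr // ltW.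
  by have := sqr_ge0 (pi * h); rewrite !exprMn; clear; lra.
have al : a \in lams l by rewrite lamsq.
have lamsC z : z \in lams l -> Cminus z by rewrite lamsq; case: hq1 => _; exact.
set a' := - conjc a.
have ha' : Cplus a' by apply: Cplus_mirror; exact: lamsC.
have a'pt : nc (a' - pt) < del by rewrite conj_mirror.
have a'P : nc (a' - pt) <= Pt / 2 by apply: le_trans (ltW a'pt) delP.
set D := fsub H (Hhat l).
have hD : in_H2 D by exact: in_H2B.
have nD : nbd D b.
  have -> : D = fun z => E z + -1 * rho z.
    by apply/funext => z; rewrite /D /E /rho /fsub; ring.
  apply: nbdD => //; first exact: in_H2Z.
  by apply: nbdN; apply: nbd_ext nrho.
have kmu := vker_elt_kernel (hmu l).
set g := Pproj (mu l) D.
have [kg og] := orth_proj_ip kmu hD; rewrite -/(Pproj _ _) -/g in kg og.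
have hg := kernel_H2 kg.
have ng : nbd g Bg by apply: proj_nbd nD (orth_proj_self kmu hD).
have gT := (orth_proj_null (Tfam_kernel lamsC) hg).1 (hQ l).
(* The optimality condition is a double zero of [g] at the mirror image of every pole of Hhat_l, in
   particular of the pole [a] close to la. *)
have [ga gda] := (Tfam_elt (fun k => ip k g = 0) (lams l)).1 gT a al.
set e := fsub D g.
have he : in_H2 e by exact: in_H2B.
have ne : nbd e Be.
  have -> : e = fun z => D z + -1 * g z by apply/funext => z; rewrite /e /fsub; ring.
  by apply: nbdD => //; [exact: in_H2Z|exact: nbdN].
have ez d : d \in mu l -> e d = 0.
  move=> dm; have hd := hmu l d dm.
  have := (vker_elt (fun k => ip k D = ip k g) (mu l)).1 og d dm.
  by rewrite /= !ip_vker // /e /fsub => ->; rewrite subrr.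
have d1e : e d1 = 0 by apply/ez/(mumono _ _ _ (ltnW l2l)).
have d2e : e d2 = 0.
  by apply/ez/(mumono _ _ _ l2l); rewrite hmuS mem_cat d2l orbT.
have gZ : 1 + 4 * P * Bg <= Z.
  by rewrite /Z lerD2l; apply: ler_wpM2l => //; exact: mulr_ge0.
have KK : 0 <= 2 * K ^+ 2 by rewrite mulr_ge0 // sqr_ge0.
have K1le : K <= K2 by rewrite lerDl.
have K2le : 2 * K ^+ 2 <= K2 by rewrite lerDr.
have ev : nc (ip (vker pt) e) <= eta / 3.
  apply: le_trans (vker_ip_near he hpt d1P Be0 ne d1e) _.
  by apply: delE; rewrite ?nc_ge0 //; exact: ltW.
have ed : nc (ip (dvker pt) e) <= eta / 3.
  apply: le_trans (dvker_ip_two_zeros he hpt d1P d2P d12 Be0 ne d1e d2e) _.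
  apply: (@le_trans _ _ (del * (2 * K ^+ 2) * Z)).
    rewrite -/Pt -/P -/K -/Z ler_wpM2r ?(ltW Z0) // (mulrA del).
    by apply: ler_wpM2r; [exact: sqr_ge0|clear -hd1 hd2; lra].
  by apply: delE => //; exact: ltW.
have gv : nc (ip (vker pt) g) <= eta / 3.
  have ga' : g a' = 0 := etrans (esym (ip_vker hg ha')) ga.
  apply: le_trans (vker_ip_near hg hpt a'P Bg0 ng ga') _.
  apply: (@le_trans _ _ (nc (a' - pt) * K * Z)).
    by rewrite ler_wpM2l // mulr_ge0 // nc_ge0.
  by apply: delE; rewrite ?nc_ge0 //; exact: ltW.
have gd : nc (ip (dvker pt) g) <= eta / 3.
  apply: le_trans (dvker_ip_near hg hpt a'P Bg0 ng gda) _.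
  apply: (@le_trans _ _ (nc (a' - pt) * (2 * K ^+ 2) * Z)).
    by rewrite ler_wpM2l // mulr_ge0 ?nc_ge0 // mulr_ge0.
  by apply: delE; rewrite ?nc_ge0 //; exact: ltW.
have EE : E = fun z => e z + (g z + rho z).
  by apply/funext => z; rewrite /e /D /E /rho /fsub; ring.
have hgr : in_H2 (fun z => g z + rho z) by exact: in_H2D.
have kv := kernel_vker hpt; have kd := kernel_dvker hpt.
have expand k : h2kernel k -> ip k E = ip k e + (ip k g + ip k rho).
  move=> hk; apply: etrans (congr1 (ip k) EE) _; apply: etrans (ipDr hk he hgr) _.
  by congr (_ + _); exact: ipDr.
by rewrite (expand _ kv) (expand _ kd); split; exact: nc_add3_le.
Qed.
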